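(* For every $m\in\mathbb{Z}$ and $z\in\mathbb{C}\setminus(-\infty,0]$, with $$\sigma_m(z) = \frac{(-1)^{m}}{\sqrt{\pi}}\,e^{\mathrm{i} z}\sum_{j=1}^{|m|}\frac{\Gamma(\frac12-j)\,\Gamma(j+|m|)}{\Gamma(|m|-j+1)}\,(2\mathrm{i} z)^{-j}$$ (the sum being zero for $m=0$), the Hankel functions of integer order satisfy $$H_m^{(1)}(z)=\frac{2\,\mathrm{i}^{m-1}}{\pi}\left[\frac{1}{\pi}\int_0^\pi e^{-\mathrm{i} z\cos\theta}\,\Gamma\big(0,-\mathrm{i} z(1+\cos\theta)\big)\cos(m\theta)\,\mathrm{d}\theta+\sigma_m(z)\right]$$ and $$H_m^{(2)}(z)=-\frac{2\,\mathrm{i}^{m-1}}{\pi}\left[\frac{1}{\pi}\int_0^\pi e^{-\mathrm{i} z\cos\theta}\Big[\Gamma\big(0,-\mathrm{i} z(1+\cos\theta)\big)-\mathrm{i}\pi\Big]\cos(m\theta)\,\mathrm{d}\theta+\sigma_m(z)\right].$$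
   Context: $H^{(1)}_m=J_m+\mathrm{i}Y_m$ and $H^{(2)}_m=J_m-\mathrm{i}Y_m$ are the Hankel functions (principal branch). $\Gamma(0,w)$ is the upper incomplete gamma function (the exponential integral $E_1(w)$): $\Gamma(0,w)=-\gamma-\ln w-\sum_{k\ge1}\frac{(-w)^k}{k\cdot k!}$, with $\gamma$ the Euler–Mascheroni constant; here, for $w=-\mathrm{i}cz$ with $c>0$, $\ln w$ means $\ln c+\ln z-\mathrm{i}\pi/2$ with $\ln z$ principal. *)

(* Defs.v *)
From Stdlib Require Import Reals ZArith.
From Coquelicot Require Import Coquelicot.

Open Scope C_scope.

(* [iota P] is the [l] such that [P l] when there is exactly one; hence [Clim]
   and [CSeries] are the limit and the sum whenever these exist. *)
Definition Clim {T : Type} (F : (T -> Prop) -> Prop) (f : T -> C) : C :=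
  iota (T := C_CompleteNormedModule)
    (fun l : C => filterlim f F (locally (T := C_UniformSpace) l)).

Definition CSeries (a : nat -> C) : C :=
  iota (T := C_CompleteNormedModule)
    (fun l : C => is_series (K := C_AbsRing) (V := C_NormedModule) a l).

Definition CpowZ (z : C) (n : Z) : C :=
  match n with
  | Z0 => 1
  | Zpos p => z ^ Pos.to_nat p
  | Zneg p => / z ^ Pos.to_nat p
  end.

Definition Cexp (z : C) : C :=
  RtoC (exp (Re z)) * (cos (Im z), sin (Im z)).

(* Principal argument, in ]-PI, PI], for [z <> 0]. *)
Definition Carg (z : C) : R :=
  if Rle_dec 0 (Im z) then acos (Re z / Cmod z) else (- acos (Re z / Cmod z))%R.

Definition Cln (z : C) : C := (ln (Cmod z), Carg z).

(* 1 / Gamma(x) for every real x, by the Euler-Gauss product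
     1 / Gamma(x) = lim_n x (x + 1) ... (x + n) / (n! n^x);
   it vanishes exactly at x = 0, -1, -2, ... *)
Definition rGamma (x : R) : R :=
  real (Lim_seq (fun n : nat =>
    (prod_f_R0 (fun k : nat => x + INR k) n
     / (INR (fact n) * Rpower (INR n) x))%R)).

(* Meaningful away from the poles 0, -1, -2, ... *)
Definition Gamma (x : R) : R := (/ rGamma x)%R.

Definition EulerMascheroni : R :=
  real (Lim_seq (fun n : nat =>
    (sum_n_m (fun k : nat => / INR k) 1 n - ln (INR n))%R)).

(* Gamma(0, w), with the value [lw] of ln w given separately because the
   logarithm used at w = - i c z is not always the principal one. *)
Definition Gamma0_log (w lw : C) : C :=
  - RtoC EulerMascheroni - lw
  - CSeries (fun k : nat =>
      (- w) ^ (S k) / (RtoC (INR (S k)) * RtoC (INR (fact (S k))))).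

(* Gamma(0, - i c z) for c > 0 and z off ]-oo, 0]. *)
Definition Gamma0_mi (c : R) (z : C) : C :=
  Gamma0_log (- Ci * RtoC c * z) (RtoC (ln c) + Cln z - Ci * RtoC PI / 2).

(* J_nu(z) = (z/2)^nu sum_k (- z^2/4)^k / (k! Gamma(nu + k + 1)), where (z/2)^nu
   is the principal power. *)
Definition BesselJ (nu : R) (z : C) : C :=
  Cexp (RtoC nu * Cln (z / 2))
  * CSeries (fun k : nat =>
      (- (z ^ 2 / 4)) ^ k
      * RtoC (/ INR (fact k) * rGamma (nu + INR k + 1))%R).

(* Bessel function of the second kind of integer order, as the limit of
   Y_nu = (J_nu cos(nu pi) - J_{-nu}) / sin(nu pi) as the order nu tends to m. *)
Definition BesselY (m : Z) (z : C) : C :=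
  Clim (locally' (IZR m)) (fun nu : R =>
    (BesselJ nu z * RtoC (cos (nu * PI)%R) - BesselJ (- nu)%R z)
    / RtoC (sin (nu * PI)%R)).

Definition Hankel1 (m : Z) (z : C) : C := BesselJ (IZR m) z + Ci * BesselY m z.

Definition Hankel2 (m : Z) (z : C) : C := BesselJ (IZR m) z - Ci * BesselY m z.

Definition sigma_m (m : Z) (z : C) : C :=
  let N := INR (Z.abs_nat m) in
  CpowZ (- (1)) m / RtoC (sqrt PI) * Cexp (Ci * z)
  * sum_n_m (G := C_AbelianMonoid) (fun j : nat =>
      RtoC (Gamma (1 / 2 - INR j) * Gamma (INR j + N) / Gamma (N - INR j + 1))%R
      * / (2 * Ci * z) ^ j)
    1 (Z.abs_nat m).

(* The integral over [0, PI] of a function that may be singular at PI. *)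
Definition is_CInt_0_PI (f : R -> C) (l : C) : Prop :=
  is_RInt_gen (V := C_R_NormedModule) f (at_point 0%R) (at_left PI) l.

(* Main.v *)
(** The bracket is an integral of G(th) = e^{-iz cos th} Gamma(0, -iz(1 + cos th)) against
    cos(m th). Integrating the derivative of sin(m th) G(th) gives a three-term relation in m
    whose inhomogeneous term is compensated by sigma_m, so that both sides of the identity obey
    the recurrence of the Bessel functions, and only m = 0 and m = 1 are left.

    On the Hankel side, Y_0 and Y_1 come from the order derivative of J_nu at nu = 0 and 1,
    which needs the expansion 1/Gamma(1 + e) = 1 + gamma e + O(e^2); the recurrence of J_nu then
    carries the limit defining Y_m to all integers m.

    On the integral side, replace z by t z with 0 < t <= 1: the integrals for m = 0, 1 and the
    candidate series satisfy, in t, the same linear system A' = -iz B + ..., B' = -iz A - B/t + ...,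
    and agree at t = 0 because the integral of ln(1 + cos th) over [0, PI] is -PI ln 2; an energy
    estimate for the homogeneous system gives equality at t = 1. *)

Require Import Defs.
From Corelib Require Import ssreflect.
From Stdlib Require Import Reals ZArith Lra Lia Psatz.
From Coquelicot Require Import Coquelicot.

Open Scope C_scope.

(** * Complex-valued functions of a real variable *)

(** The integrand has a logarithmic singularity at [th = PI], so the integral is improper and cannot
    be differentiated under the sign as it stands. Integrals over [0, PI) are therefore represented
    by primitives with a limit at PI ([has_prim]), and identities between them are proved by
    exhibiting one integrand for both sides. Before differentiating in t, the logarithm is
    integrated by parts against its own primitive, which is continuous at PI; only proper integrals
    remain ([Wf]).

    All functions are followed along the ray t z with t real, the powers of z being stored in
    coefficients, so real calculus in t replaces complex analysis. The part of Gamma(0, w) that is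
    constant in th contains the logarithm of z and only multiplies Bessel's integral for J_m; once
    it is split off, what is left is regular down to t = 0, where the system gets its initial
    values.

    The source term e^{i z t} comes from e^{-i z t cos th} e^{i z t (1 + cos th)} = e^{i z t}, which
    is independent of th. The second formula follows from the first through H2 = 2 J - H1, the
    summand - i PI being what produces 2 J_m. *)

(* Derivatives, continuity and limits of C-valued functions are handled
   componentwise, which reduces them to Coquelicot's real theory. *)
Definition Cder (f : R -> C) (x : R) (l : C) : Prop :=
  is_derive (fun t => Re (f t)) x (Re l) /\ is_derive (fun t => Im (f t)) x (Im l).

Definition Ccont {U : UniformSpace} (f : U -> C) (x : U) : Prop :=
  continuous (fun t => Re (f t)) x /\ continuous (fun t => Im (f t)) x.

Definition Ctends {T : Type} (f : T -> C) (F : (T -> Prop) -> Prop) (l : C) : Prop :=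
  filterlim (fun t => Re (f t)) F (locally (Re l))
  /\ filterlim (fun t => Im (f t)) F (locally (Im l)).

Definition CInt (f : R -> C) (a b : R) : C :=
  (RInt (fun t => Re (f t)) a b, RInt (fun t => Im (f t)) a b).

Lemma C_ext (a b : C) : Re a = Re b -> Im a = Im b -> a = b.
Proof. destruct a, b; simpl; intros -> ->; reflexivity. Qed.

Lemma Cder_eq (f : R -> C) (x : R) (l l' : C) : Cder f x l -> l = l' -> Cder f x l'.
Proof. intros H <-; exact H. Qed.

Lemma Cder_ext (f g : R -> C) (x : R) (l : C) :
  (forall t, f t = g t) -> Cder f x l -> Cder g x l.
Proof.
  intros E [H1 H2]; split.
  - apply (is_derive_ext (fun t => Re (f t))); [intro t; now rewrite E | exact H1].
  - apply (is_derive_ext (fun t => Im (f t))); [intro t; now rewrite E | exact H2].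
Qed.

Lemma Cder_ext_loc (f g : R -> C) (x : R) (l : C) :
  locally x (fun t => f t = g t) -> Cder f x l -> Cder g x l.
Proof.
  intros E [H1 H2]; split.
  - apply (is_derive_ext_loc (fun t => Re (f t))); [|exact H1].
    revert E; apply filter_imp; intros t ->; reflexivity.
  - apply (is_derive_ext_loc (fun t => Im (f t))); [|exact H2].
    revert E; apply filter_imp; intros t ->; reflexivity.
Qed.

Lemma Cder_unique (f : R -> C) (x : R) (l l' : C) : Cder f x l -> Cder f x l' -> l = l'.
Proof.
  intros [H1 H2] [H1' H2'].
  apply C_ext; [rewrite <- (is_derive_unique _ _ _ H1); apply is_derive_unique, H1'
               |rewrite <- (is_derive_unique _ _ _ H2); apply is_derive_unique, H2'].
Qed.

Lemma Cder_const (c : C) (x : R) : Cder (fun _ => c) x 0.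
Proof. split; apply: is_derive_const. Qed.

Lemma Cder_RtoC (f : R -> R) (x l : R) : is_derive f x l -> Cder (fun t => RtoC (f t)) x (RtoC l).
Proof. intro H; split; [exact H | apply: is_derive_const]. Qed.

Lemma Cder_id (x : R) : Cder (fun t => RtoC t) x 1.
Proof. apply (Cder_RtoC (fun t => t)); apply: is_derive_id. Qed.

Lemma Cder_plus (f g : R -> C) (x : R) (l m : C) :
  Cder f x l -> Cder g x m -> Cder (fun t => f t + g t) x (l + m).
Proof.
  intros [H1 H2] [K1 K2]; split;
    apply: (is_derive_plus (K := R_AbsRing) (V := R_NormedModule)); assumption.
Qed.

Lemma Cder_opp (f : R -> C) (x : R) (l : C) : Cder f x l -> Cder (fun t => - f t) x (- l).
Proof.
  intros [H1 H2]; split; apply: (is_derive_opp (K := R_AbsRing) (V := R_NormedModule)); assumption.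
Qed.

Lemma Cder_minus (f g : R -> C) (x : R) (l m : C) :
  Cder f x l -> Cder g x m -> Cder (fun t => f t - g t) x (l - m).
Proof. intros H K; apply Cder_plus; [exact H | apply Cder_opp, K]. Qed.

Lemma Cder_mult (f g : R -> C) (x : R) (l m : C) :
  Cder f x l -> Cder g x m -> Cder (fun t => f t * g t) x (l * g x + f x * m).
Proof.
  intros [H1 H2] [K1 K2]; split; simpl.
  - evar_last.
    { apply: (is_derive_minus (K := R_AbsRing) (V := R_NormedModule));
      apply: is_derive_mult; try eassumption; intros; apply Rmult_comm. }
    unfold minus, plus, opp, mult; simpl; unfold Re, Im; ring.
  - evar_last.
    { apply: (is_derive_plus (K := R_AbsRing) (V := R_NormedModule));
      apply: is_derive_mult; try eassumption; intros; apply Rmult_comm. }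
    unfold minus, plus, opp, mult; simpl; unfold Re, Im; ring.
Qed.

Lemma Cder_scal (c : C) (f : R -> C) (x : R) (l : C) :
  Cder f x l -> Cder (fun t => c * f t) x (c * l).
Proof.
  intro H; eapply Cder_eq; [apply (Cder_mult _ _ _ _ _ (Cder_const c x) H)|ring].
Qed.

Lemma Cder_comp (f : R -> C) (g : R -> R) (x : R) (l : C) (m : R) :
  Cder f (g x) l -> is_derive g x m -> Cder (fun t => f (g t)) x (RtoC m * l).
Proof.
  intros [H1 H2] K; split.
  - evar_last; [apply (is_derive_comp (K := R_AbsRing) (V := R_NormedModule) (fun y => Re (f y)) g _ _ _ H1 K)|].
    unfold scal; simpl; unfold mult; simpl; unfold Re, Im; ring.
  - evar_last; [apply (is_derive_comp (K := R_AbsRing) (V := R_NormedModule) (fun y => Im (f y)) g _ _ _ H2 K)|].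
    unfold scal; simpl; unfold mult; simpl; unfold Re, Im; ring.
Qed.

Lemma Cder_Cexp (f : R -> C) (x : R) (l : C) :
  Cder f x l -> Cder (fun t => Cexp (f t)) x (l * Cexp (f x)).
Proof.
  intros [H1 H2].
  assert (G : forall (u v : R -> R) (a b : R), is_derive u x a -> is_derive v x b ->
    is_derive (fun t => exp (u t) * cos (v t))%R x
      (a * (exp (u x) * cos (v x)) - b * (exp (u x) * sin (v x)))%R
    /\ is_derive (fun t => exp (u t) * sin (v t))%R x
      (a * (exp (u x) * sin (v x)) + b * (exp (u x) * cos (v x)))%R).
  { intros u v a b Ha Hb.
    assert (ex_derive u x) by (eexists; exact Ha).
    assert (ex_derive v x) by (eexists; exact Hb).
    split; auto_derive; auto; rewrite (is_derive_unique _ _ _ Ha) (is_derive_unique _ _ _ Hb); ring. }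
  destruct (G _ _ _ _ H1 H2) as [G1 G2].
  split.
  - apply (is_derive_ext (fun t => exp (Re (f t)) * cos (Im (f t))))%R.
    { intro t; unfold Cexp; simpl; ring. }
    evar_last; [exact G1|]. unfold Cexp, Re, Im; simpl; ring.
  - apply (is_derive_ext (fun t => exp (Re (f t)) * sin (Im (f t))))%R.
    { intro t; unfold Cexp; simpl; ring. }
    evar_last; [exact G2|]. unfold Cexp, Re, Im; simpl; ring.
Qed.

Lemma Cder_zero_const (f : R -> C) (a b : R) :
  (forall t, a <= t <= b -> Cder f t 0)%R -> (a <= b)%R -> f a = f b.
Proof.
  intros H [L| ->]; [|reflexivity].
  apply C_ext.
  - apply (eq_is_derive (V := R_NormedModule) (fun t => Re (f t))); [|exact L].
    intros t Ht; apply (H t Ht).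
  - apply (eq_is_derive (V := R_NormedModule) (fun t => Im (f t))); [|exact L].
    intros t Ht; apply (H t Ht).
Qed.

Lemma Cder_Ccont (f : R -> C) (x : R) (l : C) : Cder f x l -> Ccont f x.
Proof.
  intros [H1 H2]; split; apply @ex_derive_continuous; eexists; eassumption.
Qed.

Lemma Ccont_const {U : UniformSpace} (c : C) (x : U) : Ccont (fun _ => c) x.
Proof. split; apply continuous_const. Qed.

Lemma Ccont_RtoC {U : UniformSpace} (f : U -> R) (x : U) :
  continuous f x -> Ccont (fun t => RtoC (f t)) x.
Proof. intro H; split; [exact H|apply continuous_const]. Qed.

Lemma Ccont_plus {U : UniformSpace} (f g : U -> C) (x : U) :
  Ccont f x -> Ccont g x -> Ccont (fun t => f t + g t) x.
Proof.
  intros [H1 H2] [K1 K2]; split.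
  - exact (continuous_plus (V := R_NormedModule) _ _ _ H1 K1).
  - exact (continuous_plus (V := R_NormedModule) _ _ _ H2 K2).
Qed.

Lemma Ccont_opp {U : UniformSpace} (f : U -> C) (x : U) :
  Ccont f x -> Ccont (fun t => - f t) x.
Proof.
  intros [H1 H2]; split.
  - exact (continuous_opp (V := R_NormedModule) _ _ H1).
  - exact (continuous_opp (V := R_NormedModule) _ _ H2).
Qed.

Lemma Ccont_minus {U : UniformSpace} (f g : U -> C) (x : U) :
  Ccont f x -> Ccont g x -> Ccont (fun t => f t - g t) x.
Proof. intros H K; apply Ccont_plus; [exact H|apply Ccont_opp, K]. Qed.

Lemma Ccont_mult {U : UniformSpace} (f g : U -> C) (x : U) :
  Ccont f x -> Ccont g x -> Ccont (fun t => f t * g t) x.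
Proof.
  intros [H1 H2] [K1 K2]; split.
  - exact (continuous_minus (V := R_NormedModule) _ _ _
      (continuous_mult (K := R_AbsRing) _ _ _ H1 K1) (continuous_mult (K := R_AbsRing) _ _ _ H2 K2)).
  - exact (continuous_plus (V := R_NormedModule) _ _ _
      (continuous_mult (K := R_AbsRing) _ _ _ H1 K2) (continuous_mult (K := R_AbsRing) _ _ _ H2 K1)).
Qed.

Lemma Ccont_comp {U V : UniformSpace} (f : V -> C) (g : U -> V) (x : U) :
  Ccont f (g x) -> continuous g x -> Ccont (fun t => f (g t)) x.
Proof.
  intros [H1 H2] K; split.
  - exact (continuous_comp g (fun y => Re (f y)) x K H1).
  - exact (continuous_comp g (fun y => Im (f y)) x K H2).
Qed.

Lemma Ccont_Cexp {U : UniformSpace} (f : U -> C) (x : U) :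
  Ccont f x -> Ccont (fun t => Cexp (f t)) x.
Proof.
  intros [H1 H2]. unfold Cexp. apply Ccont_mult.
  - apply Ccont_RtoC. exact (continuous_comp _ exp _ H1 (continuous_exp _)).
  - split; simpl.
    + exact (continuous_comp _ cos _ H2 (continuous_cos _)).
    + exact (continuous_comp _ sin _ H2 (continuous_sin _)).
Qed.

Lemma Cexp_plus (a b : C) : Cexp (a + b) = Cexp a * Cexp b.
Proof.
  destruct a as [a1 a2], b as [b1 b2]; unfold Cexp; simpl.
  rewrite exp_plus cos_plus sin_plus.
  apply C_ext; simpl; ring.
Qed.

Lemma Cexp_0 : Cexp 0 = 1.
Proof. unfold Cexp; simpl; rewrite exp_0 cos_0 sin_0; apply C_ext; simpl; ring. Qed.

Lemma Cexp_opp (a : C) : Cexp a * Cexp (- a) = 1.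
Proof. rewrite <- Cexp_plus; replace (a + - a) with (RtoC 0) by ring; apply Cexp_0. Qed.

Lemma CInt_is_RInt (f : R -> C) (a b : R) :
  (forall t, Rmin a b <= t <= Rmax a b -> Ccont f t)%R ->
  is_RInt (fun t => Re (f t)) a b (Re (CInt f a b))
  /\ is_RInt (fun t => Im (f t)) a b (Im (CInt f a b)).
Proof.
  intro H; split; apply (RInt_correct (V := R_CompleteNormedModule));
    apply (ex_RInt_continuous (V := R_CompleteNormedModule)); intros t Ht; apply (H t Ht).
Qed.

(** The margin [e] guarantees that the integral exists for all upper bounds near [b], on both sides;
    a two-sided derivative at an end point of the interval needs this. *)
Lemma Cder_CInt (f : R -> C) (a b : R) (e : posreal) :
  (forall t, Rmin a b - e <= t <= Rmax a b + e -> Ccont f t)%R ->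
  Cder (fun x => CInt f a x) b (f b).
Proof.
  intro H.
  assert (K : locally b (fun y => forall t, (Rmin a y <= t <= Rmax a y)%R -> Ccont f t)).
  { exists e. intros y Hy t Ht. apply H. 
    change (Rabs (y - b) < e)%R in Hy. apply Rabs_def2 in Hy.
    revert Ht; unfold Rmin, Rmax; destruct (Rle_dec a y), (Rle_dec a b); lra. }
  assert (Hb : Ccont f b).
  { apply H. assert (e0 := cond_pos e). unfold Rmin, Rmax; destruct (Rle_dec a b); lra. }
  split; simpl.
  - apply (is_derive_RInt (V := R_NormedModule) (fun t => Re (f t)) _ a); [|apply Hb].
    revert K; apply filter_imp; intros y Hy; apply (CInt_is_RInt f a y Hy).
  - apply (is_derive_RInt (V := R_NormedModule) (fun t => Im (f t)) _ a); [|apply Hb].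
    revert K; apply filter_imp; intros y Hy; apply (CInt_is_RInt f a y Hy).
Qed.

Lemma Cder_CInt_param (f ft : R -> R -> C) (a b x : R) :
  (forall t u, Cder (fun s => f s u) t (ft t u)) ->
  (forall u, Rmin a b <= u <= Rmax a b ->
     Ccont (U := prod_UniformSpace R_UniformSpace R_UniformSpace)
       (fun p => ft (fst p) (snd p)) (x, u))%R ->
  (forall t u, Rmin a b <= u <= Rmax a b -> Ccont (f t) u)%R ->
  Cder (fun t => CInt (f t) a b) x (CInt (ft x) a b).
Proof.
  intros D Cd Cc.
  assert (G : forall (p : C -> R),
    (forall t u, is_derive (fun s => p (f s u)) t (p (ft t u))) ->
    (forall u, (Rmin a b <= u <= Rmax a b)%R ->
     continuous (T := prod_UniformSpace R_UniformSpace R_UniformSpace) (U := R_UniformSpace)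
       (fun q => p (ft (fst q) (snd q))) (x, u)) ->
    (forall t u, (Rmin a b <= u <= Rmax a b)%R -> continuous (fun v => p (f t v)) u) ->
    is_derive (fun t => RInt (fun u => p (f t u)) a b) x (RInt (fun u => p (ft x u)) a b)).
  { intros p D' Cd' Cc'.
    evar_last.
    - apply (is_derive_RInt_param (fun t u => p (f t u)) a b x).
      + apply filter_forall; intros t u Hu; eexists; apply D'.
      + intros u Hu.
        apply (continuity_2d_pt_ext (fun t v => p (ft t v))).
        { intros t v; symmetry; apply is_derive_unique, D'. }
        apply continuity_2d_pt_filterlim. apply (Cd' u Hu).
      + apply filter_forall; intros t.
        apply (ex_RInt_continuous (V := R_CompleteNormedModule)); intros; apply Cc'; assumption.
    - apply RInt_ext; intros u Hu. apply is_derive_unique, D'. }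
  split; apply G; intros; try apply D; try (apply Cd; assumption); apply Cc; assumption.
Qed.

(** * Entire power series with complex coefficients *)

Lemma pow_fact_le_exp (x : R) (n : nat) : (0 <= x)%R -> (x ^ n / INR (fact n) <= exp x)%R.
Proof.
  intro Hx. eapply Rle_trans; [|apply (exp_ge_taylor x n Hx)].
  destruct n as [|n]; [simpl; lra|].
  rewrite tech5.
  enough (0 <= sum_f_R0 (fun k => x ^ k / INR (fact k))%R n)%R by lra.
  apply cond_pos_sum; intro k. apply Rle_mult_inv_pos; [apply pow_le, Hx|apply INR_fact_lt_0].
Qed.

(** For every real r the terms [b n * r ^ n] stay below M exp(K |r|), so the radius of convergence
    exceeds every real. *)
Lemma CV_radius_fast (b : nat -> R) (M K : R) :
  (0 <= K)%R -> (forall n, Rabs (b n) <= M * K ^ n / INR (fact n))%R -> CV_radius b = p_infty.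
Proof.
  intros HK Hb.
  assert (H : forall r : R, Rbar_le r (CV_radius b)).
  { intro r. apply (CV_radius_bounded b).
    exists (M * exp (K * Rabs r))%R; intro n.
    rewrite Rabs_mult -RPow_abs.
    assert (HM : (0 <= M)%R).
    { assert (h := Hb 0%nat); simpl in h. assert (h' := Rabs_pos (b 0%nat)); lra. }
    assert (P := pow_fact_le_exp (K * Rabs r) n (Rmult_le_pos _ _ HK (Rabs_pos r))).
    apply Rle_trans with (M * ((K * Rabs r) ^ n / INR (fact n)))%R.
    - rewrite Rpow_mult_distr.
      replace (M * (K ^ n * Rabs r ^ n / INR (fact n)))%R
        with (M * K ^ n / INR (fact n) * Rabs r ^ n)%R by (field; apply INR_fact_neq_0).
      apply Rmult_le_compat_r; [apply pow_le, Rabs_pos | apply Hb].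
    - apply Rmult_le_compat_l; assumption. }
  destruct (CV_radius b) as [r| |]; [|reflexivity|].
  - assert (h := H (r + 1)%R); simpl in h; lra.
  - assert (h := H 0%R); simpl in h; tauto.
Qed.

Lemma is_series_fast (M K : R) :
  is_series (fun n => M * K ^ n / INR (fact n))%R (M * exp K)%R.
Proof.
  apply (is_series_ext (fun n => scal M (K ^ n / INR (fact n))%R)).
  { intro n; unfold scal; simpl; unfold mult; simpl. unfold Rdiv; ring. }
  apply: (is_series_scal (V := R_NormedModule)).
  assert (H := is_exp_Reals K).
  apply: is_series_ext H; intro n; unfold scal; simpl; unfold mult; simpl.
  rewrite pow_n_pow; reflexivity.
Qed.

(** The exponential, the Bessel series and the series of Gamma(0, w) all have coefficients of this
    size. The bound is stable under sums, multiples and shifts, gives an infinite radius, and its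
    explicit constants yield estimates uniform in a parameter. *)
Definition Cfast (a : nat -> C) : Prop :=
  exists M K : R, (0 <= K)%R /\ forall n, (Cmod (a n) <= M * K ^ n / INR (fact n))%R.

(** Complex coefficients but a real variable: a complex argument is absorbed into the coefficients,
    so the real theory applies to each component. *)
Definition CPS (a : nat -> C) (x : R) : C :=
  (PSeries (fun n => Re (a n)) x, PSeries (fun n => Im (a n)) x).

Lemma Re_Cmod (z : C) : (Rabs (Re z) <= Cmod z)%R.
Proof. apply Rle_trans with (2 := Rmax_Cmod z), Rmax_l. Qed.

Lemma Im_Cmod (z : C) : (Rabs (Im z) <= Cmod z)%R.
Proof. apply Rle_trans with (2 := Rmax_Cmod z), Rmax_r. Qed.

Lemma Cfast_radius (a : nat -> C) : Cfast a ->
  CV_radius (fun n => Re (a n)) = p_infty /\ CV_radius (fun n => Im (a n)) = p_infty.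
Proof.
  intros (M & K & HK & H); split; apply (CV_radius_fast _ M K HK); intro n.
  - eapply Rle_trans; [apply Re_Cmod | apply H].
  - eapply Rle_trans; [apply Im_Cmod | apply H].
Qed.

Lemma Cis_series (b : nat -> C) (lr li : R) :
  is_series (fun n => Re (b n)) lr -> is_series (fun n => Im (b n)) li ->
  is_series (K := C_AbsRing) (V := C_NormedModule) b (lr, li).
Proof.
  intros H1 H2.
  assert (E : forall n, sum_n (G := C_AbelianMonoid) b n
     = (sum_n (fun k => Re (b k)) n, sum_n (fun k => Im (b k)) n)).
  { induction n as [|n IH]; [rewrite !sum_O; apply C_ext; reflexivity|].
    rewrite !sum_Sn IH; apply C_ext; reflexivity. }
  unfold is_series in *.
  apply (filterlim_ext (F := eventually)
    (fun n => (sum_n (fun k => Re (b k)) n, sum_n (fun k => Im (b k)) n) : C_UniformSpace)).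
  { intro n; symmetry; apply E. }
  intros P [eps HP].
  destruct (H1 _ (locally_ball lr eps)) as [N1 HN1].
  destruct (H2 _ (locally_ball li eps)) as [N2 HN2].
  exists (max N1 N2); intros n Hn; apply HP; split; simpl; [apply HN1|apply HN2]; lia.
Qed.

Lemma CSeries_unique (b : nat -> C) (l : C) :
  is_series (K := C_AbsRing) (V := C_NormedModule) b l -> CSeries b = l.
Proof.
  intro H. unfold CSeries.
  apply (iota_filterlim_locally (V := C_CompleteNormedModule) (F := eventually)
     (sum_n (G := C_AbelianMonoid) b) l H).
Qed.

Lemma is_series_CPS (a : nat -> C) (x : R) : Cfast a ->
  is_series (K := C_AbsRing) (V := C_NormedModule) (fun n => a n * RtoC x ^ n) (CPS a x).
Proof.
  intro H; destruct (Cfast_radius a H) as [R1 R2].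
  assert (G : forall b : nat -> R, CV_radius b = p_infty -> is_series (fun n => b n * x ^ n)%R (PSeries b x)).
  { intros b Hb. apply (is_series_ext (fun n => scal (pow_n x n) (b n))).
    { intro n; unfold scal; simpl; unfold mult; simpl; rewrite pow_n_pow; ring. }
    apply (PSeries_correct b x). apply CV_radius_inside; rewrite Hb; exact I. }
  apply Cis_series.
  - apply (is_series_ext (fun n => Re (a n) * x ^ n)%R); [|apply G, R1].
    intro n; rewrite -RtoC_pow; unfold Re, RtoC; simpl; ring.
  - apply (is_series_ext (fun n => Im (a n) * x ^ n)%R); [|apply G, R2].
    intro n; rewrite -RtoC_pow; unfold Im, RtoC; simpl; ring.
Qed.

Lemma CPS_ext (a b : nat -> C) (x : R) : (forall n, a n = b n) -> CPS a x = CPS b x.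
Proof. intro H; unfold CPS; f_equal; apply PSeries_ext; intro n; now rewrite H. Qed.

Lemma CPS_0 (a : nat -> C) : CPS a 0 = a 0%nat.
Proof. unfold CPS; rewrite !PSeries_0; apply C_ext; reflexivity. Qed.

(** Real and imaginary parts are each dominated by M exp(K |x|), hence the factor 2. The explicit
    constant is what later controls the remainder of an expansion in the order. *)
Lemma CPS_bound (a : nat -> C) (M K x : R) :
  (0 <= K)%R -> (forall n, (Cmod (a n) <= M * K ^ n / INR (fact n))%R) ->
  (Cmod (CPS a x) <= 2 * (M * exp (K * Rabs x)))%R.
Proof.
  intros HK Ha.
  assert (G : forall p : nat -> R, (forall n, (Rabs (p n) <= M * K ^ n / INR (fact n)))%R ->
     (Rabs (PSeries p x) <= M * exp (K * Rabs x))%R).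
  { intros p Hp. unfold PSeries.
    assert (Q : forall n, (0 <= Rabs (p n * x ^ n) <= M * (K * Rabs x) ^ n / INR (fact n))%R).
    { intro n; split; [apply Rabs_pos|]. rewrite Rabs_mult -RPow_abs Rpow_mult_distr.
      replace (M * (K ^ n * Rabs x ^ n) / INR (fact n))%R
        with (M * K ^ n / INR (fact n) * Rabs x ^ n)%R by (field; apply INR_fact_neq_0).
      apply Rmult_le_compat_r; [apply pow_le, Rabs_pos | apply Hp]. }
    assert (S := is_series_fast M (K * Rabs x)).
    rewrite -(is_series_unique _ _ S).
    eapply Rle_trans; [apply Series_Rabs|apply Series_le; [exact Q|eexists; exact S]].
    apply (ex_series_le (V := R_CompleteNormedModule) _ (fun n => M * (K * Rabs x) ^ n / INR (fact n))%R).
    - intro n; unfold norm; simpl; unfold abs; simpl. rewrite Rabs_Rabsolu; apply Q.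
    - eexists; exact S. }
  assert (G1 := G _ (fun n => Rle_trans _ _ _ (Re_Cmod (a n)) (Ha n))).
  assert (G2 := G _ (fun n => Rle_trans _ _ _ (Im_Cmod (a n)) (Ha n))).
  replace (CPS a x) with (RtoC (Re (CPS a x)) + Ci * RtoC (Im (CPS a x))).
  2: { apply C_ext; simpl; ring. }
  eapply Rle_trans; [apply Cmod_triangle|].
  rewrite Cmod_mult Cmod_Ci !Cmod_R. unfold CPS, Re, Im; simpl. unfold Re, Im in G1, G2. lra.
Qed.

Definition Cderiv (a : nat -> C) (n : nat) : C := RtoC (INR (S n)) * a (S n).

Lemma Cder_CPS (a : nat -> C) (x : R) : Cfast a -> Cder (CPS a) x (CPS (Cderiv a) x).
Proof.
  intro H; destruct (Cfast_radius a H) as [R1 R2].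
  split; unfold CPS, Re, Im; cbn [fst snd].
  - evar_last; [apply is_derive_PSeries; rewrite R1; exact I|].
    apply PSeries_ext; intro n; unfold PS_derive, Cderiv; generalize (INR (S n)); intro u; destruct (a (S n)); simpl; ring.
  - evar_last; [apply is_derive_PSeries; rewrite R2; exact I|].
    apply PSeries_ext; intro n; unfold PS_derive, Cderiv; generalize (INR (S n)); intro u; destruct (a (S n)); simpl; ring.
Qed.

Lemma CPS_decr (a : nat -> C) (x : R) : Cfast a ->
  CPS a x = a 0%nat + RtoC x * CPS (fun n => a (S n)) x.
Proof.
  intro H; destruct (Cfast_radius a H) as [R1 R2].
  apply C_ext; simpl.
  - rewrite PSeries_decr_1; [|apply CV_radius_inside; rewrite R1; exact I].
    unfold PS_decr_1, Re, Im; simpl; ring.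
  - rewrite PSeries_decr_1; [|apply CV_radius_inside; rewrite R2; exact I].
    unfold PS_decr_1, Re, Im; simpl; ring.
Qed.

Lemma CPS_plus (a b : nat -> C) (x : R) : Cfast a -> Cfast b ->
  CPS (fun n => a n + b n) x = CPS a x + CPS b x.
Proof.
  intros H K; destruct (Cfast_radius a H) as [R1 R2], (Cfast_radius b K) as [R3 R4].
  apply C_ext; simpl.
  - rewrite -PSeries_plus; [reflexivity| |]; apply CV_radius_inside; rewrite ?R1 ?R3; exact I.
  - rewrite -PSeries_plus; [reflexivity| |]; apply CV_radius_inside; rewrite ?R2 ?R4; exact I.
Qed.

Lemma is_pseries_R (b : nat -> R) (x : R) : CV_radius b = p_infty -> ex_pseries b x.
Proof. intro H; apply CV_radius_inside; rewrite H; exact I. Qed.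

Lemma CPS_scal (c : C) (a : nat -> C) (x : R) : Cfast a ->
  CPS (fun n => c * a n) x = c * CPS a x.
Proof.
  intros H; destruct (Cfast_radius a H) as [R1 R2].
  assert (P : forall (u v : R) (b d : nat -> R), CV_radius b = p_infty -> CV_radius d = p_infty ->
    PSeries (fun n => u * b n + v * d n)%R x = (u * PSeries b x + v * PSeries d x)%R).
  { intros u v b d Hb Hd.
    rewrite -!PSeries_scal -PSeries_plus.
    - reflexivity.
    - apply (ex_pseries_scal (V := R_NormedModule)); [apply Rmult_comm|apply is_pseries_R, Hb].
    - apply (ex_pseries_scal (V := R_NormedModule)); [apply Rmult_comm|apply is_pseries_R, Hd]. }
  apply C_ext; simpl.
  - rewrite (PSeries_ext _ (fun n => Re c * Re (a n) + (- Im c) * Im (a n))%R);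
      [|intro n; unfold Re, Im; simpl; ring]. rewrite P //. unfold Re, Im; ring.
  - rewrite (PSeries_ext _ (fun n => Re c * Im (a n) + Im c * Re (a n))%R);
      [|intro n; unfold Re, Im; simpl; ring]. rewrite P //.
Qed.

Lemma Cfast_ext (a b : nat -> C) : (forall n, a n = b n) -> Cfast a -> Cfast b.
Proof. intros E (M & K & HK & H); exists M, K; split; [exact HK|]; intro n; now rewrite -E. Qed.

Lemma Cfast_scal (c : C) (a : nat -> C) : Cfast a -> Cfast (fun n => c * a n).
Proof.
  intros (M & K & HK & H); exists (Cmod c * M)%R, K; split; [exact HK|]; intro n.
  rewrite Cmod_mult. replace (Cmod c * M * K ^ n / INR (fact n))%R
    with (Cmod c * (M * K ^ n / INR (fact n)))%R by (unfold Rdiv; ring).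
  apply Rmult_le_compat_l; [apply Cmod_ge_0|apply H].
Qed.

Lemma Cfast_plus (a b : nat -> C) : Cfast a -> Cfast b -> Cfast (fun n => a n + b n).
Proof.
  intros (M & K & HK & H) (M' & K' & HK' & H').
  exists (M + M')%R, (Rmax K K'); split; [eapply Rle_trans; [exact HK|apply Rmax_l]|]; intro n.
  assert (HM : (0 <= M)%R).
  { assert (h := H 0%nat); simpl in h. assert (h' := Cmod_ge_0 (a 0%nat)); lra. }
  assert (HM' : (0 <= M')%R).
  { assert (h := H' 0%nat); simpl in h. assert (h' := Cmod_ge_0 (b 0%nat)); lra. }
  assert (P1 : (K ^ n <= Rmax K K' ^ n)%R) by (apply pow_incr; split; [exact HK|apply Rmax_l]).
  assert (P2 : (K' ^ n <= Rmax K K' ^ n)%R) by (apply pow_incr; split; [exact HK'|apply Rmax_r]).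
  assert (F : (0 < / INR (fact n))%R) by apply Rinv_0_lt_compat, INR_fact_lt_0.
  eapply Rle_trans; [apply Cmod_triangle|].
  eapply Rle_trans; [apply Rplus_le_compat; [apply H|apply H']|].
  unfold Rdiv. rewrite -Rmult_plus_distr_r. apply Rmult_le_compat_r; [lra|]. nra.
Qed.

Lemma Cfast_shift (a : nat -> C) : Cfast a -> Cfast (fun n => a (S n)).
Proof.
  intros (M & K & HK & H); exists (M * K)%R, K; split; [exact HK|]; intro n.
  assert (HM : (0 <= M)%R).
  { assert (h := H 0%nat); simpl in h. assert (h' := Cmod_ge_0 (a 0%nat)); lra. }
  eapply Rle_trans; [apply H|].
  simpl pow. replace (M * (K * K ^ n))%R with (M * K * K ^ n)%R by ring.
  apply Rmult_le_compat_l; [apply Rmult_le_pos; [apply Rmult_le_pos; assumption|apply pow_le, HK]|].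
  apply Rinv_le_contravar; [apply INR_fact_lt_0|]. apply le_INR, fact_le; lia.
Qed.

Lemma Cfast_pow_fact (q : C) (r : nat -> R) (M K : R) :
  (0 <= K)%R -> (forall n, Rabs (r n) <= M * K ^ n)%R ->
  Cfast (fun n => q ^ n * RtoC (r n / INR (fact n))%R).
Proof.
  intros HK H; exists M, (Cmod q * K)%R; split; [apply Rmult_le_pos; [apply Cmod_ge_0|exact HK]|].
  intro n; rewrite Cmod_mult Cmod_pow Cmod_R Rpow_mult_distr.
  unfold Rdiv; rewrite Rabs_mult (Rabs_right (/ INR (fact n))).
  2: { apply Rle_ge, Rlt_le, Rinv_0_lt_compat, INR_fact_lt_0. }
  replace (M * (Cmod q ^ n * K ^ n) * / INR (fact n))%R
    with (Cmod q ^ n * ((M * K ^ n) * / INR (fact n)))%R by ring.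
  apply Rmult_le_compat_l; [apply pow_le, Cmod_ge_0|].
  apply Rmult_le_compat_r; [apply Rlt_le, Rinv_0_lt_compat, INR_fact_lt_0|apply H].
Qed.

Lemma RtoC_nz (x : R) : x <> 0%R -> RtoC x <> 0.
Proof. intros H E; apply H, RtoC_inj, E. Qed.

Lemma INR_S_fact (n : nat) : RtoC (INR (fact (S n))) = RtoC (INR (S n)) * RtoC (INR (fact n)).
Proof. rewrite -RtoC_mult -mult_INR; reflexivity. Qed.

Lemma RtoC_fact_nz (n : nat) : RtoC (INR (fact n)) <> 0.
Proof. apply RtoC_nz, INR_fact_neq_0. Qed.

Lemma RtoC_INR_S_nz (n : nat) : RtoC (INR (S n)) <> 0.
Proof. apply RtoC_nz, not_0_INR; lia. Qed.

(** The series satisfies f' = w f and f(0) = 1, so its product with e^{-w t} has derivative zero and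
    equals 1 everywhere. *)
Lemma Cexp_CPS (w : C) (x : R) :
  Cfast (fun n => w ^ n * RtoC (1 / INR (fact n))%R)
  /\ CPS (fun n => w ^ n * RtoC (1 / INR (fact n))%R) x = Cexp (w * RtoC x).
Proof.
  assert (F : Cfast (fun n => w ^ n * RtoC (1 / INR (fact n))%R)).
  { apply (Cfast_pow_fact w (fun _ => 1%R) 1 1); [lra|intro n; rewrite pow1 Rabs_R1; lra]. }
  split; [exact F|].
  set (a := fun n => _) in *.
  assert (D : forall t, Cder (CPS a) t (w * CPS a t)).
  { intro t. eapply Cder_eq; [apply Cder_CPS, F|].
    rewrite -CPS_scal //. apply CPS_ext; intro n; unfold Cderiv, a.
    rewrite !RtoC_div; try apply INR_fact_neq_0.
    rewrite INR_S_fact Cpow_S. field.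
    split; [apply RtoC_fact_nz|apply RtoC_INR_S_nz]. }
  assert (D2 : forall t, Cder (fun t => CPS a t * Cexp (- (w * RtoC t))) t 0).
  { intro t. eapply Cder_eq.
    - apply Cder_mult; [apply D|]. apply Cder_Cexp, Cder_opp, Cder_scal, Cder_id.
    - cbv beta; ring. }
  assert (Z : forall t, CPS a t * Cexp (- (w * RtoC t)) = 1).
  { assert (Z0 : CPS a 0 * Cexp (- (w * RtoC 0)) = 1).
    { rewrite CPS_0. replace (- (w * 0)) with (RtoC 0) by ring. rewrite Cexp_0.
      unfold a; simpl. replace (1/1)%R with 1%R by field. ring. }
    intro t. destruct (Rle_dec 0 t).
    - rewrite -Z0; symmetry; apply (Cder_zero_const _ 0 t (fun s _ => D2 s)); assumption.
    - rewrite -Z0; apply (Cder_zero_const _ t 0 (fun s _ => D2 s)); lra. }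
  specialize (Z x). assert (O := Cexp_opp (w * RtoC x)).
  transitivity (CPS a x * (Cexp (w * RtoC x) * Cexp (- (w * RtoC x)))); [rewrite O; ring|].
  transitivity (Cexp (w * RtoC x) * (CPS a x * Cexp (- (w * RtoC x)))); [ring|rewrite Z; ring].
Qed.

(** * The reciprocal gamma function *)

Open Scope R_scope.

Lemma Series_Rabs_le (a b : nat -> R) :
  (forall n, Rabs (a n) <= b n) -> ex_series b -> ex_series a /\ Rabs (Series a) <= Series b.
Proof.
  intros H E.
  assert (E' : ex_series (fun n => Rabs (a n))).
  { apply (ex_series_le (V := R_CompleteNormedModule) _ b); [|exact E].
    intro n; unfold norm; simpl; unfold abs; simpl; rewrite Rabs_Rabsolu; apply H. }
  split; [apply ex_series_Rabs, E'|].
  eapply Rle_trans; [apply Series_Rabs, E'|].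
  apply Series_le; [|exact E]. intro n; split; [apply Rabs_pos|apply H].
Qed.

Lemma sum_Sn_R (a : nat -> R) (n : nat) : sum_n a (S n) = sum_n a n + a (S n).
Proof. exact (sum_Sn (G := R_AbelianMonoid) a n). Qed.

(** Comparison with the telescoping series of 2 (1/(k+1) - 1/(k+2)). *)
Lemma ex_series_inv_sq : ex_series (fun k => / (INR k + 1) ^ 2).
Proof.
  apply (ex_series_le (V := R_CompleteNormedModule) _ (fun k => 2 * (/ (INR k + 1) - / (INR k + 2)))).
  - intro k; unfold norm; simpl; unfold abs; simpl. assert (h := pos_INR k).
    rewrite Rabs_right; [|apply Rle_ge, Rlt_le, Rinv_0_lt_compat; nra].
    replace (2 * (/ (INR k + 1) - / (INR k + 2))) with (2 / ((INR k + 1) * (INR k + 2))) by (field; lra).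
    apply Rmult_le_reg_r with ((INR k + 1) * (INR k + 1) * (INR k + 2)); [nra|].
    field_simplify; nra.
  - apply (ex_series_scal_l (V := R_NormedModule) 2).
    exists 1. change (is_lim_seq (sum_n (fun k => / (INR k + 1) - / (INR k + 2))) 1).
    apply (is_lim_seq_ext (fun n => 1 - / (INR n + 2))).
    + induction n as [|n IH]; [rewrite sum_O; simpl; field|].
      rewrite sum_Sn -IH S_INR. unfold plus; simpl. assert (h := pos_INR n). field. lra.
    + evar_last; [apply is_lim_seq_minus'; [apply is_lim_seq_const|]|].
      * apply (is_lim_seq_inv _ p_infty); [|discriminate].
        eapply is_lim_seq_plus; [apply is_lim_seq_INR|apply (is_lim_seq_const 2)|reflexivity].
      * simpl; f_equal; ring.
Qed.

Lemma ln_1p_bounds (x : R) : -1 < x -> x / (1 + x) <= ln (1 + x) <= x.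
Proof.
  intro Hx. 
  assert (U : forall y, 0 < y -> ln y <= y - 1).
  { intros y Hy. assert (h := exp_ineq1_le (ln y)). rewrite exp_ln in h; lra. }
  split; [|assert (h := U (1 + x)); lra].
  assert (h : 0 < / (1 + x)) by (apply Rinv_0_lt_compat; lra). apply U in h.
  rewrite ln_Rinv in h; [|lra]. replace (x / (1 + x)) with (1 - / (1 + x)) by (field; lra). lra.
Qed.

Lemma ln_1p_sub (x : R) : - / 2 <= x -> Rabs (ln (1 + x) - x) <= 2 * x ^ 2.
Proof.
  intro Hx. destruct (ln_1p_bounds x ltac:(lra)) as [H1 H2].
  assert (x - x / (1 + x) <= 2 * x ^ 2).
  { replace (x - x / (1 + x)) with (x ^ 2 * / (1 + x)) by (field; lra).
    rewrite (Rmult_comm 2). apply Rmult_le_compat_l; [apply pow2_ge_0|].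
    rewrite -(Rinv_inv 2). apply Rinv_le_contravar; lra. }
  apply Rabs_le; split; [lra|]. assert (h := pow2_ge_0 x); lra.
Qed.

(** Logarithm of the factor (1 + e/(k+1)) e^{-e/(k+1)} of Weierstrass's product for 1/Gamma(1 +
    e). *)
Definition log_rest (e : R) (k : nat) : R := ln (1 + e / (INR k + 1)) - e / (INR k + 1).

Lemma log_rest_series (e : R) : - / 2 <= e ->
  ex_series (log_rest e)
  /\ Rabs (Series (log_rest e)) <= 2 * e ^ 2 * Series (fun k => / (INR k + 1) ^ 2).
Proof.
  intro He. rewrite -Series_scal_l.
  apply Series_Rabs_le; [|apply (ex_series_scal_l (V := R_NormedModule)), ex_series_inv_sq].
  intro k. assert (h := pos_INR k).
  replace (2 * e ^ 2 * / (INR k + 1) ^ 2) with (2 * (e / (INR k + 1)) ^ 2) by (field; lra).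
  apply ln_1p_sub.
  apply Rmult_le_reg_r with (INR k + 1); [lra|]. field_simplify; [|lra]. lra.
Qed.

Lemma sum_log_rest (e : R) (n : nat) :
  sum_n (log_rest e) n
  = sum_n (fun k => ln (1 + e / (INR k + 1))) n - e * sum_n (fun k => / (INR k + 1)) n.
Proof.
  induction n as [|n IH]; [rewrite !sum_O; unfold log_rest; simpl; field|].
  rewrite !sum_Sn IH; unfold plus, log_rest; simpl. assert (h := pos_INR n).
  unfold Rdiv; ring.
Qed.

Lemma sum_n_m_shift1 (a : nat -> R) (n : nat) : sum_n_m a 1 (S n) = sum_n (fun k => a (S k)) n.
Proof. unfold sum_n; rewrite sum_n_m_S; reflexivity. Qed.

Lemma is_lim_seq_ratio (c : R) : is_lim_seq (fun n => (INR n + 1 + c) / (INR n + 1)) 1.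
Proof.
  apply (is_lim_seq_ext (fun n => 1 + c * / (INR n + 1))).
  { intro n; assert (h := pos_INR n); field; lra. }
  evar_last; [apply is_lim_seq_plus'; [apply is_lim_seq_const|]|].
  - apply is_lim_seq_mult'; [apply is_lim_seq_const|].
    apply (is_lim_seq_inv _ p_infty); [|discriminate].
    eapply is_lim_seq_plus; [apply is_lim_seq_INR|apply (is_lim_seq_const 1)|reflexivity].
  - simpl; f_equal; ring.
Qed.

Lemma is_lim_seq_ln_ratio (c : R) : is_lim_seq (fun n => ln ((INR n + 1 + c) / (INR n + 1))) 0.
Proof.
  rewrite -ln_1. apply (is_lim_seq_continuous ln); [|apply is_lim_seq_ratio].
  apply continuity_pt_filterlim. apply continuous_ln. lra.
Qed.

(** At e = 1 the logarithms in [log_rest] telescope to ln(n + 2), so summability of [log_rest 1] is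
    the existence of the limit that [Lim_seq] only names. *)
Lemma is_lim_EulerMascheroni :
  is_lim_seq (fun n => sum_n (fun k => / (INR k + 1)) n - ln (INR n + 1)) EulerMascheroni.
Proof.
  assert (E : forall n, sum_n (log_rest 1) n = ln (INR n + 2) - sum_n (fun k => / (INR k + 1)) n).
  { intro n; rewrite sum_log_rest Rmult_1_l; f_equal.
    induction n as [|n IH]; [rewrite sum_O; simpl; f_equal; field|].
    rewrite sum_Sn IH S_INR; unfold plus; simpl. assert (h := pos_INR n).
    assert (0 < 1 / (INR n + 1)) by (apply Rdiv_lt_0_compat; lra).
    replace (INR n + 1 + 2) with ((INR n + 2) * (1 + 1 / (INR n + 1 + 1))) by (field; lra).
    rewrite ln_mult; [ring|lra|]. apply Rplus_lt_0_compat; [lra|apply Rdiv_lt_0_compat; lra]. }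
  destruct (log_rest_series 1 ltac:(lra)) as [[l Hl] _].
  assert (G : is_lim_seq (fun n => sum_n (fun k => / (INR k + 1)) n - ln (INR n + 1)) (- l)).
  { apply (is_lim_seq_ext (fun n => - sum_n (log_rest 1) n + ln ((INR n + 1 + 1) / (INR n + 1)))).
    - intro n; rewrite E. assert (h := pos_INR n). rewrite ln_div; [|lra|lra].
      replace (INR n + 1 + 1) with (INR n + 2) by ring. ring.
    - evar_last; [apply is_lim_seq_plus'; [|apply is_lim_seq_ln_ratio]|].
      + apply (is_lim_seq_opp (sum_n (log_rest 1)) l). exact Hl.
      + simpl; f_equal; ring. }
  assert (G' : is_lim_seq (fun n => sum_n_m (fun k => / INR k) 1 n - ln (INR n)) (- l)).
  { apply is_lim_seq_incr_1. apply: is_lim_seq_ext G. intro n.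
    rewrite sum_n_m_shift1 S_INR. f_equal. apply sum_n_ext; intro k; now rewrite S_INR. }
  unfold EulerMascheroni. rewrite (is_lim_seq_unique _ _ G'). exact G.
Qed.

Lemma prod_f_R0_S (f : nat -> R) (n : nat) : prod_f_R0 f (S n) = prod_f_R0 f n * f (S n).
Proof. reflexivity. Qed.

Definition gamma_prod (x : R) (n : nat) : R :=
  prod_f_R0 (fun k => x + INR k) n / (INR (fact n) * Rpower (INR n) x).

(** Stated at [S n] because n^{x+1} = n^x n needs a positive base. *)
Lemma gamma_prod_shift (x : R) (n : nat) :
  gamma_prod x (S n) * (x + 2 + INR n) = gamma_prod (x + 1) (S n) * x * (INR n + 1).
Proof.
  unfold gamma_prod.
  assert (P : forall n, prod_f_R0 (fun k => x + 1 + INR k) n * x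
    = prod_f_R0 (fun k => x + INR k) n * (x + 1 + INR n)).
  { clear n; induction n as [|n IH]; [simpl; ring|].
    rewrite !prod_f_R0_S !S_INR.
    transitivity (prod_f_R0 (fun k => x + 1 + INR k) n * x * (x + 1 + (INR n + 1))); [ring|].
    rewrite IH; ring. }
  specialize (P (S n)). rewrite S_INR in P. rewrite Rpower_plus S_INR Rpower_1; [|assert (h := pos_INR n); lra].
  assert (h := pos_INR n). assert (Rpower (INR n + 1) x <> 0) by (apply Rgt_not_eq, exp_pos).
  assert (F := INR_fact_neq_0 (S n)).
  replace (prod_f_R0 (fun k => x + 1 + INR k) (S n) / (INR (fact (S n)) * (Rpower (INR n + 1) x * (INR n + 1))) * x * (INR n + 1))
    with (prod_f_R0 (fun k => x + 1 + INR k) (S n) * x / (INR (fact (S n)) * Rpower (INR n + 1) x)) by (field; repeat split; try assumption; lra).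
  rewrite P. field; split; assumption.
Qed.

(** Trading ln n for the harmonic number turns the Euler-Gauss product into Weierstrass's. The three
    summands of the exponent tend to the sum of [log_rest e], to e gamma and to 0; the bound on e
    keeps every logarithm's argument positive. *)
Lemma gamma_prod_log (e : R) (n : nat) : - / 2 <= e ->
  gamma_prod (1 + e) (S n)
  = exp (sum_n (log_rest e) n
         + e * (sum_n (fun k => / (INR k + 1)) n - ln (INR n + 1)) + ln ((INR n + 1 + (1 + e)) / (INR n + 1))).
Proof.
  intro He. rewrite sum_log_rest. assert (h := pos_INR n).
  assert (Q : forall n, 0 < 1 + e / (INR n + 1)).
  { intro k; assert (hk := pos_INR k).
    replace (1 + e / (INR k + 1)) with ((INR k + 1 + e) / (INR k + 1)) by (field; lra).
    apply Rdiv_lt_0_compat; lra. }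
  assert (P : forall n, prod_f_R0 (fun k => 1 + e + INR k) n
    = exp (sum_n (fun k => ln (1 + e / (INR k + 1))) n) * INR (fact (S n))).
  { clear n h; induction n as [|n IH].
    - rewrite sum_O exp_ln //. simpl; field.
    - rewrite prod_f_R0_S IH sum_Sn_R exp_plus exp_ln //.
      rewrite (fact_simpl (S n)) mult_INR !S_INR. assert (h := pos_INR n). field; lra. }
  unfold gamma_prod. rewrite prod_f_R0_S P Rpower_plus (S_INR n) Rpower_1; [|lra].
  rewrite !exp_plus (exp_ln ((INR n + 1 + (1 + e)) / (INR n + 1))); [|apply Rdiv_lt_0_compat; lra].
  unfold Rpower.
  replace (sum_n (fun k => ln (1 + e / (INR k + 1))) n - e * sum_n (fun k => / (INR k + 1)) n)
    with (sum_n (fun k => ln (1 + e / (INR k + 1))) n + - (e * sum_n (fun k => / (INR k + 1)) n)) by ring.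
  replace (e * (sum_n (fun k => / (INR k + 1)) n - ln (INR n + 1)))
    with (e * sum_n (fun k => / (INR k + 1)) n + - (e * ln (INR n + 1))) by ring.
  rewrite !exp_plus !exp_Ropp.
  field. repeat split; try (apply Rgt_not_eq, exp_pos); try lra; apply INR_fact_neq_0.
Qed.

Lemma rGamma_1p (e : R) : - / 2 <= e ->
  is_lim_seq (gamma_prod (1 + e)) (exp (Series (log_rest e) + e * EulerMascheroni)).
Proof.
  intro He. apply is_lim_seq_incr_1.
  eapply is_lim_seq_ext; [intro n; symmetry; apply gamma_prod_log, He|].
  apply (is_lim_seq_continuous exp).
  { apply derivable_continuous_pt, derivable_pt_exp. }
  evar_last; [apply is_lim_seq_plus'; [apply is_lim_seq_plus'|]|].
  - apply (Series_correct (log_rest e)), log_rest_series, He.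
  - apply is_lim_seq_mult'; [apply is_lim_seq_const|apply is_lim_EulerMascheroni].
  - apply is_lim_seq_ln_ratio.
  - f_equal; ring.
Qed.

Lemma gamma_prod_lim_step (x l : R) :
  is_lim_seq (gamma_prod (x + 1)) l -> is_lim_seq (gamma_prod x) (x * l).
Proof.
  intro H. apply is_lim_seq_incr_1. apply is_lim_seq_incr_1 in H.
  set (N := fun n => gamma_prod (x + 1) (S n) * x * / ((INR n + 1 + (x + 1)) / (INR n + 1))).
  apply (is_lim_seq_ext_loc N).
  (* The divisor x + 2 + n is sure to be nonzero once n is large compared with |x|, so the equality
     is only claimed eventually. *)
  - destruct (nfloor_ex (Rabs x + 3)) as [n0 Hn0]; [assert (h := Rabs_pos x); lra|].
    exists n0; intros n Hn. apply le_INR in Hn.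
    assert (h := Rabs_le_between x (Rabs x)). assert (h' := proj1 h (Rle_refl _)).
    assert (hn := pos_INR n).
    unfold N. replace (gamma_prod x (S n)) with (gamma_prod x (S n) * (x + 2 + INR n) / (x + 2 + INR n)) by (field; lra).
    rewrite gamma_prod_shift. field. split; lra.
  - unfold N. evar_last; [apply is_lim_seq_mult'|].
    + apply is_lim_seq_mult'; [exact H|apply is_lim_seq_const].
    + apply (is_lim_seq_inv _ 1); [apply is_lim_seq_ratio|]. intro E; injection E; lra.
    + simpl; f_equal; field.
Qed.

(** Convergence is known for x >= 1/2; each use of the functional equation carries it one unit
    further to the left. This is what makes [rGamma] a true limit at every real. *)
Lemma gamma_prod_lim (x : R) : exists l : R, is_lim_seq (gamma_prod x) l.
Proof.
  assert (G : forall (N : nat) (x : R), / 2 <= x + INR N -> exists l : R, is_lim_seq (gamma_prod x) l).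
  { induction N as [|N IH]; intros y Hy.
    - simpl in Hy. replace y with (1 + (y - 1)) by ring. eexists; apply rGamma_1p; lra.
    - rewrite S_INR in Hy. destruct (IH (y + 1)) as [l Hl]; [lra|].
      eexists; apply gamma_prod_lim_step, Hl. }
  destruct (nfloor_ex (Rabs x + 1)) as [n0 Hn0]; [assert (h := Rabs_pos x); lra|].
  apply (G (S n0)). rewrite S_INR.
  assert (h' := proj1 (Rabs_le_between x (Rabs x)) (Rle_refl _)). lra.
Qed.

Lemma rGamma_lim (x : R) : is_lim_seq (gamma_prod x) (rGamma x).
Proof.
  destruct (gamma_prod_lim x) as [l Hl].
  replace (rGamma x) with l; [exact Hl|].
  unfold rGamma. symmetry. apply (f_equal real (is_lim_seq_unique _ _ Hl)).
Qed.

Lemma rGamma_unique (x l : R) : is_lim_seq (gamma_prod x) l -> rGamma x = l.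
Proof. intro H. apply (f_equal real (is_lim_seq_unique _ _ H)). Qed.

Lemma rGamma_step (x : R) : rGamma x = x * rGamma (x + 1).
Proof. apply rGamma_unique, gamma_prod_lim_step, rGamma_lim. Qed.

Lemma rGamma_1 : rGamma 1 = 1.
Proof.
  replace 1 with (1 + 0) at 1 by ring. rewrite (rGamma_unique _ _ (rGamma_1p 0 ltac:(lra))).
  destruct (log_rest_series 0 ltac:(lra)) as [_ H].
  replace (2 * 0 ^ 2 * Series (fun k => / (INR k + 1) ^ 2)) with 0 in H by ring.
  assert (h := Rabs_pos (Series (log_rest 0))).
  assert (E : Series (log_rest 0) = 0).
  { destruct (Req_dec (Series (log_rest 0)) 0) as [E|E]; [exact E|]. apply Rabs_pos_lt in E; lra. }
  rewrite E Rmult_0_l Rplus_0_l; apply exp_0.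
Qed.

Lemma rGamma_fact (n : nat) : rGamma (INR n + 1) = / INR (fact n).
Proof.
  induction n as [|n IH]; [simpl; rewrite Rplus_0_l Rinv_1; apply rGamma_1|].
  rewrite rGamma_step in IH. assert (h := pos_INR n).
  rewrite S_INR fact_simpl mult_INR S_INR. 
  apply Rmult_eq_reg_l with (INR n + 1); [|lra]. rewrite IH. field. split; [apply INR_fact_neq_0|lra].
Qed.

Lemma is_derive_quadratic (f : R -> R) (l K : R) :
  (forall e, Rabs e <= / 2 -> Rabs (f e - f 0 - e * l) <= K * e ^ 2) -> is_derive f 0 l.
Proof.
  intro B.
  assert (HK : 0 <= K).
  { assert (h := B (/ 2) ltac:(rewrite Rabs_right; lra)).
    assert (h' := Rabs_pos (f (/ 2) - f 0 - / 2 * l)). lra. }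
  apply is_derive_Reals. intros eps Heps.
  assert (Hd : 0 < Rmin (/ 2) (eps / (K + 1))).
  { apply Rmin_pos; [lra|apply Rdiv_lt_0_compat; lra]. }
  exists (mkposreal _ Hd). intros h Hh Hlt; simpl in Hlt.
  assert (Hl1 := Rlt_le_trans _ _ _ Hlt (Rmin_l _ _)).
  assert (Hl2 := Rlt_le_trans _ _ _ Hlt (Rmin_r _ _)).
  rewrite Rplus_0_l.
  replace ((f h - f 0) / h - l) with ((f h - f 0 - h * l) / h) by (field; exact Hh).
  unfold Rdiv; rewrite Rabs_mult Rabs_inv.
  apply Rabs_pos_lt in Hh.
  apply Rle_lt_trans with (K * Rabs h).
  - apply Rmult_le_reg_r with (Rabs h); [exact Hh|].
    rewrite Rmult_assoc Rinv_l ?Rmult_1_r; [|lra].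
    eapply Rle_trans; [apply B; lra|].
    rewrite -(pow2_abs h). apply Req_le; ring.
  - apply Rle_lt_trans with ((K + 1) * Rabs h); [nra|].
    apply Rmult_lt_reg_l with (/ (K + 1)); [apply Rinv_0_lt_compat; lra|].
    rewrite -Rmult_assoc Rinv_l; [|lra]. rewrite Rmult_1_l Rmult_comm. exact Hl2.
Qed.

(** Near 0 the function is exp(S(e) + gamma e), where S, the sum of [log_rest e], is bounded by a
    multiple of e^2. Thus S has derivative 0 at 0 without any termwise differentiation, and only
    gamma survives. *)
Lemma is_derive_rGamma_1 : is_derive (fun e => rGamma (1 + e)) 0 EulerMascheroni.
Proof.
  set (S2 := Series (fun k => / (INR k + 1) ^ 2)).
  assert (B : forall e, - / 2 <= e -> Rabs (Series (log_rest e)) <= 2 * e ^ 2 * S2).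
  { intros e He; apply log_rest_series, He. }
  assert (S0 : 0 <= S2).
  { assert (h := B 1 ltac:(lra)). assert (h' := Rabs_pos (Series (log_rest 1))). lra. }
  assert (Z : Series (log_rest 0) = 0).
  { assert (h := B 0 ltac:(lra)). replace (2 * 0 ^ 2 * S2) with 0 in h by ring.
    destruct (Req_dec (Series (log_rest 0)) 0) as [E|E]; [exact E|]. apply Rabs_pos_lt in E; lra. }
  assert (D : is_derive (fun e => Series (log_rest e)) 0 0).
  { apply (is_derive_quadratic _ 0 (2 * S2)). intros e He. rewrite Z.
    replace (Series (log_rest e) - 0 - e * 0) with (Series (log_rest e)) by ring.
    eapply Rle_trans; [apply B|apply Req_le; ring]. apply Rabs_le_between in He; lra. }
  apply (is_derive_ext_loc (fun e => exp (Series (log_rest e) + e * EulerMascheroni))).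
  { exists (mkposreal (/ 2) ltac:(lra)). intros y Hy. change (Rabs (y - 0) < / 2) in Hy.
    apply Rabs_def2 in Hy. symmetry; apply rGamma_unique, rGamma_1p; lra. }
  assert (G : forall u : R -> R, u 0 = 0 -> is_derive u 0 0 ->
    is_derive (fun e => exp (u e + e * EulerMascheroni)) 0 EulerMascheroni).
  { intros u Zu Du. assert (ex_derive u 0) by (eexists; exact Du).
    auto_derive; [auto|].
    rewrite (is_derive_unique _ _ _ Du) Zu Rmult_0_l Rplus_0_l exp_0. ring. }
  exact (G _ Z D).
Qed.

Open Scope C_scope.

(** * Bessel functions of real order *)

Lemma Cmod_sqr (z : C) : (Cmod z ^ 2 = Re z ^ 2 + Im z ^ 2)%R.
Proof. unfold Cmod; rewrite pow2_sqrt; [reflexivity|]. apply Rplus_le_le_0_compat; apply pow2_ge_0. Qed.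

Lemma Cexp_Cln (z : C) : z <> 0 -> Cexp (Cln z) = z.
Proof.
  intro Hz. assert (H0 := proj1 (Cmod_gt_0 z) Hz).
  assert (Q := Cmod_sqr z).
  assert (B := Rabs_le_between (Re z) (Cmod z)). assert (B' := proj1 B (Re_Cmod z)). clear B.
  assert (E : (Re z = Cmod z * (Re z / Cmod z))%R) by (field; lra).
  assert (I : (-1 <= Re z / Cmod z <= 1)%R).
  { split; apply Rmult_le_reg_r with (Cmod z); try assumption; unfold Rdiv;
    rewrite Rmult_assoc Rinv_l; lra. }
  assert (S : (Cmod z * sqrt (1 - (Re z / Cmod z)²) = Rabs (Im z))%R).
  { rewrite -(sqrt_Rsqr_abs (Im z)) -{1}(sqrt_Rsqr (Cmod z)); [|lra].
    rewrite -sqrt_mult_alt; [|apply Rle_0_sqr]. f_equal. unfold Rsqr. 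
    replace (Im z * Im z)%R with (Cmod z ^ 2 - Re z ^ 2)%R by (rewrite Q; ring). field. lra. }
  unfold Cln, Cexp. cbn [Re Im fst snd]. rewrite exp_ln //. unfold Carg.
  destruct (Rle_dec 0 (Im z)) as [HI|HI].
  - rewrite cos_acos // sin_acos //. apply C_ext; simpl.
    + unfold Re in *; field; lra.
    + rewrite Rabs_right in S; [|lra]. unfold Im, Re in *; rewrite -S; ring.
  - rewrite cos_neg sin_neg cos_acos // sin_acos //. apply C_ext; simpl.
    + unfold Re in *; field; lra.
    + rewrite Rabs_left in S; [|lra]. unfold Im, Re in *. lra.
Qed.

Lemma Cln_half (z : C) : z <> 0 -> Cln (z / 2) = Cln z - RtoC (ln 2).
Proof.
  intro Hz. assert (H0 := proj1 (Cmod_gt_0 z) Hz).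
  assert (M : Cmod (z / 2) = (Cmod z / 2)%R).
  { rewrite Cmod_div; [|apply RtoC_nz; lra]. rewrite Cmod_R Rabs_right; [reflexivity|lra]. }
  assert (ER : Re (z / 2) = (Re z / 2)%R) by (unfold Re, Im; simpl; field).
  assert (EI : Im (z / 2) = (Im z / 2)%R) by (unfold Re, Im; simpl; field).
  assert (D : (Re (z / 2) / Cmod (z / 2) = Re z / Cmod z)%R) by (rewrite M ER; field; lra).
  unfold Cln, Carg. rewrite D M EI ln_div; [|lra|lra]. apply C_ext.
  - unfold Re, RtoC; simpl; ring.
  - simpl. destruct (Rle_dec 0 (Im z / 2)), (Rle_dec 0 (Im z)); lra.
Qed.

(** With q = - z^2/4 and the series evaluated at 1, this is J_nu without its power (z/2)^nu; the
    argument sits in q, which leaves the order as the variable. *)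
Definition bessel_coef (q : C) (nu : R) (k : nat) : C :=
  q ^ k * RtoC (rGamma (nu + INR k + 1) / INR (fact k))%R.

Lemma eventually_decr_bounded (u : nat -> R) (k0 : nat) :
  (forall k, (k0 <= k)%nat -> (Rabs (u (S k)) <= Rabs (u k))%R) ->
  exists M : R, forall k, (Rabs (u k) <= M)%R.
Proof.
  intro H. exists (sum_f_R0 (fun k => Rabs (u k)) k0).
  assert (A : forall n, (n <= k0)%nat -> (Rabs (u n) <= sum_f_R0 (fun k => Rabs (u k)) k0)%R).
  { clear H. induction k0 as [|k0 IH]; intros n Hn.
    - replace n with 0%nat by lia. simpl; lra.
    - simpl sum_f_R0. assert (h := Rabs_pos (u (S k0))).
      destruct (Nat.eq_dec n (S k0)) as [->|N].
      + assert (0 <= sum_f_R0 (fun k => Rabs (u k)) k0)%R by (apply cond_pos_sum; intro; apply Rabs_pos). lra.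
      + assert (h' := IH n ltac:(lia)). lra. }
  assert (B : forall n, (Rabs (u (k0 + n)%nat) <= Rabs (u k0))%R).
  { induction n as [|n IH]; [rewrite Nat.add_0_r; lra|].
    rewrite Nat.add_succ_r. eapply Rle_trans; [apply H; lia|exact IH]. }
  intro k. destruct (Nat.le_gt_cases k k0) as [L|L]; [apply A, L|].
  replace k with (k0 + (k - k0))%nat by lia. eapply Rle_trans; [apply B|apply A; lia].
Qed.

(** From 1/Gamma(x) = x / Gamma(x + 1), the sequence |1/Gamma(nu + k + 1)| decreases as soon as nu +
    k + 1 >= 1, hence is bounded. *)
Lemma bessel_coef_fast (q : C) (nu : R) : Cfast (bessel_coef q nu).
Proof.
  destruct (nfloor_ex (Rabs nu + 1)) as [k0 Hk0]; [assert (h := Rabs_pos nu); lra|].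
  destruct (eventually_decr_bounded (fun k => rGamma (nu + INR k + 1)) k0) as [M HM].
  - intros k Hk. apply le_INR in Hk.
    assert (h := proj1 (Rabs_le_between nu (Rabs nu)) (Rle_refl _)).
    rewrite (rGamma_step (nu + INR k + 1)) Rabs_mult S_INR.
    replace (nu + (INR k + 1) + 1)%R with (nu + INR k + 1 + 1)%R by ring.
    assert (1 <= Rabs (nu + INR k + 1))%R by (rewrite Rabs_right; lra).
    assert (h' := Rabs_pos (rGamma (nu + INR k + 1 + 1))). nra.
  - apply (Cfast_pow_fact q _ M 1); [lra|]. intro k; rewrite pow1 Rmult_1_r; apply HM.
Qed.

Lemma BesselJ_CPS (nu : R) (z : C) :
  BesselJ nu z = Cexp (RtoC nu * Cln (z / 2)) * CPS (bessel_coef (- (z ^ 2 / 4)) nu) 1.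
Proof.
  unfold BesselJ. f_equal. apply CSeries_unique.
  apply: is_series_ext (is_series_CPS _ 1 (bessel_coef_fast _ _)).
  intro n. unfold bessel_coef. rewrite Cpow_1_l Cmult_1_r. f_equal. f_equal. unfold Rdiv; ring.
Qed.

(** The functional equation of 1/Gamma gives c_{nu-1,k} = (nu + k) c_{nu,k}, and the series of k
    c_{nu,k} is, after one index shift, q times the series of order nu + 1. *)
Lemma bessel_coef_rec (q : C) (nu : R) :
  CPS (bessel_coef q (nu - 1)) 1 - q * CPS (bessel_coef q (nu + 1)) 1
  = RtoC nu * CPS (bessel_coef q nu) 1.
Proof.
  set (d := fun k => RtoC (INR k) * bessel_coef q nu k).
  assert (S : forall k, d (S k) = q * bessel_coef q (nu + 1) k).
  { intro k. unfold d, bessel_coef. rewrite !RtoC_div; try apply INR_fact_neq_0.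
    rewrite INR_S_fact Cpow_S S_INR.
    replace (nu + 1 + INR k + 1)%R with (nu + (INR k + 1) + 1)%R by ring.
    rewrite -S_INR. field. split; [apply RtoC_fact_nz|apply RtoC_INR_S_nz]. }
  assert (E : forall k, bessel_coef q (nu - 1) k = RtoC nu * bessel_coef q nu k + d k).
  { intro k; unfold d, bessel_coef. replace (nu - 1 + INR k + 1)%R with (nu + INR k)%R by ring.
    rewrite (rGamma_step (nu + INR k)) !RtoC_div; try apply INR_fact_neq_0.
    rewrite RtoC_mult RtoC_plus. unfold Cdiv; ring. }
  assert (F : Cfast d).
  { apply (Cfast_ext (fun k => bessel_coef q (nu - 1) k + RtoC (- nu) * bessel_coef q nu k)).
    - intro k; rewrite E RtoC_opp; ring.
    - apply Cfast_plus; [|apply Cfast_scal]; apply bessel_coef_fast. }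
  rewrite (CPS_ext _ _ 1 E) CPS_plus; [|apply Cfast_scal, bessel_coef_fast|exact F].
  rewrite CPS_scal; [|apply bessel_coef_fast].
  rewrite (CPS_decr d 1 F) (CPS_ext _ _ 1 S) CPS_scal; [|apply bessel_coef_fast].
  unfold d; simpl INR. ring.
Qed.

Lemma C_nz_half (z : C) : z <> 0 -> z / 2 <> 0.
Proof.
  intros Hz E; apply Hz. replace z with (z / 2 * 2) by (field; apply RtoC_nz; lra). rewrite E; ring.
Qed.

Lemma C2_nz : RtoC 2 <> 0. Proof. apply RtoC_nz; lra. Qed.

Lemma BesselJ_rec (nu : R) (z : C) : z <> 0 ->
  BesselJ (nu - 1) z + BesselJ (nu + 1) z = 2 * RtoC nu / z * BesselJ nu z.
Proof.
  intro Hz. rewrite !BesselJ_CPS.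
  assert (E := Cexp_Cln _ (C_nz_half z Hz)).
  set (L := Cln (z / 2)) in *. set (q := - (z ^ 2 / 4)).
  assert (P : Cexp (RtoC (nu + 1) * L) = Cexp (RtoC nu * L) * (z / 2)).
  { rewrite -E -Cexp_plus RtoC_plus; f_equal; ring. }
  assert (M : Cexp (RtoC (nu - 1) * L) * (z / 2) = Cexp (RtoC nu * L)).
  { rewrite -E -Cexp_plus RtoC_minus; f_equal; ring. }
  assert (R := bessel_coef_rec q nu).
  rewrite P -M.
  transitivity (Cexp (RtoC (nu - 1) * L) * (CPS (bessel_coef q (nu - 1)) 1 - q * CPS (bessel_coef q (nu + 1)) 1)).
  - unfold q. field.
  - rewrite R. field. exact Hz.
Qed.

(** * Expansion of the Bessel series in the order near 0 and 1 *)

(** 1 / ((1 + e)(2 + e)...(k + e)), the quotient of 1/Gamma(1 + e + k) by 1/Gamma(1 + e). With Gamma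
    factored out, a rational function of e remains, to be expanded at e = 0. *)
Fixpoint rpoch (e : R) (k : nat) : R :=
  match k with O => 1%R | S k => (rpoch e k / (INR k + 1 + e))%R end.

Fixpoint harm (k : nat) : R := match k with O => 0%R | S k => (harm k + / (INR k + 1))%R end.

Lemma rGamma_rpoch (e : R) (k : nat) : (- 1 < e)%R ->
  rGamma (1 + e + INR k) = (rGamma (1 + e) * rpoch e k)%R.
Proof.
  intro He. induction k as [|k IH]; [simpl; rewrite Rplus_0_r Rmult_1_r; reflexivity|].
  assert (h := pos_INR k). rewrite rGamma_step in IH. simpl rpoch. rewrite S_INR.
  replace (1 + e + (INR k + 1))%R with (1 + e + INR k + 1)%R by ring.
  apply Rmult_eq_reg_l with (1 + e + INR k)%R; [|lra]. rewrite IH. field. lra.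
Qed.

Lemma rpoch_0 (k : nat) : rpoch 0 k = (/ INR (fact k))%R.
Proof.
  induction k as [|k IH]; [simpl; lra|].
  simpl rpoch. rewrite IH fact_simpl mult_INR S_INR. assert (h := pos_INR k).
  field; split; [apply INR_fact_neq_0|lra].
Qed.

Lemma harm_bounds (k : nat) : (0 <= harm k <= INR k)%R.
Proof.
  induction k as [|k IH]; [simpl; lra|]. simpl harm. rewrite S_INR. assert (h := pos_INR k).
  assert (0 < / (INR k + 1))%R by (apply Rinv_0_lt_compat; lra).
  assert (/ (INR k + 1) <= 1)%R by (rewrite -Rinv_1; apply Rinv_le_contravar; lra). lra.
Qed.

Lemma rpoch_factor (e : R) (k : nat) : (Rabs e <= / 2)%R -> (0 < / (INR k + 1 + e) <= 2)%R.
Proof.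
  intro He. apply Rabs_le_between in He. assert (h := pos_INR k).
  split; [apply Rinv_0_lt_compat; lra|]. rewrite -(Rinv_inv 2); apply Rinv_le_contravar; lra.
Qed.

Lemma rpoch_bound (e : R) (k : nat) : (Rabs e <= / 2 -> 0 <= rpoch e k <= 2 ^ k)%R.
Proof.
  intro He; induction k as [|k IH]; [simpl; lra|].
  simpl rpoch; simpl pow. assert (h := rpoch_factor e k He). unfold Rdiv; nra.
Qed.

(** First-order expansion with logarithmic derivative - H_k. The constant may grow geometrically in
    k, since another factor 1/k! is still available in the series. *)
Lemma rpoch_expand (e : R) (k : nat) : (Rabs e <= / 2 ->
  Rabs (rpoch e k - (1 - e * harm k) / INR (fact k)) <= e ^ 2 * 4 ^ k)%R.
Proof.
  intro He; induction k as [|k IH].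
  { simpl. replace (1 - (1 - e * 0) / 1)%R with 0%R by field. rewrite Rabs_R0. nra. }
  assert (Fk := INR_fact_lt_0 k). assert (hk := pos_INR k). assert (b := rpoch_factor e k He).
  assert (He' := proj1 (Rabs_le_between _ _) He).
  simpl rpoch; simpl harm; simpl pow. rewrite fact_simpl mult_INR S_INR.
  (* The old error is multiplied by 1/(k+1+e) <= 2 and a new term of at most 2 e^2 is added; 2 * 4^k
     + 2 <= 4^{k+1} closes the induction. *)
  replace (rpoch e k / (INR k + 1 + e) - (1 - e * (harm k + / (INR k + 1))) / ((INR k + 1) * INR (fact k)))%R
    with ((rpoch e k - (1 - e * harm k) / INR (fact k)) * / (INR k + 1 + e)
          + e ^ 2 * ((harm k + / (INR k + 1)) / (INR k + 1) * / INR (fact k) * / (INR k + 1 + e)))%R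
    by (field; lra).
  eapply Rle_trans; [apply Rabs_triang|].
  assert (H4 : (1 <= 4 ^ k)%R) by (apply pow_R1_Rle; lra).
  assert (T : (0 <= (harm k + / (INR k + 1)) / (INR k + 1) * / INR (fact k) * / (INR k + 1 + e) <= 2)%R).
  { assert (B := harm_bounds (S k)). simpl harm in B. rewrite S_INR in B.
    assert (T1 : (0 <= (harm k + / (INR k + 1)) / (INR k + 1) <= 1)%R).
    { split; [apply Rdiv_le_0_compat; lra|].
      apply Rmult_le_reg_r with (INR k + 1)%R; [lra|]. unfold Rdiv. rewrite Rmult_assoc Rinv_l; lra. }
    assert (T2 : (0 < / INR (fact k) <= 1)%R).
    { split; [apply Rinv_0_lt_compat, Fk|]. rewrite -Rinv_1. apply Rinv_le_contravar; [lra|].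
      apply (le_INR 1), lt_O_fact. }
    set (u := ((harm k + / (INR k + 1)) / (INR k + 1))%R) in *. set (v := (/ INR (fact k))%R) in *.
    assert (0 <= u * v <= 1)%R by nra. nra. }
  rewrite Rabs_mult (Rabs_right (/ (INR k + 1 + e))); [|lra].
  set (T0 := ((harm k + / (INR k + 1)) / (INR k + 1) * / INR (fact k) * / (INR k + 1 + e))%R) in *.
  assert (h := pow2_ge_0 e). assert (h' := Rabs_pos (rpoch e k - (1 - e * harm k) / INR (fact k))).
  rewrite (Rabs_right (e ^ 2 * T0)); [|apply Rle_ge, Rmult_le_pos; lra].
  set (X := Rabs (rpoch e k - (1 - e * harm k) / INR (fact k))) in *.
  assert (X * / (INR k + 1 + e) <= e ^ 2 * 4 ^ k * 2)%R by (apply Rmult_le_compat; lra).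
  assert (e ^ 2 * T0 <= e ^ 2 * 2)%R by (apply Rmult_le_compat_l; lra).
  assert (e ^ 2 * 1 <= e ^ 2 * 4 ^ k)%R by (apply Rmult_le_compat_l; lra).
  lra.
Qed.

(* J_i(z) = (z/2)^i CPS (bser i (- z^2/4)) 1 for i = 0, 1, and hser holds the part of the
   order derivative at i coming from the digamma factors. *)
Definition bser (i : nat) (q : C) (k : nat) : C :=
  q ^ k * RtoC (/ INR (fact (k + i)) / INR (fact k))%R.

Definition hser (i : nat) (q : C) (k : nat) : C :=
  q ^ k * RtoC (harm (k + i) / INR (fact (k + i)) / INR (fact k))%R.

Lemma inv_fact_le_1 (k : nat) : (0 < / INR (fact k) <= 1)%R.
Proof.
  split; [apply Rinv_0_lt_compat, INR_fact_lt_0|]. rewrite -Rinv_1. apply Rinv_le_contravar; [lra|].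
  apply (le_INR 1), lt_O_fact.
Qed.

Lemma bser_fast (i : nat) (q : C) : Cfast (bser i q).
Proof.
  apply (Cfast_pow_fact q (fun k => / INR (fact (k + i)))%R 1 1); [lra|].
  intro k. assert (h := inv_fact_le_1 (k + i)). rewrite pow1 Rabs_right; lra.
Qed.

Lemma hser_fast (i : nat) (q : C) : Cfast (hser i q).
Proof.
  apply (Cfast_pow_fact q (fun k => harm (k + i) / INR (fact (k + i)))%R (INR i + 1) 2); [lra|].
  intro k. assert (h := inv_fact_le_1 (k + i)). assert (b := harm_bounds (k + i)).
  assert (P : (INR k + 1 <= 2 ^ k)%R).
  { clear. induction k as [|k IH]; [simpl; lra|]. rewrite S_INR. simpl pow. assert (g := pos_INR k). lra. }
  rewrite plus_INR in b. assert (g := pos_INR k). assert (g' := pos_INR i).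
  unfold Rdiv. rewrite Rabs_right; nra.
Qed.

(** What remains of J_{i+e} once the power (z/2)^{i+e} and the factor 1/Gamma(1 + e) are taken
    out. *)
Definition rpser (i : nat) (q : C) (e : R) (k : nat) : C :=
  q ^ k * RtoC (rpoch e (k + i) / INR (fact k))%R.

Lemma rpser_fast (i : nat) (q : C) (e : R) : (Rabs e <= / 2)%R -> Cfast (rpser i q e).
Proof.
  intro He. apply (Cfast_pow_fact q (fun k => rpoch e (k + i)) (2 ^ i) 2); [lra|].
  intro k. assert (b := rpoch_bound e (k + i) He). rewrite Rabs_right; [|lra].
  rewrite pow_add in b. lra.
Qed.

(** The coefficientwise error of [rpoch_expand] is summed by [CPS_bound], giving a remainder
    quadratic in e for the whole series. *)
Lemma Cder_rpser (i : nat) (q : C) : (i <= 1)%nat ->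
  Cder (fun e => CPS (rpser i q e) 1) 0 (- CPS (hser i q) 1).
Proof.
  intro Hi.
  (* The 2 comes from [CPS_bound], the first 4 bounds 4^i for i <= 1, and the 4 in the exponent is
     the geometric ratio of [rpoch_expand]. *)
  set (K := (2 * (4 * exp (Cmod q * 4)))%R).
  assert (Z : forall k, rpser i q 0 k = bser i q k).
  { intro k; unfold rpser, bser; rewrite rpoch_0; reflexivity. }
  assert (B : forall e, (Rabs e <= / 2)%R ->
    (Cmod (CPS (rpser i q e) 1 - CPS (rpser i q 0) 1 - RtoC e * - CPS (hser i q) 1) <= K * e ^ 2)%R).
  { intros e He. rewrite (CPS_ext _ _ 1 Z).
    set (d := fun k => rpser i q e k + (RtoC (- 1) * bser i q k + RtoC e * hser i q k)).
    assert (E : CPS (rpser i q e) 1 - CPS (bser i q) 1 - RtoC e * - CPS (hser i q) 1 = CPS d 1).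
    { unfold d. rewrite CPS_plus; [|apply rpser_fast, He|apply Cfast_plus; apply Cfast_scal; [apply bser_fast|apply hser_fast]].
      rewrite CPS_plus; [|apply Cfast_scal, bser_fast|apply Cfast_scal, hser_fast].
      rewrite !CPS_scal; [|apply hser_fast|apply bser_fast]. ring. }
    rewrite E. eapply Rle_trans; [apply (CPS_bound d (e ^ 2 * 4) (Cmod q * 4))|].
    - apply Rmult_le_pos; [apply Cmod_ge_0|lra].
    - intro k.
      replace (d k) with (q ^ k * RtoC ((rpoch e (k + i) - (1 - e * harm (k + i)) / INR (fact (k + i))) / INR (fact k))%R).
      2: { unfold d, rpser, bser, hser.
           replace ((rpoch e (k + i) - (1 - e * harm (k + i)) / INR (fact (k + i))) / INR (fact k))%R
             with (rpoch e (k + i) / INR (fact k) + (- 1 * (/ INR (fact (k + i)) / INR (fact k))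
               + e * (harm (k + i) / INR (fact (k + i)) / INR (fact k))))%R
             by (field; split; apply INR_fact_neq_0).
           rewrite !RtoC_plus !(RtoC_mult (-1)) !(RtoC_mult e). ring. }
      rewrite Cmod_mult Cmod_pow Cmod_R Rpow_mult_distr.
      assert (X := rpoch_expand e (k + i) He). assert (h := inv_fact_le_1 k).
      set (D := (rpoch e (k + i) - (1 - e * harm (k + i)) / INR (fact (k + i)))%R) in *.
      unfold Rdiv. rewrite Rabs_mult (Rabs_right (/ INR (fact k))); [|lra].
      replace (e ^ 2 * 4 * (Cmod q ^ k * 4 ^ k) * / INR (fact k))%R
        with (Cmod q ^ k * ((e ^ 2 * (4 ^ k * 4)) * / INR (fact k)))%R by ring.
      apply Rmult_le_compat_l; [apply pow_le, Cmod_ge_0|].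
      apply Rmult_le_compat_r; [lra|]. eapply Rle_trans; [exact X|].
      apply Rmult_le_compat_l; [apply pow2_ge_0|]. rewrite pow_add.
      apply Rmult_le_compat_l; [apply pow_le; lra|].
      destruct i as [|[|i]]; [simpl; lra|simpl; lra|lia].
    - rewrite Rabs_R1 Rmult_1_r. unfold K. apply Req_le; ring. }
  split.
  - apply (is_derive_quadratic _ _ K). intros e He. eapply Rle_trans; [|apply (B e He)].
    eapply Rle_trans; [|apply Re_Cmod]. apply Req_le. f_equal. unfold Re, Im, RtoC; simpl; ring.
  - apply (is_derive_quadratic _ _ K). intros e He. eapply Rle_trans; [|apply (B e He)].
    eapply Rle_trans; [|apply Im_Cmod]. apply Req_le. f_equal. unfold Re, Im, RtoC; simpl; ring.
Qed.

Lemma rpser_0 (i : nat) (q : C) (x : R) : CPS (rpser i q 0) x = CPS (bser i q) x.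
Proof. apply CPS_ext; intro k; unfold rpser, bser; now rewrite rpoch_0. Qed.

Lemma BesselJ_rpser (i : nat) (e : R) (z : C) : (Rabs e <= / 2)%R ->
  BesselJ (INR i + e) z
  = Cexp (RtoC (INR i + e) * Cln (z / 2)) * (RtoC (rGamma (1 + e)) * CPS (rpser i (- (z ^ 2 / 4)) e) 1).
Proof.
  intro He. rewrite BesselJ_CPS. f_equal. rewrite -CPS_scal; [|apply rpser_fast, He].
  apply CPS_ext; intro k; unfold bessel_coef, rpser.
  apply Rabs_le_between in He.
  replace (INR i + e + INR k + 1)%R with (1 + e + INR (k + i))%R by (rewrite plus_INR; ring).
  rewrite rGamma_rpoch; [|lra]. unfold Rdiv. rewrite !RtoC_mult. ring.
Qed.

(** Product rule for three factors: ln(z/2) comes from the power, gamma from 1/Gamma(1 + e), and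
    [hser] from the rising factorials. *)
Lemma Cder_BesselJ (i : nat) (z : C) : (i <= 1)%nat -> z <> 0 ->
  Cder (fun e => BesselJ (INR i + e) z) 0
    ((z / 2) ^ i * ((Cln (z / 2) + RtoC EulerMascheroni) * CPS (bser i (- (z ^ 2 / 4))) 1
       - CPS (hser i (- (z ^ 2 / 4))) 1)).
Proof.
  intros Hi Hz.
  apply (Cder_ext_loc (fun e => Cexp (RtoC (INR i + e) * Cln (z / 2))
     * (RtoC (rGamma (1 + e)) * CPS (rpser i (- (z ^ 2 / 4)) e) 1))).
  { exists (mkposreal (/ 2) ltac:(lra)). intros y Hy. change (Rabs (y - 0) < / 2)%R in Hy.
    symmetry; apply BesselJ_rpser. rewrite Rminus_0_r in Hy; lra. }
  eapply Cder_eq.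
  - apply Cder_mult.
    + apply Cder_Cexp, Cder_mult; [|apply Cder_const].
      apply (Cder_RtoC (fun e => INR i + e)%R _ 1). auto_derive; [exact I|ring].
    + apply Cder_mult; [apply Cder_RtoC, is_derive_rGamma_1|apply Cder_rpser, Hi].
  - cbv beta. rewrite rpser_0 !Rplus_0_r rGamma_1.
    assert (X : Cexp (RtoC (INR i) * Cln (z / 2)) = (z / 2) ^ i).
    { destruct i as [|[|i]]; [| |lia].
      - simpl INR. rewrite Cmult_0_l Cexp_0. reflexivity.
      - simpl INR. rewrite Cmult_1_l (Cexp_Cln _ (C_nz_half z Hz)). simpl; ring. }
    rewrite X. ring.
Qed.

Lemma BesselJ_01 (i : nat) (z : C) : (i <= 1)%nat -> z <> 0 ->
  BesselJ (INR i) z = (z / 2) ^ i * CPS (bser i (- (z ^ 2 / 4))) 1.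
Proof.
  intros Hi Hz. replace (INR i) with (INR i + 0)%R by ring.
  rewrite BesselJ_rpser; [|rewrite Rabs_R0; lra]. rewrite rpser_0 !Rplus_0_r rGamma_1.
  destruct i as [|[|i]]; [| |lia]; simpl INR.
  - rewrite Cmult_0_l Cexp_0. simpl; ring.
  - rewrite Cmult_1_l (Cexp_Cln _ (C_nz_half z Hz)). simpl; ring.
Qed.

(** * Bessel functions of the second kind and Hankel functions *)

Definition Ynu (z : C) (nu : R) : C :=
  (BesselJ nu z * RtoC (cos (nu * PI)%R) - BesselJ (- nu)%R z) / RtoC (sin (nu * PI)%R).

(** Valid at 0 as well, both inverses being 0 there; the algebra on [Ynu] can then be carried out at
    every order, zeros of the sine included. *)
Lemma RtoC_Rinv (s : R) : RtoC (/ s) = / RtoC s.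
Proof.
  destruct (Req_dec s 0) as [->|H]; [|apply RtoC_inv, H].
  rewrite Rinv_0. apply C_ext; unfold Re, Im, Cinv, RtoC; simpl; unfold Rdiv; ring.
Qed.

(** A unit shift of the order reverses both sine and cosine, and the coefficient 2 (- nu)/z in the
    recurrence of J_{-nu} supplies the matching sign. *)
Lemma Ynu_rec (z : C) (nu : R) : z <> 0 ->
  Ynu z (nu + 1) = 2 * RtoC nu / z * Ynu z nu - Ynu z (nu - 1).
Proof.
  intro Hz. unfold Ynu.
  replace ((nu + 1) * PI)%R with (nu * PI + PI)%R by ring.
  replace ((nu - 1) * PI)%R with (nu * PI - PI)%R by ring.
  rewrite neg_cos neg_sin cos_minus sin_minus cos_PI sin_PI.
  replace (cos (nu * PI) * -1 + sin (nu * PI) * 0)%R with (- cos (nu * PI))%R by ring.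
  replace (sin (nu * PI) * -1 - cos (nu * PI) * 0)%R with (- sin (nu * PI))%R by ring.
  assert (R1 := BesselJ_rec nu z Hz). assert (R2 := BesselJ_rec (- nu) z Hz).
  replace (- nu - 1)%R with (- (nu + 1))%R in R2 by ring.
  replace (- nu + 1)%R with (- (nu - 1))%R in R2 by ring.
  unfold Cdiv. rewrite -!RtoC_Rinv.
  replace (/ - sin (nu * PI))%R with (- / sin (nu * PI))%R by (symmetry; apply Rinv_opp).
  set (s := (/ sin (nu * PI))%R). set (c := cos (nu * PI)).
  rewrite !RtoC_opp.
  assert (E1 : BesselJ (nu + 1) z = 2 * RtoC nu / z * BesselJ nu z - BesselJ (nu - 1) z)
    by (rewrite -R1; ring).
  assert (E2 : BesselJ (- (nu + 1)) z = 2 * RtoC (- nu) / z * BesselJ (- nu) z - BesselJ (- (nu - 1)) z)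
    by (rewrite -R2; ring).
  rewrite E1 E2 RtoC_opp. unfold Cdiv. ring.
Qed.

(** * Limits in the order and the functions Y_m *)

Lemma Ctends_filterlim {T : Type} (f : T -> C) (F : (T -> Prop) -> Prop) (l : C) :
  Filter F -> Ctends f F l -> filterlim f F (locally (T := C_UniformSpace) l).
Proof.
  intros FF [H1 H2] P [eps HP].
  assert (G1 := H1 _ (locally_ball (Re l) eps)). assert (G2 := H2 _ (locally_ball (Im l) eps)).
  unfold filtermap in *.
  apply (filter_imp (fun x => ball (Re l) eps (Re (f x)) /\ ball (Im l) eps (Im (f x)))).
  - intros x [B1 B2]; apply HP; split; assumption.
  - apply filter_and; assumption.
Qed.

Lemma Ctends_plus {T : Type} (f g : T -> C) (F : (T -> Prop) -> Prop) (l m : C) :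
  Filter F -> Ctends f F l -> Ctends g F m -> Ctends (fun t => f t + g t) F (l + m).
Proof.
  intros FF [H1 H2] [K1 K2]; split.
  - exact (filterlim_comp_2 _ _ _ H1 K1 (filterlim_plus (V := R_NormedModule) (Re l) (Re m))).
  - exact (filterlim_comp_2 _ _ _ H2 K2 (filterlim_plus (V := R_NormedModule) (Im l) (Im m))).
Qed.

Lemma Ctends_mult {T : Type} (f g : T -> C) (F : (T -> Prop) -> Prop) (l m : C) :
  Filter F -> Ctends f F l -> Ctends g F m -> Ctends (fun t => f t * g t) F (l * m).
Proof.
  intros FF [H1 H2] [K1 K2].
  assert (M : forall (u v : T -> R) (a b : R), filterlim u F (locally a) -> filterlim v F (locally b) ->
    filterlim (fun t => u t * v t)%R F (locally (a * b)%R)).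
  { intros u v a b Hu Hv. exact (filterlim_comp_2 _ _ _ Hu Hv (filterlim_mult (K := R_AbsRing) a b)). }
  assert (O : forall (u : T -> R) (a : R), filterlim u F (locally a) ->
    filterlim (fun t => - u t)%R F (locally (- a)%R)).
  { intros u a Hu. exact (filterlim_comp _ _ _ _ _ _ _ _ Hu (filterlim_opp (V := R_NormedModule) a)). }
  split.
  - exact (filterlim_comp_2 _ _ _ (M _ _ _ _ H1 K1) (O _ _ (M _ _ _ _ H2 K2))
      (filterlim_plus (V := R_NormedModule) _ _)).
  - exact (filterlim_comp_2 _ _ _ (M _ _ _ _ H1 K2) (M _ _ _ _ H2 K1)
      (filterlim_plus (V := R_NormedModule) _ _)).
Qed.

Lemma Ctends_const {T : Type} (c : C) (F : (T -> Prop) -> Prop) :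
  Filter F -> Ctends (fun _ => c) F c.
Proof. intro FF; split; apply filterlim_const. Qed.

Lemma Ctends_RtoC {T : Type} (f : T -> R) (F : (T -> Prop) -> Prop) (l : R) :
  Filter F -> filterlim f F (locally l) -> Ctends (fun t => RtoC (f t)) F (RtoC l).
Proof. intros FF H; split; [exact H|apply filterlim_const]. Qed.

Lemma Ctends_ext_loc {T : Type} (f g : T -> C) (F : (T -> Prop) -> Prop) (l : C) :
  Filter F -> F (fun t => f t = g t) -> Ctends f F l -> Ctends g F l.
Proof.
  intros FF E [H1 H2]; split.
  - apply (filterlim_ext_loc (fun t => Re (f t))); [|exact H1].
    revert E; apply filter_imp; intros t ->; reflexivity.
  - apply (filterlim_ext_loc (fun t => Im (f t))); [|exact H2].
    revert E; apply filter_imp; intros t ->; reflexivity.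
Qed.

Lemma Ctends_unique {T : Type} (f : T -> C) (F : (T -> Prop) -> Prop) (l m : C) :
  ProperFilter' F -> Ctends f F l -> Ctends f F m -> l = m.
Proof.
  intros FF [H1 H2] [K1 K2]; apply C_ext.
  - exact (filterlim_locally_unique (V := R_NormedModule) (F := F) _ _ _ H1 K1).
  - exact (filterlim_locally_unique (V := R_NormedModule) (F := F) _ _ _ H2 K2).
Qed.

Lemma diff_quotient_lim (f : R -> R) (l : R) :
  f 0%R = 0%R -> is_derive f 0 l -> filterlim (fun e => f e / e)%R (locally' 0) (locally l).
Proof.
  intros Z D. apply is_derive_Reals in D.
  intros P [eps HP]. destruct (D eps (cond_pos eps)) as [d Hd].
  exists d. intros y Hy Hny. apply HP. change (Rabs (f y / y - l) < eps)%R.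
  change (Rabs (y - 0) < d)%R in Hy. rewrite Rminus_0_r in Hy.
  assert (h := Hd y Hny Hy). rewrite Rplus_0_l Z Rminus_0_r in h. exact h.
Qed.

(** L'Hospital's rule at a simple zero: numerator and sine are each divided by e, with limits l and
    PI. *)
Lemma Ctends_over_sin (N : R -> C) (l : C) :
  Cder N 0 l -> N 0 = 0 -> Ctends (fun e => N e / RtoC (sin (e * PI))) (locally' 0) (l / RtoC PI).
Proof.
  intros [D1 D2] Z.
  assert (PIp := PI_RGT_0).
  assert (S : filterlim (fun e => / (sin (e * PI) / e))%R (locally' 0) (locally (/ PI)%R)).
  { apply (is_lim_inv (fun e => sin (e * PI) / e)%R 0 PI); [|intro E; injection E; lra].
    apply (diff_quotient_lim (fun e => sin (e * PI)) PI).
    - rewrite Rmult_0_l; apply sin_0.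
    - auto_derive; [exact I|]. rewrite Rmult_0_l cos_0; ring. }
  assert (Q : Ctends (fun e => (Re (N e) / e, Im (N e) / e)%R) (locally' 0) l).
  { split; apply diff_quotient_lim; try assumption; rewrite Z; reflexivity. }
  unfold Cdiv. rewrite -RtoC_Rinv.
  eapply Ctends_ext_loc; [apply _| |apply (Ctends_mult _ _ _ _ _ _ Q (Ctends_RtoC _ _ _ _ S))].
  exists (mkposreal 1 Rlt_0_1). intros y Hy Hny. cbv beta. rewrite -RtoC_Rinv.
  assert (X : (/ y * / (sin (y * PI) / y) = / sin (y * PI))%R).
  { destruct (Req_dec (sin (y * PI)) 0) as [E|E]; [rewrite E; unfold Rdiv; rewrite Rmult_0_l Rinv_0; ring|].
    field; split; assumption. }
  rewrite -X. apply C_ext; unfold Re, Im, RtoC, Rdiv; simpl; ring.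
Qed.

Lemma filterlim_shift_punctured (a b : R) : filterlim (fun x => x + (a - b))%R (locally' b) (locally' a).
Proof.
  intros P [eps HP]. exists eps. intros y Hy Hny. apply HP.
  - change (Rabs (y - b) < eps)%R in Hy. change (Rabs (y + (a - b) - a) < eps)%R.
    replace (y + (a - b) - a)%R with (y - b)%R by ring. exact Hy.
  - lra.
Qed.

Lemma Ctends_comp {T U : Type} (f : U -> C) (h : T -> U) (F : (T -> Prop) -> Prop) (G : (U -> Prop) -> Prop) (l : C) :
  filterlim h F G -> Ctends f G l -> Ctends (fun t => f (h t)) F l.
Proof.
  intros H [H1 H2]; split.
  - exact (filterlim_comp _ _ _ h (fun u => Re (f u)) F G _ H H1).
  - exact (filterlim_comp _ _ _ h (fun u => Im (f u)) F G _ H H2).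
Qed.

(** The derivative of J_nu(z) in nu at nu = i, for i = 0 or 1. *)
Definition dJ (i : nat) (z : C) : C :=
  (z / 2) ^ i * ((Cln (z / 2) + RtoC EulerMascheroni) * CPS (bser i (- (z ^ 2 / 4))) 1
     - CPS (hser i (- (z ^ 2 / 4))) 1).

Lemma Ynu_lim_0 (z : C) : z <> 0 -> Ctends (Ynu z) (locally' 0) (2 * dJ 0 z / RtoC PI).
Proof.
  intro Hz.
  assert (D := Cder_BesselJ 0 z ltac:(lia) Hz). fold (dJ 0 z) in D. simpl INR in D.
  assert (D0 : Cder (fun e => BesselJ e z) 0 (dJ 0 z)).
  { apply: Cder_ext D; intro t; now rewrite Rplus_0_l. }
  apply (Ctends_over_sin (fun e => BesselJ e z * RtoC (cos (e * PI)) - BesselJ (- e) z)).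
  - eapply Cder_eq.
    + apply Cder_minus.
      * apply Cder_mult; [exact D0|].
        apply (Cder_RtoC (fun e => cos (e * PI)) 0 0). auto_derive; [exact I|].
        rewrite Rmult_0_l sin_0; ring.
      * apply (Cder_comp (fun e => BesselJ e z) (fun e => - e)%R 0 (dJ 0 z) (- 1)).
        -- rewrite Ropp_0; exact D0.
        -- auto_derive; [exact I|ring].
    + cbv beta. rewrite Rmult_0_l cos_0. ring.
  - rewrite Ropp_0 Rmult_0_l cos_0. ring.
Qed.

(** Expansions in the order are available only at 0 and 1, whereas J_{-nu} lives near -1. The
    recurrence rewrites it through J_{1-nu} and J_{2-nu}; with nu = 1 + e this gives the numerator
    [N], whose last term is the origin of the summand in J_0. *)
Lemma Ynu_lim_1 (z : C) : z <> 0 ->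
  Ctends (Ynu z) (locally' 1) ((2 * dJ 1 z - 2 / z * BesselJ 0 z) / RtoC PI).
Proof.
  intro Hz.
  assert (D := Cder_BesselJ 0 z ltac:(lia) Hz). fold (dJ 0 z) in D. simpl INR in D.
  assert (D0 : Cder (fun e => BesselJ e z) 0 (dJ 0 z)).
  { apply: Cder_ext D; intro t; now rewrite Rplus_0_l. }
  assert (D1 := Cder_BesselJ 1 z ltac:(lia) Hz). fold (dJ 1 z) in D1. simpl INR in D1.
  set (N := fun e => BesselJ (1 + e) z * RtoC (cos (e * PI)) - BesselJ (1 + - e) z
     - 2 * RtoC e / z * BesselJ (- e) z).
  assert (L : Ctends (fun e => N e / RtoC (sin (e * PI))) (locally' 0) ((2 * dJ 1 z - 2 / z * BesselJ 0 z) / RtoC PI)).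
  { apply Ctends_over_sin.
    - eapply Cder_eq.
      + apply Cder_minus; [apply Cder_minus|].
        * apply Cder_mult; [exact D1|].
          apply (Cder_RtoC (fun e => cos (e * PI)) 0 0). auto_derive; [exact I|].
          rewrite Rmult_0_l sin_0; ring.
        * apply (Cder_comp (fun e => BesselJ (1 + e) z) (fun e => - e)%R 0 (dJ 1 z) (- 1)).
          -- rewrite Ropp_0; exact D1.
          -- auto_derive; [exact I|ring].
        * apply Cder_mult.
          -- apply Cder_mult; [apply Cder_scal, Cder_id|apply Cder_const].
          -- apply (Cder_comp (fun e => BesselJ e z) (fun e => - e)%R 0 (dJ 0 z) (- 1)).
             ++ rewrite Ropp_0; exact D0.
             ++ auto_derive; [exact I|ring].
      + cbv beta. rewrite Rmult_0_l cos_0 Ropp_0. field. exact Hz.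
    - unfold N. rewrite Ropp_0 Rmult_0_l cos_0. field. exact Hz. }
  assert (E : forall nu, N (nu + (0 - 1))%R / RtoC (sin ((nu + (0 - 1)) * PI)) = Ynu z nu).
  { intro nu. unfold Ynu, N.
    replace ((nu + (0 - 1)) * PI)%R with (nu * PI - PI)%R by ring.
    rewrite cos_minus sin_minus cos_PI sin_PI.
    replace (cos (nu * PI) * -1 + sin (nu * PI) * 0)%R with (- cos (nu * PI))%R by ring.
    replace (sin (nu * PI) * -1 - cos (nu * PI) * 0)%R with (- sin (nu * PI))%R by ring.
    assert (R2 := BesselJ_rec (1 - nu) z Hz).
    replace (1 - nu - 1)%R with (- nu)%R in R2 by ring.
    replace (1 + (nu + (0 - 1)))%R with nu by ring.
    replace (1 + - (nu + (0 - 1)))%R with (1 - nu + 1)%R by ring.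
    replace (- (nu + (0 - 1)))%R with (1 - nu)%R by ring.
    replace (nu + (0 - 1))%R with (- (1 - nu))%R by ring.
    unfold Cdiv. rewrite -!RtoC_Rinv Rinv_opp !RtoC_opp.
    assert (E2 : BesselJ (- nu) z = 2 * RtoC (1 - nu) / z * BesselJ (1 - nu) z - BesselJ (1 - nu + 1) z)
      by (rewrite -R2; ring).
    rewrite E2. unfold Cdiv. ring. }
  eapply Ctends_ext_loc; [apply _|apply filter_forall, E|].
  exact (Ctends_comp _ _ _ _ _ (filterlim_shift_punctured 0 1) L).
Qed.

Lemma Ynu_lim_shift (z : C) (m : Z) (l : C) : Ctends (Ynu z) (locally' (IZR m)) l ->
  forall d : R, forall n : Z, IZR n = (IZR m + d)%R -> Ctends (fun nu => Ynu z (nu - d)) (locally' (IZR n)) l.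
Proof.
  intros H d n E. eapply Ctends_ext_loc; [apply _| |exact (Ctends_comp _ _ _ _ _ (filterlim_shift_punctured (IZR m) (IZR n)) H)].
  apply filter_forall; intro x; cbv beta. f_equal. rewrite E. ring.
Qed.

Lemma Ynu_lim_up (z : C) (m : Z) (l l' : C) : z <> 0 ->
  Ctends (Ynu z) (locally' (IZR (m - 1))) l -> Ctends (Ynu z) (locally' (IZR m)) l' ->
  Ctends (Ynu z) (locally' (IZR (m + 1))) (2 * RtoC (IZR m) / z * l' - l).
Proof.
  intros Hz H H'.
  assert (G := Ynu_lim_shift z _ _ H 2 (m + 1) ltac:(rewrite plus_IZR minus_IZR; ring)).
  assert (G' := Ynu_lim_shift z _ _ H' 1 (m + 1) ltac:(rewrite plus_IZR; ring)).
  apply (Ctends_ext_loc (fun x => 2 * RtoC (x - 1) / z * Ynu z (x - 1) + - Ynu z (x - 2))).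
  { apply _. }
  { apply filter_forall; intro x. replace (Ynu z x) with (Ynu z (x - 1 + 1)) by (f_equal; ring).
    rewrite Ynu_rec; [|exact Hz].
    replace (x - 1 - 1)%R with (x - 2)%R by ring. reflexivity. }
  apply Ctends_plus; [apply _| |].
  - apply Ctends_mult; [apply _| |exact G'].
    apply Ctends_mult; [apply _| |apply Ctends_const, _].
    apply Ctends_mult; [apply _|apply Ctends_const, _|].
    apply Ctends_RtoC; [apply _|].
    apply (filterlim_filter_le_1 (F := locally (IZR (m + 1)))); [apply filter_le_within|].
    rewrite -(Rplus_0_r (IZR m)).
    replace (IZR m + 0)%R with (IZR (m + 1) - 1)%R by (rewrite plus_IZR; ring).
    apply (continuous_minus (V := R_NormedModule) (fun x => x) (fun _ => 1%R)); [apply continuous_id|apply continuous_const].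
  - destruct G as [G1 G2]; split.
    + exact (filterlim_comp _ _ _ _ _ _ _ _ G1 (filterlim_opp (V := R_NormedModule) _)).
    + exact (filterlim_comp _ _ _ _ _ _ _ _ G2 (filterlim_opp (V := R_NormedModule) _)).
Qed.

Lemma Ctends_opp {T : Type} (f : T -> C) (F : (T -> Prop) -> Prop) (l : C) :
  Ctends f F l -> Ctends (fun t => - f t) F (- l).
Proof.
  intros [G1 G2]; split.
  - exact (filterlim_comp _ _ _ _ _ _ _ _ G1 (filterlim_opp (V := R_NormedModule) _)).
  - exact (filterlim_comp _ _ _ _ _ _ _ _ G2 (filterlim_opp (V := R_NormedModule) _)).
Qed.

Lemma Ynu_lim_down (z : C) (m : Z) (l l' : C) : z <> 0 ->
  Ctends (Ynu z) (locally' (IZR (m + 1))) l -> Ctends (Ynu z) (locally' (IZR m)) l' ->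
  Ctends (Ynu z) (locally' (IZR (m - 1))) (2 * RtoC (IZR m) / z * l' - l).
Proof.
  intros Hz H H'.
  assert (G := Ynu_lim_shift z _ _ H (-2) (m - 1) ltac:(rewrite plus_IZR minus_IZR; ring)).
  assert (G' := Ynu_lim_shift z _ _ H' (-1) (m - 1) ltac:(rewrite minus_IZR; ring)).
  apply (Ctends_ext_loc (fun x => 2 * RtoC (x - -1) / z * Ynu z (x - -1) + - Ynu z (x - -2))).
  { apply _. }
  { apply filter_forall. change (forall x : R, 2 * RtoC (x - -1) / z * Ynu z (x - -1) + - Ynu z (x - -2) = Ynu z x).
    intro x. assert (R := Ynu_rec z (x - -1) Hz).
    replace (x - -1 + 1)%R with (x - -2)%R in R by ring.
    replace (x - -1 - 1)%R with x in R by ring. rewrite R. ring. }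
  apply Ctends_plus; [apply _| |apply Ctends_opp, G].
  apply Ctends_mult; [apply _| |exact G'].
  apply Ctends_mult; [apply _| |apply Ctends_const, _].
  apply Ctends_mult; [apply _|apply Ctends_const, _|].
  apply Ctends_RtoC; [apply _|].
  apply (filterlim_filter_le_1 (F := locally (IZR (m - 1)))); [apply filter_le_within|].
  replace (IZR m) with (IZR (m - 1) - -1)%R by (rewrite minus_IZR; ring).
  apply (continuous_minus (V := R_NormedModule) (fun x => x) (fun _ => (-1)%R)); [apply continuous_id|apply continuous_const].
Qed.

Lemma BesselY_unique (m : Z) (z l : C) : Ctends (Ynu z) (locally' (IZR m)) l -> BesselY m z = l.
Proof.
  intro H. unfold BesselY, Clim.
  apply (iota_filterlim_locally (V := C_CompleteNormedModule) (F := locally' (IZR m)) (FF := Proper_StrongProper _ (Rbar_locally'_filter (Finite (IZR m)))) (Ynu z) l).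
  apply (Ctends_filterlim (Ynu z) (locally' (IZR m)) l _ H).
Qed.

(** Limits at two consecutive integers are carried together, since the recurrence then yields the
    next one in either direction. *)
Lemma BesselY_lim (m : Z) (z : C) : z <> 0 -> Ctends (Ynu z) (locally' (IZR m)) (BesselY m z).
Proof.
  intro Hz.
  assert (G : (exists l, Ctends (Ynu z) (locally' (IZR m)) l)
     /\ (exists l, Ctends (Ynu z) (locally' (IZR (m + 1))) l)).
  { induction m as [|m IH|m IH] using Z.peano_ind.
    - split; eexists; [apply Ynu_lim_0, Hz|apply Ynu_lim_1, Hz].
    - destruct IH as [[l Hl] [l' Hl']]. split; [exists l'; exact Hl'|].
      eexists. apply (Ynu_lim_up z (Z.succ m) l l' Hz); [|exact Hl'].
      replace (Z.succ m - 1)%Z with m by lia. exact Hl.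
    - destruct IH as [[l Hl] [l' Hl']]. split.
      + replace (Z.pred m) with (m - 1)%Z by lia. eexists; apply (Ynu_lim_down z m l' l Hz Hl' Hl).
      + exists l. replace (Z.pred m + 1)%Z with m by lia. exact Hl. }
  destruct G as [[l Hl] _]. rewrite (BesselY_unique m z l Hl). exact Hl.
Qed.

Lemma BesselY_rec (m : Z) (z : C) : z <> 0 ->
  BesselY (m + 1) z = 2 * RtoC (IZR m) / z * BesselY m z - BesselY (m - 1) z.
Proof. intro Hz; apply BesselY_unique, Ynu_lim_up; [exact Hz| |]; apply BesselY_lim, Hz. Qed.

Lemma BesselJ_IZR_rec (m : Z) (z : C) : z <> 0 ->
  BesselJ (IZR (m + 1)) z = 2 * RtoC (IZR m) / z * BesselJ (IZR m) z - BesselJ (IZR (m - 1)) z.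
Proof.
  intro Hz. assert (R := BesselJ_rec (IZR m) z Hz).
  rewrite plus_IZR minus_IZR -R. ring.
Qed.

Lemma Hankel1_rec (m : Z) (z : C) : z <> 0 ->
  Hankel1 (m + 1) z = 2 * RtoC (IZR m) / z * Hankel1 m z - Hankel1 (m - 1) z.
Proof.
  intro Hz. unfold Hankel1. rewrite BesselY_rec // BesselJ_IZR_rec //. ring.
Qed.

Lemma Hankel1_0 (z : C) : z <> 0 ->
  Hankel1 0 z = CPS (bser 0 (- (z ^ 2 / 4))) 1 + Ci * (2 / RtoC PI) *
    ((Cln (z / 2) + RtoC EulerMascheroni) * CPS (bser 0 (- (z ^ 2 / 4))) 1 - CPS (hser 0 (- (z ^ 2 / 4))) 1).
Proof.
  intro Hz. unfold Hankel1. rewrite (BesselY_unique 0 z _ (Ynu_lim_0 z Hz)).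
  rewrite (BesselJ_01 0 z ltac:(lia) Hz). unfold dJ. simpl Cpow. unfold Cdiv; ring.
Qed.

Lemma Hankel1_1 (z : C) : z <> 0 ->
  Hankel1 1 z = z / 2 * CPS (bser 1 (- (z ^ 2 / 4))) 1 + Ci * (2 / RtoC PI) *
    (z / 2 * ((Cln (z / 2) + RtoC EulerMascheroni) * CPS (bser 1 (- (z ^ 2 / 4))) 1 - CPS (hser 1 (- (z ^ 2 / 4))) 1)
     - CPS (bser 0 (- (z ^ 2 / 4))) 1 / z).
Proof.
  intro Hz. unfold Hankel1. rewrite (BesselY_unique 1 z _ (Ynu_lim_1 z Hz)).
  rewrite (BesselJ_01 1 z ltac:(lia) Hz) (BesselJ_01 0 z ltac:(lia) Hz). unfold dJ. simpl Cpow. unfold Cdiv; ring.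
Qed.

(** The recurrence of [f] at all integers already forces f(-n) = (-1)^n f(n), starting from its
    instance at 0. For [g] the recurrence is only asked at n >= 1, where the source terms of the
    integral and of [sigma_m] cancel, and the parity is a separate assumption. *)
Lemma rec_agree (a : C) (f g : Z -> C) :
  (forall m, f (m + 1)%Z = RtoC (IZR m) * a * f m - f (m - 1)%Z) ->
  (forall n : nat, (1 <= n)%nat ->
     g (Z.of_nat n + 1)%Z = RtoC (INR n) * a * g (Z.of_nat n) - g (Z.of_nat n - 1)%Z) ->
  (forall n : nat, g (- Z.of_nat n)%Z = (- (1)) ^ n * g (Z.of_nat n)) ->
  f 0%Z = g 0%Z -> f 1%Z = g 1%Z -> forall m, f m = g m.
Proof.
  intros Hf Hg Sg E0 E1.
  assert (P : forall n : nat, f (Z.of_nat n) = g (Z.of_nat n) /\ f (Z.of_nat (S n)) = g (Z.of_nat (S n))).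
  { induction n as [|n [IH1 IH2]]; [split; assumption|].
    split; [exact IH2|].
    replace (Z.of_nat (S (S n))) with (Z.of_nat (S n) + 1)%Z by lia.
    rewrite Hf Hg; [|lia]. replace (Z.of_nat (S n) - 1)%Z with (Z.of_nat n) by lia.
    rewrite IH1 IH2 INR_IZR_INZ. reflexivity. }
  assert (N : forall n : nat, f (- Z.of_nat n)%Z = (- (1)) ^ n * f (Z.of_nat n)
     /\ f (- Z.of_nat (S n))%Z = (- (1)) ^ S n * f (Z.of_nat (S n))).
  { induction n as [|n [IH1 IH2]].
    - split; [simpl; ring|].
      assert (H := Hf 0%Z). change (f 1%Z = RtoC 0 * a * f 0%Z - f (-1)%Z) in H.
      change (f (-1)%Z = (- (1)) ^ 1 * f 1%Z). rewrite H. simpl; ring.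
    - split; [exact IH2|].
      assert (H := Hf (- Z.of_nat (S n))%Z). assert (H' := Hf (Z.of_nat (S n))).
      replace (- Z.of_nat (S n) + 1)%Z with (- Z.of_nat n)%Z in H by lia.
      replace (- Z.of_nat (S n) - 1)%Z with (- Z.of_nat (S (S n)))%Z in H by lia.
      replace (Z.of_nat (S n) - 1)%Z with (Z.of_nat n) in H' by lia.
      replace (Z.of_nat (S n) + 1)%Z with (Z.of_nat (S (S n)))%Z in H' by lia.
      rewrite opp_IZR RtoC_opp in H.
      rewrite H'.
      assert (Q : f (- Z.of_nat (S (S n)))%Z
        = - RtoC (IZR (Z.of_nat (S n))) * a * f (- Z.of_nat (S n))%Z - f (- Z.of_nat n)%Z) by (rewrite H; ring).
      rewrite Q IH1 IH2 !Cpow_S. ring. }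
  intro m. destruct (Z.le_gt_cases 0 m) as [Hm|Hm].
  - rewrite -(Z2Nat.id m Hm). apply P.
  - replace m with (- Z.of_nat (Z.to_nat (- m)))%Z by lia.
    rewrite (proj1 (N _)) Sg. f_equal. apply P.
Qed.

(** * The logarithmic singularity *)

Open Scope R_scope.

Definition sinc (x : R) : R := match Req_dec_T x 0 with left _ => 1 | right _ => sin x / x end.

Lemma sinc_ne (x : R) : x <> 0 -> sinc x = sin x / x.
Proof. intro H; unfold sinc; destruct (Req_dec_T x 0); [contradiction|reflexivity]. Qed.

Lemma sinc_cont (x : R) : continuous sinc x.
Proof.
  destruct (Req_dec x 0) as [->|H].
  - intros P [eps HP]. replace (sinc 0) with 1 in HP by (unfold sinc; destruct (Req_dec_T 0 0); [reflexivity|lra]).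
    assert (L := is_lim_sinc_0 (ball 1 eps) (locally_ball 1 eps)).
    destruct L as [d Hd]. exists d; intros y Hy; apply HP.
    destruct (Req_dec y 0) as [->|N].
    + unfold sinc; destruct (Req_dec_T 0 0); [apply ball_center|lra].
    + rewrite sinc_ne //. apply Hd; assumption.
  - apply (continuous_ext_loc _ (fun y => sin y / y)).
    + assert (Hp := Rabs_pos_lt x H). exists (mkposreal _ Hp). intros y Hy.
      change (Rabs (y - x) < Rabs x) in Hy. symmetry; apply sinc_ne. intros ->.
      rewrite Rminus_0_l Rabs_Ropp in Hy. lra.
    + apply @ex_derive_continuous. auto_derive. exact H.
Qed.

Lemma sinc_nz (x : R) : - PI < x < PI -> sinc x <> 0.
Proof.
  intro Hx. destruct (Req_dec x 0) as [->|N].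
  - unfold sinc; destruct (Req_dec_T 0 0); lra.
  - rewrite sinc_ne //. unfold Rdiv. apply Rmult_integral_contrapositive; split; [|apply Rinv_neq_0_compat, N].
    destruct (Rtotal_order x 0) as [L|[E|G]]; [|contradiction|].
    + assert (h := sin_gt_0 (- x)). rewrite sin_neg in h. lra.
    + apply Rgt_not_eq, sin_gt_0; lra.
Qed.

(* x cot x, extended continuously by 1 at 0 *)
Definition xcot (x : R) : R := cos x / sinc x.

Lemma xcot_cont (x : R) : - PI < x < PI -> continuous xcot x.
Proof.
  intro Hx. apply (continuous_mult (K := R_AbsRing) cos (fun t => / sinc t)).
  - apply continuous_cos.
  - apply continuous_Rinv_comp; [apply sinc_cont|apply sinc_nz, Hx].
Qed.

Definition xcot_prim (x : R) : R := RInt xcot 0 x.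

Lemma xcot_prim_der (x : R) : - PI < x < PI -> is_derive xcot_prim x (xcot x).
Proof.
  intro Hx. assert (PIp := PI_RGT_0).
  apply (is_derive_RInt (V := R_NormedModule) xcot _ 0); [|apply xcot_cont, Hx].
  assert (Hd : 0 < Rmin (x + PI) (PI - x)) by (apply Rmin_pos; lra).
  exists (mkposreal _ Hd). intros y Hy. change (Rabs (y - x) < Rmin (x + PI) (PI - x)) in Hy.
  assert (H1 := Rlt_le_trans _ _ _ Hy (Rmin_l _ _)). assert (H2 := Rlt_le_trans _ _ _ Hy (Rmin_r _ _)).
  apply Rabs_def2 in H1. apply Rabs_def2 in H2.
  apply (RInt_correct (V := R_CompleteNormedModule)).
  apply (ex_RInt_continuous (V := R_CompleteNormedModule)).
  intros t Ht. apply xcot_cont. revert Ht; unfold Rmin, Rmax; destruct (Rle_dec 0 y); lra.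
Qed.

Lemma cot_half_double (x : R) : 0 < x < PI ->
  x * (cos x / sin x) = x / 2 * (cos (x / 2) / sin (x / 2)) - x / 2 * (sin (x / 2) / cos (x / 2)).
Proof.
  intro Hx. assert (S : sin (x / 2) <> 0) by (apply Rgt_not_eq, sin_gt_0; lra).
  assert (Cn : cos (x / 2) <> 0) by (apply Rgt_not_eq, cos_gt_0; lra).
  replace (cos x) with (cos (2 * (x / 2))) by (f_equal; field).
  replace (sin x) with (sin (2 * (x / 2))) by (f_equal; field).
  rewrite cos_2a sin_2a. field. split; assumption.
Qed.

Lemma xcot_ne (x : R) : x <> 0 -> xcot x = x * (cos x / sin x).
Proof.
  intro H. unfold xcot. rewrite sinc_ne //.
  destruct (Req_dec (sin x) 0) as [E|E]; [|field; split; assumption].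
  rewrite E. unfold Rdiv. rewrite Rmult_0_l Rinv_0. ring.
Qed.

(* The duplication formula of the cotangent makes P(x) - 2 P(x/2) + 2 P((PI - x)/2) - PI ln cos(x/2)
   constant, P being the primitive of x cot x; compare x = 0 and x = PI/2. *)
Lemma RInt_xcot : xcot_prim (PI / 2) = PI / 2 * ln 2.
Proof.
  assert (PIp := PI_RGT_0).
  set (F := fun x => xcot_prim x - 2 * xcot_prim (x / 2) + 2 * xcot_prim ((PI - x) / 2) - PI * ln (cos (x / 2))).
  assert (D : forall x, 0 <= x <= PI / 2 -> is_derive F x 0).
  { intros x Hx.
    assert (Cn : 0 < cos (x / 2)) by (apply cos_gt_0; lra).
    assert (D1 := xcot_prim_der x ltac:(lra)).
    assert (D2 := xcot_prim_der (x / 2) ltac:(lra)).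
    assert (D3 := xcot_prim_der ((PI - x) / 2) ltac:(lra)).
    unfold F. revert D1 D2 D3. generalize xcot_prim. intros u D1 D2 D3.
    evar_last.
    { apply (is_derive_minus (V := R_NormedModule)).
      - apply (is_derive_plus (V := R_NormedModule)).
        + apply (is_derive_minus (V := R_NormedModule)); [exact D1|].
          apply is_derive_scal. apply (is_derive_comp (V := R_NormedModule) u (fun x => x / 2)); [exact D2|].
          auto_derive; [exact I|]. reflexivity.
        + apply is_derive_scal. apply (is_derive_comp (V := R_NormedModule) u (fun x => (PI - x) / 2)); [exact D3|].
          auto_derive; [exact I|]. reflexivity.
      - auto_derive; [exact Cn|]. reflexivity. }
    unfold minus, plus, opp, scal; simpl; unfold mult; simpl.
    rewrite (xcot_ne ((PI - x) / 2)); [|lra].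
    replace ((PI - x) / 2) with (PI / 2 - x / 2) by field.
    rewrite cos_shift sin_shift.
    destruct (Req_dec x 0) as [->|N].
    - replace (0 / 2) with 0 by field. rewrite !Rmult_0_l sin_0 cos_0. field.
    - rewrite (xcot_ne x N) (xcot_ne (x / 2)); [|lra]. rewrite cot_half_double; [|lra].
      assert (S : sin (x / 2) <> 0) by (apply Rgt_not_eq, sin_gt_0; lra).
      change (x * / 2) with (x / 2). field. split; lra. }
  (* F(0) = 2 P(PI/2), while at PI/2 the two values at PI/4 cancel and F(PI/2) = P(PI/2) + (PI/2) ln
     2. *)
  assert (E := eq_is_derive (V := R_NormedModule) F 0 (PI / 2) D ltac:(lra)).
  unfold F in E.
  assert (Z : xcot_prim 0 = 0) by apply (RInt_point (V := R_CompleteNormedModule)).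
  replace ((PI - 0) / 2) with (PI / 2) in E by field.
  replace ((PI - PI / 2) / 2) with (PI / 2 / 2) in E by field.
  replace (0 / 2) with 0 in E by field. rewrite Z cos_0 ln_1 in E.
  replace (PI / 2 / 2) with (PI / 4) in E by field.
  rewrite cos_PI4 ln_div in E; [|lra|apply sqrt_lt_R0; lra].
  rewrite ln_1 in E.
  assert (L2 : ln 2 = 2 * ln (sqrt 2)).
  { rewrite -{1}(sqrt_sqrt 2); [|lra]. rewrite ln_mult; [ring| |]; apply sqrt_lt_R0; lra. }
  nra.
Qed.

Definition ln1pcos (th : R) : R := ln (1 + cos th).

Lemma one_plus_cos_pos (th : R) : - PI < th < PI -> 0 < 1 + cos th.
Proof.
  intro H. replace (cos th) with (cos (2 * (th / 2))) by (f_equal; field).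
  rewrite cos_2a_cos. assert (0 < cos (th / 2)) by (apply cos_gt_0; lra). nra.
Qed.

(* Primitive of ln1pcos, from (th - PI) ln1pcos(th) by parts; at th = PI Rocq's ln 0 = 0 is harmless. *)
Definition ln1pcos_prim (th : R) : R := (th - PI) * ln1pcos th - PI * ln 2 + 4 * xcot_prim ((PI - th) / 2).

Lemma ln1pcos_prim_0 : ln1pcos_prim 0 = 0.
Proof.
  unfold ln1pcos_prim, ln1pcos. replace ((PI - 0) / 2) with (PI / 2) by field. rewrite RInt_xcot cos_0.
  replace (1 + 1) with 2 by ring. field.
Qed.

Lemma ln1pcos_prim_PI : ln1pcos_prim PI = - (PI * ln 2).
Proof.
  unfold ln1pcos_prim. replace ((PI - PI) / 2) with 0 by field.
  replace (xcot_prim 0) with 0 by (symmetry; apply (RInt_point (V := R_CompleteNormedModule))). ring.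
Qed.

Lemma sin_cos_half (th : R) : - PI < th < PI -> sin (th / 2) / cos (th / 2) = sin th / (1 + cos th).
Proof.
  intro H. assert (0 < cos (th / 2)) by (apply cos_gt_0; lra).
  assert (P := one_plus_cos_pos th H). revert P.
  replace (cos th) with (cos (2 * (th / 2))) by (f_equal; field).
  replace (sin th) with (sin (2 * (th / 2))) by (f_equal; field).
  rewrite cos_2a_cos sin_2a. intro P. field. split; lra.
Qed.

Lemma ln1pcos_prim_der (th : R) : - PI < th < PI -> is_derive ln1pcos_prim th (ln1pcos th).
Proof.
  intro H. assert (PIp := PI_RGT_0). assert (P := one_plus_cos_pos th H).
  assert (D := xcot_prim_der ((PI - th) / 2) ltac:(lra)).
  unfold ln1pcos_prim, ln1pcos. revert D. generalize xcot_prim. intros u D.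
  evar_last.
  { apply (is_derive_plus (V := R_NormedModule)).
    - auto_derive; [exact P|reflexivity].
    - apply is_derive_scal. apply (is_derive_comp (V := R_NormedModule) u (fun x => (PI - x) / 2)); [exact D|].
      auto_derive; [exact I|reflexivity]. }
  unfold minus, plus, opp, scal; simpl; unfold mult; simpl.
  rewrite (xcot_ne ((PI - th) / 2)); [|lra].
  replace ((PI - th) / 2) with (PI / 2 - th / 2) by field.
  rewrite cos_shift sin_shift (sin_cos_half th H). field. lra.
Qed.

(** With s = sqrt |y|, the bound 1 - cos y >= y^2/4 = 4 (s/2)^4 together with ln(s/2) >= 1 - 2/s
    gives ln(1 - cos y) >= - 8/s, and |y| = s^2. *)
Lemma ln1pcos_small (y : R) : Rabs y <= 1 -> Rabs (y * ln (1 - cos y)) <= 8 * sqrt (Rabs y).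
Proof.
  intro Hy. destruct (Req_dec y 0) as [->|N].
  { rewrite Rmult_0_l Rabs_R0 sqrt_0. lra. }
  assert (Hp := Rabs_pos_lt y N).
  assert (Hy' := proj1 (Rabs_le_between _ _) Hy).
  assert (B : y ^ 2 / 4 <= 1 - cos y).
  { assert (X := cos_bound y 0). unfold cos_approx, cos_term in X. simpl in X.
    assert (PI2 := PI2_1). destruct X as [_ X]; [lra|lra|].
    field_simplify in X. assert (y ^ 2 <= 1) by nra. 
    replace (y ^ 4) with (y ^ 2 * y ^ 2) in X by ring. nra. }
  assert (U : 1 - cos y <= 1).
  { enough (0 <= cos y) by lra. assert (PI2 := PI2_1). apply cos_ge_0; lra. }
  set (s := sqrt (Rabs y)).
  assert (Hs : 0 < s) by (apply sqrt_lt_R0, Hp).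
  assert (Es : s * s = Rabs y) by (apply sqrt_sqrt; lra).
  assert (E4 : y ^ 2 / 4 = (s * s / 2) * (s * s / 2)).
  { rewrite Es -(pow2_abs y). field. }
  assert (Lw : - 8 / s <= ln (1 - cos y)).
  { apply Rle_trans with (ln (y ^ 2 / 4)).
    - assert (L := exp_ineq1_le (- ln (s / 2))).
      rewrite exp_Ropp exp_ln in L; [|lra].
      rewrite E4. replace (s * s / 2 * (s * s / 2)) with ((s / 2) * (s / 2) * ((s / 2) * (s / 2)) * 4) by field.
      assert (Hr : 0 < s / 2) by lra.
      assert (Hrr : 0 < s / 2 * (s / 2)) by (apply Rmult_lt_0_compat; assumption).
      rewrite (ln_mult _ 4); [|apply Rmult_lt_0_compat; assumption|lra].
      rewrite (ln_mult (s / 2 * (s / 2))) // (ln_mult (s / 2)) //.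
      assert (0 < ln 4) by (rewrite -ln_1; apply ln_increasing; lra).
      replace (- 8 / s) with (- 4 * / (s / 2)) by (field; lra). lra.
    - apply ln_le; [nra|exact B]. }
  assert (Up : ln (1 - cos y) <= 0).
  { rewrite -ln_1. apply ln_le; [nra|exact U]. }
  rewrite Rabs_mult (Rabs_left1 (ln _)); [|exact Up].
  rewrite -Es. replace (8 * s) with (s * s * (8 / s)) by (field; lra).
  apply Rmult_le_compat_l; [nra|]. replace (8 / s) with (- (- 8 / s)) by (field; lra). lra.
Qed.

Lemma ln1pcos_weight_lim : filterlim (fun th => (th - PI) * ln1pcos th) (locally PI) (locally 0).
Proof.
  intros P [eps HP].
  assert (Hd : 0 < Rmin 1 ((eps / 8) ^ 2)).
  { apply Rmin_pos; [lra|]. assert (h := cond_pos eps). apply pow_lt; lra. }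
  exists (mkposreal _ Hd). intros th Hth. change (Rabs (th - PI) < Rmin 1 ((eps / 8) ^ 2)) in Hth.
  assert (H1 := Rlt_le_trans _ _ _ Hth (Rmin_l _ _)). assert (H2 := Rlt_le_trans _ _ _ Hth (Rmin_r _ _)).
  apply HP. change (Rabs ((th - PI) * ln1pcos th - 0) < eps). rewrite Rminus_0_r.
  unfold ln1pcos. replace (1 + cos th) with (1 - cos (th - PI)) by (rewrite cos_minus cos_PI sin_PI; ring).
  eapply Rle_lt_trans; [apply ln1pcos_small; lra|].
  assert (H2' := sqrt_lt_1_alt _ _ (conj (Rabs_pos _) H2)). clear H2. rename H2' into H2.
  rewrite sqrt_pow2 in H2; [|assert (h := cond_pos eps); lra]. lra.
Qed.

(** The weight th - PI tames the logarithm at PI. The range extends past PI, up to the next zero of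
    1 + cos, because integrals are differentiated in their upper bound at PI itself. *)
Lemma ln1pcos_prim_cont (th : R) : - PI < th < 3 * PI -> continuous ln1pcos_prim th.
Proof.
  intro H. assert (PIp := PI_RGT_0). unfold ln1pcos_prim.
  apply (continuous_plus (V := R_NormedModule) (fun t => (t - PI) * ln1pcos t - PI * ln 2) (fun t => 4 * xcot_prim ((PI - t) / 2))).
  - apply (continuous_minus (V := R_NormedModule) (fun t => (t - PI) * ln1pcos t) (fun _ => PI * ln 2)); [|apply continuous_const].
    destruct (Req_dec th PI) as [->|N].
    + unfold continuous. replace ((PI - PI) * ln1pcos PI) with 0 by ring. apply ln1pcos_weight_lim.
    + apply @ex_derive_continuous. unfold ln1pcos. auto_derive.
      destruct (Rlt_le_dec th PI) as [L|L]; [apply one_plus_cos_pos; lra|].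
      replace (cos th) with (cos (th - 2 * PI)) by (rewrite -(cos_period (th - 2 * PI) 1); f_equal; simpl; ring).
      apply one_plus_cos_pos. lra.
  - apply (continuous_scal_r (V := R_NormedModule) 4 (fun t => xcot_prim ((PI - t) / 2))).
    apply (continuous_comp (fun t => (PI - t) / 2) xcot_prim).
    + apply @ex_derive_continuous. auto_derive. exact I.
    + apply @ex_derive_continuous; eexists; apply xcot_prim_der; lra.
Qed.

Open Scope C_scope.

(** * Improper integrals over [0, PI) *)

(** The improper integral over [0, PI), encoded by a primitive that vanishes at 0 and tends to [l]
    at PI. Linearity is then that of derivatives and limits, and integration by parts is the product
    rule. *)
Definition has_prim (f : R -> C) (l : C) : Prop :=
  (forall th, (0 <= th < PI)%R -> Ccont f th)
  /\ exists F : R -> C, (forall th, (0 <= th < PI)%R -> Cder F th (f th))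
       /\ Ctends F (at_left PI) l /\ F 0%R = 0.

Lemma at_left_PI_pos (P : R -> Prop) :
  (forall th, (0 <= th < PI)%R -> P th) -> at_left PI P.
Proof.
  intro H. exists (mkposreal PI PI_RGT_0). intros y Hy Hl. apply H.
  change (Rabs (y - PI) < PI)%R in Hy. apply Rabs_def2 in Hy. lra.
Qed.

(** Two primitives vanishing at 0 coincide on [0, PI), hence so do their limits. Equations between
    integrals are obtained from this by showing that both sides integrate the same function. *)
Lemma has_prim_unique (f : R -> C) (l m : C) : has_prim f l -> has_prim f m -> l = m.
Proof.
  intros [_ (F & DF & LF & ZF)] [_ (G & DG & LG & ZG)].
  assert (E : forall th, (0 <= th < PI)%R -> F th = G th).
  { intros th Hth.
    assert (K : F 0%R - G 0%R = F th - G th).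
    { apply (Cder_zero_const (fun s => F s - G s) 0 th); [|lra].
      intros t Ht. eapply Cder_eq; [apply Cder_minus; [apply DF|apply DG]; lra|ring]. }
    rewrite ZF ZG in K. replace (F th) with (G th + (F th - G th)) by ring. rewrite -K. ring. }
  apply (Ctends_unique G (at_left PI)); [apply _| |exact LG].
  apply: Ctends_ext_loc LF. apply at_left_PI_pos, E.
Qed.

(** Agreement is asked to the left of 0 too, since continuity at 0 is two-sided. *)
Lemma has_prim_ext (f g : R -> C) (l : C) :
  (forall th, (- PI < th < PI)%R -> f th = g th) -> has_prim f l -> has_prim g l.
Proof.
  intros E [Cf (F & DF & LF & ZF)]. assert (PIp := PI_RGT_0). split.
  - intros th Hth. destruct (Cf th Hth) as [C1 C2].
    assert (N : locally th (fun t => f t = g t)).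
    { assert (Hd : (0 < Rmin (th + PI) (PI - th))%R) by (apply Rmin_pos; lra).
      exists (mkposreal _ Hd). intros y Hy. change (Rabs (y - th) < Rmin (th + PI) (PI - th))%R in Hy.
      assert (H1 := Rlt_le_trans _ _ _ Hy (Rmin_l _ _)). assert (H2 := Rlt_le_trans _ _ _ Hy (Rmin_r _ _)).
      apply Rabs_def2 in H1. apply Rabs_def2 in H2. apply E; lra. }
    split.
    + apply (continuous_ext_loc _ (fun t => Re (f t))); [|exact C1].
      revert N; apply filter_imp; intros t ->; reflexivity.
    + apply (continuous_ext_loc _ (fun t => Im (f t))); [|exact C2].
      revert N; apply filter_imp; intros t ->; reflexivity.
  - exists F; split; [|split; assumption]. intros th Hth. rewrite -E; [apply DF; lra|lra].
Qed.

Lemma has_prim_plus (f g : R -> C) (l m : C) :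
  has_prim f l -> has_prim g m -> has_prim (fun th => f th + g th) (l + m).
Proof.
  intros [Cf (F & DF & LF & ZF)] [Cg (G & DG & LG & ZG)]. split.
  - intros; apply Ccont_plus; [apply Cf|apply Cg]; assumption.
  - exists (fun th => F th + G th); split; [|split].
    + intros; apply Cder_plus; [apply DF|apply DG]; assumption.
    + apply Ctends_plus; [apply _|exact LF|exact LG].
    + rewrite ZF ZG; ring.
Qed.

Lemma has_prim_scal (c : C) (f : R -> C) (l : C) :
  has_prim f l -> has_prim (fun th => c * f th) (c * l).
Proof.
  intros [Cf (F & DF & LF & ZF)]. split.
  - intros; apply Ccont_mult; [apply Ccont_const|apply Cf; assumption].
  - exists (fun th => c * F th); split; [|split].
    + intros; apply Cder_scal, DF; assumption.
    + apply Ctends_mult; [apply _|apply Ctends_const, _|exact LF].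
    + rewrite ZF; ring.
Qed.

Lemma has_prim_FTC (F f : R -> C) (l : C) :
  (forall th, (0 <= th < PI)%R -> Ccont f th) ->
  (forall th, (0 <= th < PI)%R -> Cder F th (f th)) ->
  Ctends F (at_left PI) l -> has_prim f (l - F 0%R).
Proof.
  intros Cf DF LF. split; [exact Cf|]. exists (fun th => F th - F 0%R); split; [|split].
  - intros th Hth. eapply Cder_eq; [apply Cder_minus; [apply DF, Hth|apply Cder_const]|ring].
  - apply Ctends_plus; [apply _|exact LF|apply Ctends_const, _].
  - ring.
Qed.

Lemma Ctends_at_left (F : R -> C) (x : R) : Ccont F x -> Ctends F (at_left x) (F x).
Proof.
  intros [C1 C2]; split.
  - apply (filterlim_filter_le_1 (F := locally x)); [apply filter_le_within|exact C1].
  - apply (filterlim_filter_le_1 (F := locally x)); [apply filter_le_within|exact C2].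
Qed.

Lemma CInt_nn (f : R -> C) (a : R) : CInt f a a = 0.
Proof. unfold CInt; rewrite !(RInt_point (V := R_CompleteNormedModule)); reflexivity. Qed.

Lemma Cder_CInt_0 (f : R -> C) (th : R) :
  (forall t, (- PI < t < 3 * PI)%R -> Ccont f t) -> (0 <= th <= PI)%R ->
  Cder (fun x => CInt f 0 x) th (f th).
Proof.
  intros Cf Hth. assert (PIp := PI_RGT_0). assert (Hp : (0 < PI / 2)%R) by lra.
  apply (Cder_CInt f 0 th (mkposreal _ Hp)). intros t Ht. apply Cf.
  revert Ht; simpl; unfold Rmin, Rmax; destruct (Rle_dec 0 th); lra.
Qed.

Lemma has_prim_proper (f : R -> C) :
  (forall t, (- PI < t < 3 * PI)%R -> Ccont f t) -> has_prim f (CInt f 0 PI).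
Proof.
  intro Cf. assert (PIp := PI_RGT_0).
  replace (CInt f 0 PI) with (CInt f 0 PI - CInt f 0 0) by (rewrite CInt_nn; ring).
  apply (has_prim_FTC (fun x => CInt f 0 x)).
  - intros; apply Cf; lra.
  - intros; apply Cder_CInt_0; [exact Cf|lra].
  - apply (Ctends_at_left (fun x => CInt f 0 x)). eapply Cder_Ccont, Cder_CInt_0; [exact Cf|lra].
Qed.

Lemma has_prim_is_CInt (f : R -> C) (l : C) : has_prim f l -> is_CInt_0_PI f l.
Proof.
  intros [Cf (F & DF & LF & ZF)].
  assert (L := Ctends_filterlim F (at_left PI) l _ LF).
  intros P HP. assert (G := L P HP). unfold filtermap in G.
  unfold filtermapi.
  exists (fun x => x = 0%R) (fun b => (0 < b < PI)%R /\ P (F b)).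
  - reflexivity.
  - apply filter_and; [|exact G].
    exists (mkposreal PI PI_RGT_0). intros y Hy Hl.
    change (Rabs (y - PI) < PI)%R in Hy. apply Rabs_def2 in Hy. lra.
  - intros a b -> [Hb HPb]. exists (F b). split; [|exact HPb]. simpl.
    assert (R1 : is_RInt (fun t => Re (f t)) 0 b (Re (F b) - Re (F 0%R))%R).
    { apply (is_RInt_derive (V := R_CompleteNormedModule) (fun t => Re (F t))).
      - intros t; rewrite Rmin_left ?Rmax_right; try lra. intro Ht; apply DF; lra.
      - intros t; rewrite Rmin_left ?Rmax_right; try lra. intro Ht; apply Cf; lra. }
    assert (R2 : is_RInt (fun t => Im (f t)) 0 b (Im (F b) - Im (F 0%R))%R).
    { apply (is_RInt_derive (V := R_CompleteNormedModule) (fun t => Im (F t))).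
      - intros t; rewrite Rmin_left ?Rmax_right; try lra. intro Ht; apply DF; lra.
      - intros t; rewrite Rmin_left ?Rmax_right; try lra. intro Ht; apply Cf; lra. }
    rewrite ZF in R1 R2. simpl in R1, R2. rewrite Rminus_0_r in R1. rewrite Rminus_0_r in R2.
    replace (F b) with (Re (F b), Im (F b)) by (destruct (F b); reflexivity).
    apply (is_RInt_fct_extend_pair (U := R_NormedModule) (V := R_NormedModule) f); assumption.
Qed.

(** * The integrand and its logarithmic part *)

Definition ez (z : C) (t th : R) : C := Cexp (- Ci * z * RtoC t * RtoC (cos th)).

(** At k = 0 the convention [/ INR 0 = 0] removes the constant term, so the series effectively
    starts at k = 1. *)
Definition ecoef (z : C) (k : nat) : C := (Ci * z) ^ k * RtoC (/ INR k / INR (fact k))%R.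

(* Ein-type series: Gamma(0, w) = - gamma - ln w - einc on the ray w = - i z x *)
Definition einc (z : C) (x : R) : C := CPS (ecoef z) x.

(** The entire function (e^{i z x} - 1)/x, the derivative of [einc]. *)
Definition einc1 (z : C) (x : R) : C :=
  CPS (fun k => (Ci * z) ^ S k * RtoC (1 / INR (fact (S k)))%R) x.

Lemma ecoef_fast (z : C) : Cfast (ecoef z).
Proof.
  apply (Cfast_pow_fact (Ci * z) (fun k => / INR k)%R 1 1); [lra|].
  intro n; rewrite pow1 Rmult_1_r. destruct n as [|n]; [simpl; rewrite Rinv_0 Rabs_R0; lra|].
  rewrite S_INR. assert (h := pos_INR n). rewrite Rabs_right.
  - rewrite -Rinv_1; apply Rinv_le_contravar; lra.
  - apply Rle_ge, Rlt_le, Rinv_0_lt_compat; lra.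
Qed.

Lemma einc_der (z : C) (x : R) : Cder (einc z) x (einc1 z x).
Proof.
  eapply Cder_eq; [apply Cder_CPS, ecoef_fast|].
  apply CPS_ext; intro n; unfold Cderiv, ecoef.
  assert (h : INR (S n) <> 0%R) by (apply not_0_INR; lia).
  replace (1 / INR (fact (S n)))%R with (INR (S n) * (/ INR (S n) / INR (fact (S n))))%R
    by (field; split; [apply INR_fact_neq_0|exact h]).
  rewrite (RtoC_mult (INR (S n))). ring.
Qed.

Lemma einc1_eq (z : C) (x : R) : RtoC x * einc1 z x = Cexp (Ci * z * RtoC x) - 1.
Proof.
  destruct (Cexp_CPS (Ci * z) x) as [F E]. rewrite -E (CPS_decr _ x F).
  unfold einc1. simpl Cpow at 2. replace (1 / INR (fact 0))%R with 1%R by (simpl; field). ring.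
Qed.

Lemma einc_0 (z : C) : einc z 0 = 0.
Proof. unfold einc; rewrite CPS_0; unfold ecoef; simpl. rewrite Rinv_0. unfold Rdiv; rewrite Rmult_0_l. ring. Qed.

Lemma einc1_cont (z : C) (x : R) : Ccont (einc1 z) x.
Proof.
  eapply Cder_Ccont. apply Cder_CPS. apply (Cfast_shift (fun k => (Ci * z) ^ k * RtoC (1 / INR (fact k))%R)).
  apply (Cexp_CPS (Ci * z) 0).
Qed.

(** Isolates ln c, the only part that becomes singular at th = PI when c = 1 + cos th; the series in
    the definition is [einc] with its zero constant term dropped. *)
Lemma Gamma0_mi_einc (c : R) (z : C) :
  Gamma0_mi c z = - RtoC EulerMascheroni - (RtoC (ln c) + Cln z - Ci * RtoC PI / 2) - einc z c.
Proof.
  unfold Gamma0_mi, Gamma0_log. f_equal. f_equal.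
  apply CSeries_unique.
  unfold einc. rewrite (CPS_decr _ c (ecoef_fast z)).
  replace (ecoef z 0) with (RtoC 0).
  2: { unfold ecoef; simpl. rewrite Rinv_0. unfold Rdiv; rewrite Rmult_0_l. ring. }
  rewrite Cplus_0_l.
  assert (H := is_series_CPS _ c (Cfast_shift _ (ecoef_fast z))).
  assert (H' := is_series_scal (K := C_AbsRing) (V := C_NormedModule) (RtoC c) _ _ H).
  apply: is_series_ext H'. intro n. match goal with |- _ = ?r => change (RtoC c * (ecoef z (S n) * RtoC c ^ n) = r) end.
  unfold ecoef. rewrite RtoC_div; [|apply INR_fact_neq_0].
  rewrite RtoC_Rinv !Cpow_S.
  replace (- (- Ci * RtoC c * z)) with (Ci * z * RtoC c) by ring.
  rewrite !Cpow_mult_l. field. split; [apply RtoC_fact_nz|apply RtoC_INR_S_nz].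
Qed.

Lemma Cder_cos (x : R) : Cder (fun t => RtoC (cos t)) x (- RtoC (sin x)).
Proof. rewrite -RtoC_opp. apply Cder_RtoC, is_derive_cos. Qed.

Lemma Cder_sin (x : R) : Cder (fun t => RtoC (sin t)) x (RtoC (cos x)).
Proof. apply Cder_RtoC, is_derive_sin. Qed.

Lemma Ccont_cos (x : R) : Ccont (fun t => RtoC (cos t)) x.
Proof. eapply Cder_Ccont, Cder_cos. Qed.

Lemma Ccont_sin (x : R) : Ccont (fun t => RtoC (sin t)) x.
Proof. eapply Cder_Ccont, Cder_sin. Qed.

Lemma ez_der_th (z : C) (t th : R) :
  Cder (ez z t) th (Ci * z * RtoC t * RtoC (sin th) * ez z t th).
Proof.
  unfold ez. eapply Cder_eq.
  - apply Cder_Cexp, Cder_scal, Cder_cos.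
  - cbv beta; ring.
Qed.

Lemma ez_der_t (z : C) (t th : R) :
  Cder (fun s => ez z s th) t (- Ci * z * RtoC (cos th) * ez z t th).
Proof.
  unfold ez. eapply Cder_eq.
  - apply Cder_Cexp, Cder_mult; [apply Cder_scal, Cder_id|apply Cder_const].
  - cbv beta; ring.
Qed.

Lemma ez_cont (z : C) (t th : R) : Ccont (ez z t) th.
Proof. eapply Cder_Ccont, ez_der_th. Qed.

Lemma einc_arg_der_th (t th : R) :
  is_derive (fun x => t * (1 + cos x))%R th (- (t * sin th))%R.
Proof. auto_derive; [exact I|ring]. Qed.

Lemma einc_th_der (z : C) (t th : R) :
  Cder (fun x => einc z (t * (1 + cos x))) th (- RtoC (t * sin th) * einc1 z (t * (1 + cos th))).
Proof.
  eapply Cder_eq; [apply (Cder_comp (einc z) _ th _ _ (einc_der z _) (einc_arg_der_th t th))|].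
  rewrite RtoC_opp; ring.
Qed.

Lemma einc_th_cont (z : C) (t th : R) : Ccont (fun x => einc z (t * (1 + cos x))) th.
Proof. eapply Cder_Ccont, einc_th_der. Qed.

Lemma einc1_th_cont (z : C) (t th : R) : Ccont (fun x => einc1 z (t * (1 + cos x))) th.
Proof.
  apply (Ccont_comp (einc1 z) (fun x => t * (1 + cos x))%R); [apply einc1_cont|].
  apply @ex_derive_continuous; eexists; apply einc_arg_der_th.
Qed.

(** e^{-i z t cos th} times the part of - Gamma(0, - i z t (1 + cos th)) that varies with th. The
    discarded part is constant in th and contains ln t; without it the value at t = 0 is finite. *)
Definition Qf (z : C) (t th : R) : C := ez z t th * (RtoC (ln1pcos th) + einc z (t * (1 + cos th))).

Definition tan_half (th : R) : R := (sin th / (1 + cos th))%R.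

Lemma ln1pcos_der (th : R) : (- PI < th < PI)%R -> is_derive ln1pcos th (- tan_half th)%R.
Proof.
  intro H. assert (P := one_plus_cos_pos th H). unfold ln1pcos, tan_half. auto_derive; [exact P|]. field. lra.
Qed.

(** The bracket of [Qf] has derivative - tan(th/2) e^{i z t (1 + cos th)}, and multiplying by e^{-i
    z t cos th} leaves e^{i z t}, free of th. This is the source of every inhomogeneous term
    below. *)
Lemma Qf_der_th (z : C) (t th : R) : (- PI < th < PI)%R ->
  Cder (Qf z t) th
    (Ci * z * RtoC t * RtoC (sin th) * Qf z t th - Cexp (Ci * z * RtoC t) * RtoC (tan_half th)).
Proof.
  intro H. assert (P := one_plus_cos_pos th H). unfold Qf. eapply Cder_eq.
  - apply Cder_mult; [apply ez_der_th|].
    apply Cder_plus; [apply Cder_RtoC, ln1pcos_der, H|apply einc_th_der].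
  - cbv beta. assert (E := einc1_eq z (t * (1 + cos th))).
    assert (X : Cexp (Ci * z * RtoC t) = ez z t th * Cexp (Ci * z * RtoC (t * (1 + cos th)))).
    { unfold ez. rewrite -Cexp_plus; f_equal. rewrite RtoC_mult RtoC_plus. ring. }
    rewrite X. replace (Cexp (Ci * z * RtoC (t * (1 + cos th))))
      with (RtoC (t * (1 + cos th)) * einc1 z (t * (1 + cos th)) + 1) by (rewrite E; ring).
    replace (RtoC (t * sin th)) with (RtoC (t * (1 + cos th)) * RtoC (tan_half th)).
    2: { rewrite -RtoC_mult; f_equal. unfold tan_half; field. lra. }
    rewrite RtoC_opp. ring.
Qed.

Lemma Qf_cont (z : C) (t th : R) : (- PI < th < PI)%R -> Ccont (Qf z t) th.
Proof. intro H; eapply Cder_Ccont, Qf_der_th, H. Qed.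

Lemma tan_half_cont (th : R) : (- PI < th < PI)%R -> Ccont (fun x => RtoC (tan_half x)) th.
Proof.
  intro H. assert (P := one_plus_cos_pos th H). apply Ccont_RtoC, @ex_derive_continuous.
  unfold tan_half. auto_derive. lra.
Qed.

(** f(th)/(th - PI) tends to l, while (th - PI) ln(1 + cos th) tends to 0. *)
Lemma ln1pcos_times_vanishing (f : R -> C) (l : C) :
  Cder f PI l -> f PI = 0 -> Ctends (fun th => f th * RtoC (ln1pcos th)) (at_left PI) 0.
Proof.
  intros [D1 D2] Z.
  assert (T1 : filterlim (fun th => th - PI)%R (at_left PI) (locally' 0)).
  { intros P [eps HP]. exists eps. intros y Hy Hl. apply HP.
    - change (Rabs (y - PI - 0) < eps)%R. rewrite Rminus_0_r. exact Hy.
    - lra. }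
  assert (G : forall (u : R -> R) (a : R), is_derive u PI a -> u PI = 0%R ->
     filterlim (fun th => u th / (th - PI))%R (at_left PI) (locally a)).
  { intros u a Du Zu.
    assert (D' : is_derive (fun e => u (PI + e)%R) 0 a).
    { assert (Du' : is_derive u (PI + 0)%R a) by (rewrite Rplus_0_r; exact Du).
      assert (Dv : is_derive (fun e => PI + e)%R 0 1%R) by (auto_derive; [exact I|reflexivity]).
      evar_last; [exact (is_derive_comp (V := R_NormedModule) u (fun e => PI + e)%R 0 _ _ Du' Dv)|].
      unfold scal; simpl; unfold mult; simpl; ring. }
    assert (L := diff_quotient_lim (fun e => u (PI + e)%R) a (eq_trans (f_equal u (Rplus_0_r PI)) Zu) D').
    apply (filterlim_ext (fun th => u (PI + (th - PI)) / (th - PI))%R).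
    { intro th; do 2 f_equal; ring. }
    exact (filterlim_comp _ _ _ (fun th => th - PI)%R _ _ _ _ T1 L). }
  assert (T : Ctends (fun th => (Re (f th) / (th - PI), Im (f th) / (th - PI))%R) (at_left PI) l).
  { split; apply G; try assumption; rewrite Z; reflexivity. }
  assert (W : Ctends (fun th => RtoC ((th - PI) * ln1pcos th)) (at_left PI) (RtoC 0)).
  { apply Ctends_RtoC; [apply _|].
    apply (filterlim_filter_le_1 (F := locally PI)); [apply filter_le_within|apply ln1pcos_weight_lim]. }
  assert (M := Ctends_mult _ _ _ _ _ _ T W). replace (l * RtoC 0) with (RtoC 0) in M by ring.
  apply: Ctends_ext_loc M. exists (mkposreal 1 Rlt_0_1). intros y _ Hl.
  apply C_ext; unfold Re, Im, RtoC; simpl; field; lra.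
Qed.

(** A weight vanishing at PI suppresses the logarithmic boundary term; it will be sin th or sin(m
    th), for which the term at 0 vanishes too. *)
Lemma Qf_by_parts (p p' : R -> C) (z : C) (t : R) :
  (forall th, Cder p th (p' th)) -> (forall th, Ccont p' th) -> p PI = 0 ->
  has_prim (fun th => p' th * Qf z t th
     + p th * (Ci * z * RtoC t * RtoC (sin th) * Qf z t th - Cexp (Ci * z * RtoC t) * RtoC (tan_half th)))
   (- (p 0%R * Qf z t 0)).
Proof.
  intros D Cp' Z. assert (PIp := PI_RGT_0).
  replace (- (p 0%R * Qf z t 0)) with (0 - p 0%R * Qf z t 0) by ring.
  apply (has_prim_FTC (fun th => p th * Qf z t th)).
  - intros th Hth. assert (K : (- PI < th < PI)%R) by lra.
    assert (Cp : Ccont p th) by (eapply Cder_Ccont, D).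
    apply Ccont_plus; [apply Ccont_mult; [apply Cp'|apply Qf_cont, K]|].
    apply Ccont_mult; [exact Cp|].
    apply Ccont_minus; [apply Ccont_mult; [|apply Qf_cont, K]|].
    + apply Ccont_mult; [apply Ccont_const|apply Ccont_sin].
    + apply Ccont_mult; [apply Ccont_const|apply tan_half_cont, K].
  - intros th Hth. apply Cder_mult; [apply D|apply Qf_der_th; lra].
  - assert (Dpe : Cder (fun th => p th * ez z t th) PI
       (p' PI * ez z t PI + p PI * (Ci * z * RtoC t * RtoC (sin PI) * ez z t PI))).
    { apply Cder_mult; [apply D|apply ez_der_th]. }
    assert (L1 := ln1pcos_times_vanishing _ _ Dpe ltac:(cbv beta; rewrite Z; ring)).
    assert (L2 : Ctends (fun th => p th * ez z t th * einc z (t * (1 + cos th))) (at_left PI) 0).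
    { replace (RtoC 0) with (p PI * ez z t PI * einc z (t * (1 + cos PI))) by (rewrite Z; ring).
      apply (Ctends_at_left (fun th => p th * ez z t th * einc z (t * (1 + cos th)))).
      apply Ccont_mult; [eapply Cder_Ccont, Dpe|apply einc_th_cont]. }
    assert (L := Ctends_plus _ _ _ _ _ _ L1 L2). replace (0 + 0) with (RtoC 0) in L by ring.
    apply: Ctends_ext_loc L. apply filter_forall; intro th. unfold Qf. ring.
Qed.

(* The improper integral of p * Qf z t over [0, PI], with the logarithmic singularity removed by parts. *)
Definition Wf (z : C) (p p' : R -> C) (t : R) : C :=
  CInt (fun th => p th * ez z t th * einc z (t * (1 + cos th))) 0 PI
  - RtoC (PI * ln 2) * (p PI * ez z t PI)
  - CInt (fun th => (p' th + Ci * z * RtoC t * RtoC (sin th) * p th) * ez z t th * RtoC (ln1pcos_prim th)) 0 PI.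

(** The logarithmic part is written as the derivative of p e^{...} L minus (p e^{...})' L, where L =
    [ln1pcos_prim] is continuous at PI with L(0) = 0 and L(PI) = - PI ln 2; the latter gives the
    middle term of [Wf]. *)
Lemma Wf_prim (z : C) (p p' : R -> C) (t : R) :
  (forall th, Cder p th (p' th)) -> (forall th, Ccont p' th) ->
  has_prim (fun th => p th * Qf z t th) (Wf z p p' t).
Proof.
  intros D Cp'. assert (PIp := PI_RGT_0).
  assert (Cp : forall th, Ccont p th) by (intro; eapply Cder_Ccont, D).
  set (f1 := fun th => p th * ez z t th * einc z (t * (1 + cos th))).
  set (f2 := fun th => (p' th + Ci * z * RtoC t * RtoC (sin th) * p th) * ez z t th * RtoC (ln1pcos_prim th)).
  assert (C1 : forall th, Ccont f1 th).
  { intro th. apply Ccont_mult; [apply Ccont_mult; [apply Cp|apply ez_cont]|apply einc_th_cont]. }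
  assert (C2 : forall th, (- PI < th < 3 * PI)%R -> Ccont f2 th).
  { intros th Hth. apply Ccont_mult; [|apply Ccont_RtoC, ln1pcos_prim_cont, Hth].
    apply Ccont_mult; [|apply ez_cont]. apply Ccont_plus; [apply Cp'|].
    apply Ccont_mult; [|apply Cp]. apply Ccont_mult; [apply Ccont_const|apply Ccont_sin]. }
  set (F := fun x => CInt f1 0 x + p x * ez z t x * RtoC (ln1pcos_prim x) - CInt f2 0 x).
  assert (Dpe : forall th, Cder (fun th => p th * ez z t th) th
       (p' th * ez z t th + p th * (Ci * z * RtoC t * RtoC (sin th) * ez z t th))).
  { intro th. apply Cder_mult; [apply D|apply ez_der_th]. }
  assert (F0 : F 0%R = 0).
  { unfold F. rewrite !CInt_nn ln1pcos_prim_0. ring. }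
  replace (Wf z p p' t) with (F PI - F 0%R).
  2: { rewrite F0. unfold F, Wf, f1, f2. rewrite ln1pcos_prim_PI RtoC_opp. ring. }
  apply (has_prim_FTC F).
  - intros th Hth. apply Ccont_mult; [apply Cp|apply Qf_cont; lra].
  - intros th Hth. eapply Cder_eq.
    + apply Cder_minus; [apply Cder_plus|].
      * apply Cder_CInt_0; [intros; apply C1|lra].
      * apply Cder_mult; [apply Dpe|apply Cder_RtoC, ln1pcos_prim_der; lra].
      * apply Cder_CInt_0; [exact C2|lra].
    + unfold f1, f2, Qf. cbv beta. ring.
  - apply Ctends_at_left. apply Ccont_minus; [apply Ccont_plus|].
    + eapply Cder_Ccont, Cder_CInt_0; [intros; apply C1|lra].
    + apply Ccont_mult; [eapply Cder_Ccont, Dpe|apply Ccont_RtoC, ln1pcos_prim_cont; lra].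
    + eapply Cder_Ccont, Cder_CInt_0; [exact C2|lra].
Qed.

Notation RxR := (prod_UniformSpace R_UniformSpace R_UniformSpace).

Lemma Ccont_fst (f : R -> C) (x : R * R) : Ccont f (fst x) -> Ccont (U := RxR) (fun q => f (fst q)) x.
Proof. intro H; apply (Ccont_comp (U := RxR) f fst); [exact H|apply continuous_fst]. Qed.

Lemma Ccont_snd (f : R -> C) (x : R * R) : Ccont f (snd x) -> Ccont (U := RxR) (fun q => f (snd q)) x.
Proof. intro H; apply (Ccont_comp (U := RxR) f snd); [exact H|apply continuous_snd]. Qed.

Lemma ez_cont2 (z : C) (x : R * R) : Ccont (U := RxR) (fun q => ez z (fst q) (snd q)) x.
Proof.
  unfold ez. apply Ccont_Cexp, Ccont_mult.
  - apply Ccont_mult; [apply Ccont_const|].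
    apply (Ccont_fst (fun t => RtoC t)). eapply Cder_Ccont, Cder_id.
  - apply (Ccont_snd (fun t => RtoC (cos t))). apply Ccont_cos.
Qed.

Lemma einc_arg_cont2 (x : R * R) : continuous (T := RxR) (fun q => fst q * (1 + cos (snd q)))%R x.
Proof.
  apply (continuous_mult (K := R_AbsRing) (U := RxR) fst (fun q => 1 + cos (snd q))%R); [apply continuous_fst|].
  apply (continuous_comp (U := RxR) (V := R_UniformSpace) snd (fun t => 1 + cos t)%R); [apply continuous_snd|].
  apply @ex_derive_continuous. auto_derive. exact I.
Qed.

(** Differentiating e^{-i z t cos th} multiplies the weight by - i z cos th, so the result is again
    a [Wf]; the last integral is the derivative of [einc] in t and has no logarithm. *)
Lemma Wf_der (z : C) (p p' : R -> C) (t : R) :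
  (forall th, Cder p th (p' th)) -> (forall th, Ccont p' th) ->
  Cder (Wf z p p') t
    (Wf z (fun th => - Ci * z * RtoC (cos th) * p th)
          (fun th => Ci * z * RtoC (sin th) * p th + - Ci * z * RtoC (cos th) * p' th) t
     + CInt (fun th => p th * ez z t th * RtoC (1 + cos th) * einc1 z (t * (1 + cos th))) 0 PI).
Proof.
  intros D Cp'. assert (PIp := PI_RGT_0).
  assert (Cp : forall th, Ccont p th) by (intro; eapply Cder_Ccont, D).
  assert (CE : forall x : R * R, Ccont (U := RxR) (fun q => einc z (fst q * (1 + cos (snd q)))) x).
  { intro x. apply (Ccont_comp (U := RxR) (einc z) (fun q => fst q * (1 + cos (snd q)))%R); [|apply einc_arg_cont2].
    eapply Cder_Ccont, einc_der. }
  assert (CE1 : forall x : R * R, Ccont (U := RxR) (fun q => einc1 z (fst q * (1 + cos (snd q)))) x).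
  { intro x. apply (Ccont_comp (U := RxR) (einc1 z) (fun q => fst q * (1 + cos (snd q)))%R); [|apply einc_arg_cont2].
    apply einc1_cont. }
  assert (DE : forall s th, Cder (fun s => einc z (s * (1 + cos th))) s (RtoC (1 + cos th) * einc1 z (s * (1 + cos th)))).
  { intros s th. apply (Cder_comp (einc z) (fun s => s * (1 + cos th))%R s); [apply einc_der|].
    auto_derive; [exact I|ring]. }
  set (g := fun s th => p th * ez z s th * RtoC (1 + cos th) * einc1 z (s * (1 + cos th))).
  set (h := fun s th => (- Ci * z * RtoC (cos th) * p th) * ez z s th * einc z (s * (1 + cos th))).
  assert (C1c : forall th, Ccont (fun x => RtoC (1 + cos x)) th).
  { intro th. apply Ccont_RtoC, @ex_derive_continuous. auto_derive. exact I. }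
  assert (Cg : forall s th, Ccont (g s) th).
  { intros s th. apply Ccont_mult; [apply Ccont_mult; [apply Ccont_mult; [apply Cp|apply ez_cont]|apply C1c]|apply einc1_th_cont]. }
  assert (Ch : forall s th, Ccont (h s) th).
  { intros s th. apply Ccont_mult; [apply Ccont_mult; [|apply ez_cont]|apply einc_th_cont].
    apply Ccont_mult; [|apply Cp]. apply Ccont_mult; [apply Ccont_const|apply Ccont_cos]. }
  assert (D1 : Cder (fun s => CInt (fun th => p th * ez z s th * einc z (s * (1 + cos th))) 0 PI) t
     (CInt (fun th => h t th + g t th) 0 PI)).
  { apply (Cder_CInt_param (fun s th => p th * ez z s th * einc z (s * (1 + cos th))) (fun s th => h s th + g s th)).
    - intros s th. eapply Cder_eq.
      + apply Cder_mult; [apply Cder_scal, ez_der_t|apply DE].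
      + unfold h, g; cbv beta; ring.
    - intros th _. apply Ccont_plus.
      + unfold h. apply Ccont_mult; [apply Ccont_mult; [|apply ez_cont2]|apply CE].
        apply (Ccont_snd (fun th => - Ci * z * RtoC (cos th) * p th)).
        apply Ccont_mult; [|apply Cp]. apply Ccont_mult; [apply Ccont_const|apply Ccont_cos].
      + unfold g. apply Ccont_mult; [|apply CE1].
        apply Ccont_mult; [|apply (Ccont_snd (fun th => RtoC (1 + cos th))), C1c].
        apply Ccont_mult; [|apply ez_cont2]. apply (Ccont_snd p), Cp.
    - intros s th _. apply Ccont_mult; [apply Ccont_mult; [apply Cp|apply ez_cont]|apply einc_th_cont]. }
  assert (S1 : CInt (fun th => h t th + g t th) 0 PI = CInt (h t) 0 PI + CInt (g t) 0 PI).
  { apply (has_prim_unique (fun th => h t th + g t th)).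
    - apply has_prim_proper; intros; apply Ccont_plus; [apply Ch|apply Cg].
    - apply has_prim_plus; apply has_prim_proper; intros; [apply Ch|apply Cg]. }
  set (k := fun s th => (p' th + Ci * z * RtoC s * RtoC (sin th) * p th) * ez z s th * RtoC (ln1pcos_prim th)).
  set (kt := fun s th => (Ci * z * RtoC (sin th) * p th + - Ci * z * RtoC (cos th) * p' th
     + Ci * z * RtoC s * RtoC (sin th) * (- Ci * z * RtoC (cos th) * p th)) * ez z s th * RtoC (ln1pcos_prim th)).
  assert (D2 : Cder (fun s => CInt (k s) 0 PI) t (CInt (kt t) 0 PI)).
  { apply Cder_CInt_param.
    - intros s th. unfold k. eapply Cder_eq.
      + apply Cder_mult; [|apply Cder_const]. apply Cder_mult; [|apply ez_der_t].
        apply Cder_plus; [apply Cder_const|]. apply Cder_mult; [|apply Cder_const].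
        apply Cder_mult; [|apply Cder_const]. apply Cder_scal, Cder_id.
      + unfold kt; cbv beta; ring.
    - intros th Hth. rewrite Rmin_left in Hth; [|lra]. rewrite Rmax_right in Hth; [|lra].
      unfold kt. apply Ccont_mult; [|apply (Ccont_snd (fun th => RtoC (ln1pcos_prim th))), Ccont_RtoC, ln1pcos_prim_cont; simpl; lra].
      apply Ccont_mult; [|apply ez_cont2]. apply Ccont_plus.
      + apply (Ccont_snd (fun th => Ci * z * RtoC (sin th) * p th + - Ci * z * RtoC (cos th) * p' th)).
        apply Ccont_plus; (apply Ccont_mult; [apply Ccont_mult; [apply Ccont_const|]|]).
        * apply Ccont_sin. * apply Cp. * apply Ccont_cos. * apply Cp'.
      + apply Ccont_mult; [apply Ccont_mult; [apply Ccont_mult; [apply Ccont_const|]|]|].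
        * apply (Ccont_fst (fun t => RtoC t)). eapply Cder_Ccont, Cder_id.
        * apply (Ccont_snd (fun t => RtoC (sin t))), Ccont_sin.
        * apply (Ccont_snd (fun th => - Ci * z * RtoC (cos th) * p th)).
          apply Ccont_mult; [|apply Cp]. apply Ccont_mult; [apply Ccont_const|apply Ccont_cos].
    - intros s th Hth. rewrite Rmin_left in Hth; [|lra]. rewrite Rmax_right in Hth; [|lra].
      unfold k. apply Ccont_mult; [|apply Ccont_RtoC, ln1pcos_prim_cont; lra].
      apply Ccont_mult; [|apply ez_cont]. apply Ccont_plus; [apply Cp'|].
      apply Ccont_mult; [|apply Cp]. apply Ccont_mult; [apply Ccont_const|apply Ccont_sin]. }
  unfold Wf. eapply Cder_eq.
  - apply Cder_minus; [apply Cder_minus|exact D2]; [exact D1|].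
    apply Cder_scal, Cder_scal, ez_der_t.
  - rewrite S1. unfold h, g, kt. rewrite cos_PI. ring.
Qed.

(** * The differential system in the radial variable *)

(* |A|^2 + |B|^2 grows at most like exp (2 |Im z| t): the singular term - B / t only decreases it. *)
Lemma bessel_system_unique (z : C) (A B : R -> C) (T : R) : (0 < T)%R ->
  (forall t, (0 < t <= T)%R -> Cder A t (- Ci * z * B t)) ->
  (forall t, (0 < t <= T)%R -> Cder B t (- Ci * z * A t - B t / RtoC t)) ->
  Ccont A 0%R -> Ccont B 0%R -> A 0%R = 0 -> B 0%R = 0 -> A T = 0 /\ B T = 0.
Proof.
  intros HT DA DB CA CB ZA ZB.
  set (K := (2 * Rabs (Im z))%R).
  set (N := fun t => ((Re (A t) * Re (A t) + Im (A t) * Im (A t) + Re (B t) * Re (B t) + Im (B t) * Im (B t)) * exp (- (K * t)))%R).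
  assert (G : forall (u v w y : R -> R) (t du dv dw dy : R),
    is_derive u t du -> is_derive v t dv -> is_derive w t dw -> is_derive y t dy ->
    is_derive (fun s => (u s * u s + v s * v s + w s * w s + y s * y s) * exp (- (K * s)))%R t
      ((2 * (u t * du + v t * dv + w t * dw + y t * dy)
        - K * (u t * u t + v t * v t + w t * w t + y t * y t)) * exp (- (K * t)))%R).
  { intros u v w y t du dv dw dy H1 H2 H3 H4.
    assert (ex_derive u t) by (eexists; exact H1). assert (ex_derive v t) by (eexists; exact H2).
    assert (ex_derive w t) by (eexists; exact H3). assert (ex_derive y t) by (eexists; exact H4).
    auto_derive; [auto 10|].
    rewrite (is_derive_unique _ _ _ H1) (is_derive_unique _ _ _ H2) (is_derive_unique _ _ _ H3) (is_derive_unique _ _ _ H4).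
    ring. }
  set (df := fun t => ((2 * (Re (A t) * Re (- Ci * z * B t) + Im (A t) * Im (- Ci * z * B t)
      + Re (B t) * Re (- Ci * z * A t - B t / RtoC t) + Im (B t) * Im (- Ci * z * A t - B t / RtoC t))
      - K * (Re (A t) * Re (A t) + Im (A t) * Im (A t) + Re (B t) * Re (B t) + Im (B t) * Im (B t))) * exp (- (K * t)))%R).
  assert (DN : forall t, (0 < t <= T)%R -> is_derive N t (df t)).
  { intros t Ht. destruct (DA t Ht) as [D1 D2], (DB t Ht) as [D3 D4]. exact (G _ _ _ _ t _ _ _ _ D1 D2 D3 D4). }
  assert (Ndf : forall t, (0 < t)%R -> (df t <= 0)%R).
  { intros t Ht. unfold df.
    (* Re z cancels between the contributions of A and B; Im z leaves twice the cross term, and the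
       singular term leaves - |B|^2 / t. *)
    assert (E : (Re (A t) * Re (- Ci * z * B t) + Im (A t) * Im (- Ci * z * B t)
      + Re (B t) * Re (- Ci * z * A t - B t / RtoC t) + Im (B t) * Im (- Ci * z * A t - B t / RtoC t)
      = 2 * Im z * (Re (A t) * Re (B t) + Im (A t) * Im (B t))
        - (Re (B t) * Re (B t) + Im (B t) * Im (B t)) / t)%R).
    { destruct z as [x y], (A t) as [a1 a2], (B t) as [b1 b2]. simpl. field. lra. }
    rewrite E.
    assert (Hi := Rinv_0_lt_compat _ Ht).
    set (a := Re (A t)). set (b := Im (A t)). set (c := Re (B t)). set (d := Im (B t)).
    assert (P : (0 <= (c * c + d * d) / t)%R).
    { unfold Rdiv. apply Rmult_le_pos; [nra|lra]. }
    assert (Q : (2 * Im z * (a * c + b * d) <= Rabs (Im z) * (a * a + b * b + c * c + d * d))%R).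
    { assert (S1 : (2 * (a * c + b * d) <= a * a + b * b + c * c + d * d)%R)
        by (assert (h := Rle_0_sqr (a - c)); assert (h' := Rle_0_sqr (b - d)); unfold Rsqr in *; lra).
      assert (S2 : (- (2 * (a * c + b * d)) <= a * a + b * b + c * c + d * d)%R)
        by (assert (h := Rle_0_sqr (a + c)); assert (h' := Rle_0_sqr (b + d)); unfold Rsqr in *; lra).
      set (M := (a * a + b * b + c * c + d * d)%R) in *. set (U := (a * c + b * d)%R) in *.
      unfold Rabs; destruct (Rcase_abs (Im z)); nra. }
    assert (X := exp_pos (- (K * t))). unfold K in *.
    set (M := (a * a + b * b + c * c + d * d)%R) in *. set (U := (a * c + b * d)%R) in *.
    assert (Y : (2 * (2 * Im z * U - (c * c + d * d) / t) - 2 * Rabs (Im z) * M <= 0)%R) by lra.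
    set (V := (2 * (2 * Im z * U - (c * c + d * d) / t) - 2 * Rabs (Im z) * M)%R) in *. nra. }
  assert (CN : forall t, (0 <= t <= T)%R -> continuity_pt N t).
  { intros t Ht. apply continuity_pt_filterlim.
    destruct (Req_dec t 0) as [->|Nt].
    - destruct CA as [C1 C2], CB as [C3 C4].
      apply (continuous_mult (K := R_AbsRing) (fun t => Re (A t) * Re (A t) + Im (A t) * Im (A t) + Re (B t) * Re (B t) + Im (B t) * Im (B t))%R (fun t => exp (- (K * t)))).
      + apply (continuous_plus (V := R_NormedModule)); [apply (continuous_plus (V := R_NormedModule)); [apply (continuous_plus (V := R_NormedModule))|]|];
        apply (continuous_mult (K := R_AbsRing)); assumption.
      + apply @ex_derive_continuous. auto_derive. exact I.
    - apply @ex_derive_continuous; eexists; apply DN; lra. }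
  destruct (MVT_gen N 0 T df) as [c [Hc E]].
  - intros t Ht. rewrite Rmin_left in Ht; [|lra]. rewrite Rmax_right in Ht; [|lra]. apply DN; lra.
  - intros t Ht. rewrite Rmin_left in Ht; [|lra]. rewrite Rmax_right in Ht; [|lra]. apply CN; lra.
  - rewrite Rmin_left in Hc; [|lra]. rewrite Rmax_right in Hc; [|lra].
    assert (N0 : N 0%R = 0%R) by (unfold N; rewrite ZA ZB; simpl; ring).
    (* The mean value point may be 0, where the division by t takes a default value; there [df] is 0
       because A and B vanish. *)
    assert (D0 : (df c <= 0)%R).
    { destruct (Req_dec c 0) as [->|Nc]; [|apply Ndf; lra]. unfold df; rewrite ZA ZB; simpl.
      apply Req_le. unfold Rdiv. ring. }
    assert (L : (N T <= 0)%R) by nra.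
    unfold N in L. assert (X := exp_pos (- (K * T))).
    set (S := (Re (A T) * Re (A T) + Im (A T) * Im (A T) + Re (B T) * Re (B T) + Im (B T) * Im (B T))%R) in *.
    assert (HS : (S <= 0)%R) by nra. unfold S in HS.
    split; apply C_ext; simpl; nra.
Qed.

(** x f' + f is the derivative of x f, so it multiplies the k-th coefficient by k + 1. *)
Lemma xderiv_CPS (a b : nat -> C) (x : R) : Cfast a -> Cfast b ->
  (forall k, RtoC (INR (S k)) * a k = b k) -> RtoC x * CPS (Cderiv a) x + CPS a x = CPS b x.
Proof.
  intros Fa Fb E.
  set (c := fun k => RtoC (INR k) * a k).
  assert (Ec : forall k, b k + RtoC (-1) * a k = c k).
  { intro k; rewrite -E S_INR RtoC_plus. unfold c. ring. }
  assert (Fc : Cfast c) by (apply (Cfast_ext _ _ Ec), Cfast_plus, Cfast_scal; assumption).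
  assert (H := CPS_decr c x Fc). change (CPS c x = c 0%nat + RtoC x * CPS (Cderiv a) x) in H.
  rewrite -(CPS_ext _ _ x Ec) CPS_plus in H; [|exact Fb|apply Cfast_scal, Fa].
  rewrite CPS_scal // in H. replace (c 0%nat) with (RtoC 0) in H by (unfold c; simpl; ring).
  rewrite Cplus_0_l in H. rewrite -H. ring.
Qed.

Lemma bser0_der (q : C) (x : R) : Cder (CPS (bser 0 q)) x (q * CPS (bser 1 q) x).
Proof.
  eapply Cder_eq; [apply Cder_CPS, bser_fast|].
  rewrite -CPS_scal; [|apply bser_fast]. apply CPS_ext; intro k. unfold Cderiv, bser.
  rewrite !Nat.add_0_r Nat.add_1_r.
  rewrite !RtoC_div; try apply INR_fact_neq_0. rewrite !RtoC_inv; try apply INR_fact_neq_0.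
  rewrite INR_S_fact Cpow_S. field. split; [apply RtoC_fact_nz|apply RtoC_INR_S_nz].
Qed.

Lemma hser0_der (q : C) (x : R) : Cder (CPS (hser 0 q)) x (q * CPS (hser 1 q) x).
Proof.
  eapply Cder_eq; [apply Cder_CPS, hser_fast|].
  rewrite -CPS_scal; [|apply hser_fast]. apply CPS_ext; intro k. unfold Cderiv, hser.
  rewrite !Nat.add_0_r Nat.add_1_r.
  rewrite !RtoC_div; try apply INR_fact_neq_0.
  rewrite INR_S_fact Cpow_S. field. split; [apply RtoC_fact_nz|apply RtoC_INR_S_nz].
Qed.

Lemma bser1_xder (q : C) (x : R) :
  RtoC x * CPS (Cderiv (bser 1 q)) x + CPS (bser 1 q) x = CPS (bser 0 q) x.
Proof.
  apply xderiv_CPS; try apply bser_fast. intro k. unfold bser. rewrite Nat.add_0_r Nat.add_1_r.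
  rewrite !RtoC_div; try apply INR_fact_neq_0. rewrite !RtoC_inv; try apply INR_fact_neq_0.
  rewrite INR_S_fact. field. split; [apply RtoC_fact_nz|apply RtoC_INR_S_nz].
Qed.

(** The additional [bser 1] comes from the last summand 1/(k+1) of [harm (k + 1)]. *)
Lemma hser1_xder (q : C) (x : R) :
  RtoC x * CPS (Cderiv (hser 1 q)) x + CPS (hser 1 q) x = CPS (hser 0 q) x + CPS (bser 1 q) x.
Proof.
  rewrite -CPS_plus; [|apply hser_fast|apply bser_fast].
  apply xderiv_CPS; [apply hser_fast|apply Cfast_plus; [apply hser_fast|apply bser_fast]|].
  intro k. unfold hser, bser. rewrite Nat.add_0_r Nat.add_1_r.
  simpl harm. rewrite -S_INR. assert (hn : INR (S k) <> 0%R) by (apply not_0_INR; lia).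
  assert (hf := INR_fact_neq_0 k).
  replace ((harm k + / INR (S k)) / INR (fact (S k)) / INR (fact k))%R
    with (/ INR (S k) * (harm k / INR (fact k) / INR (fact k) + / INR (fact (S k)) / INR (fact k)))%R.
  2: { rewrite fact_simpl mult_INR. field. split; assumption. }
  rewrite RtoC_mult RtoC_plus RtoC_inv //. field. apply RtoC_INR_S_nz.
Qed.

Lemma CPS_sq_der (a : nat -> C) (t : R) (l : C) : Cder (CPS a) (t * t) l ->
  Cder (fun s => CPS a (s * s)) t (RtoC (2 * t) * l).
Proof.
  intro H. apply (Cder_comp (CPS a) (fun s => s * s)%R t l (2 * t) H). auto_derive; [exact I|ring].
Qed.

(** * Bessel's integrals for J_0 and J_1 *)

Definition Jf (z : C) (p : R -> C) (t : R) : C := CInt (fun th => p th * ez z t th) 0 PI.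

Lemma Jf_prim (z : C) (p : R -> C) (t : R) : (forall th, Ccont p th) ->
  has_prim (fun th => p th * ez z t th) (Jf z p t).
Proof.
  intro Cp. apply has_prim_proper; intros; apply Ccont_mult; [apply Cp|apply ez_cont].
Qed.

Lemma Jf_der (z : C) (p : R -> C) (t : R) : (forall th, Ccont p th) ->
  Cder (Jf z p) t (Jf z (fun th => - Ci * z * RtoC (cos th) * p th) t).
Proof.
  intro Cp. apply (Cder_CInt_param (fun s th => p th * ez z s th)
    (fun s th => - Ci * z * RtoC (cos th) * p th * ez z s th)).
  - intros s th. eapply Cder_eq; [apply Cder_scal, ez_der_t|]. ring.
  - intros th _. apply Ccont_mult; [|apply ez_cont2].
    apply (Ccont_snd (fun th => - Ci * z * RtoC (cos th) * p th)).
    apply Ccont_mult; [|apply Cp]. apply Ccont_mult; [apply Ccont_const|apply Ccont_cos].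
  - intros s th _. apply Ccont_mult; [apply Cp|apply ez_cont].
Qed.

Lemma ez_by_parts (p p' : R -> C) (z : C) (t : R) :
  (forall th, Cder p th (p' th)) -> (forall th, Ccont p' th) ->
  has_prim (fun th => p' th * ez z t th + p th * (Ci * z * RtoC t * RtoC (sin th) * ez z t th))
    (p PI * ez z t PI - p 0%R * ez z t 0).
Proof.
  intros D Cp'.
  assert (Cp : forall th, Ccont p th) by (intro; eapply Cder_Ccont, D).
  assert (DF : forall th, Cder (fun th => p th * ez z t th) th
     (p' th * ez z t th + p th * (Ci * z * RtoC t * RtoC (sin th) * ez z t th))).
  { intro th; apply Cder_mult; [apply D|apply ez_der_th]. }
  apply (has_prim_FTC (fun th => p th * ez z t th)).
  - intros th _. apply Ccont_plus; [apply Ccont_mult; [apply Cp'|apply ez_cont]|].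
    apply Ccont_mult; [apply Cp|]. apply Ccont_mult; [|apply ez_cont].
    apply Ccont_mult; [apply Ccont_const|apply Ccont_sin].
  - intros; apply DF.
  - apply (Ctends_at_left (fun th => p th * ez z t th)). eapply Cder_Ccont, DF.
Qed.

Definition one_f (th : R) : C := 1.
Definition zero_f (th : R) : C := 0.
Definition cos_f (th : R) : C := RtoC (cos th).
Definition sin_f (th : R) : C := RtoC (sin th).
Definition nsin_f (th : R) : C := - RtoC (sin th).
Definition cos2_f (th : R) : C := RtoC (cos th) * RtoC (cos th).
Definition cos2_f' (th : R) : C := - RtoC (sin th) * RtoC (cos th) + RtoC (cos th) * - RtoC (sin th).

Lemma Ccont_cos2 (th : R) : Ccont cos2_f th.
Proof. apply (Ccont_mult cos_f cos_f); apply Ccont_cos. Qed.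

Lemma one_f_der (th : R) : Cder one_f th (zero_f th). Proof. apply Cder_const. Qed.
Lemma cos2_der (th : R) : Cder cos2_f th (cos2_f' th).
Proof. exact (Cder_mult cos_f cos_f _ _ _ (Cder_cos th) (Cder_cos th)). Qed.
Lemma Ccont_nsin (th : R) : Ccont nsin_f th.
Proof. apply Ccont_opp, Ccont_sin. Qed.
Lemma Ccont_cos2' (th : R) : Ccont cos2_f' th.
Proof.
  exact (Ccont_plus _ _ _ (Ccont_mult nsin_f cos_f _ (Ccont_nsin th) (Ccont_cos th))
    (Ccont_mult cos_f nsin_f _ (Ccont_cos th) (Ccont_nsin th))).
Qed.

Lemma sin2_eq (th : R) : RtoC (sin th) * RtoC (sin th) = 1 - RtoC (cos th) * RtoC (cos th).
Proof.
  rewrite -!RtoC_mult -RtoC_minus. f_equal. assert (h := sin2_cos2 th). unfold Rsqr in h. lra.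
Qed.

Lemma Jf_0_der (z : C) (t : R) : Cder (Jf z one_f) t (- Ci * z * Jf z cos_f t).
Proof.
  eapply Cder_eq; [apply Jf_der; intro; apply Ccont_const|].
  apply (has_prim_unique (fun th => - Ci * z * RtoC (cos th) * one_f th * ez z t th)).
  - apply (Jf_prim z (fun th => - Ci * z * RtoC (cos th) * one_f th)). intro th.
    apply Ccont_mult; [apply Ccont_mult; [apply Ccont_const|apply Ccont_cos]|apply Ccont_const].
  - apply (has_prim_ext (fun th => - Ci * z * (cos_f th * ez z t th))).
    + intros; unfold one_f, cos_f; ring.
    + apply has_prim_scal, Jf_prim, Ccont_cos.
Qed.

(** Integrating the derivative of sin th e^{-i z t cos th} and using sin^2 = 1 - cos^2 eliminates
    the weight cos^2, which closes the system on the weights 1 and cos. *)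
Lemma Jf_relation (z : C) (t : R) :
  Jf z cos_f t + Ci * z * RtoC t * (Jf z one_f t - Jf z cos2_f t) = 0.
Proof.
  assert (H := ez_by_parts sin_f cos_f z t Cder_sin Ccont_cos).
  unfold sin_f at 2 3 in H. rewrite sin_PI sin_0 in H.
  replace (RtoC 0 * ez z t PI - RtoC 0 * ez z t 0) with (RtoC 0) in H by ring.
  replace (Jf z one_f t - Jf z cos2_f t) with (Jf z one_f t + - (1) * Jf z cos2_f t) by ring.
  apply (has_prim_unique (fun th => cos_f th * ez z t th
     + Ci * z * RtoC t * (one_f th * ez z t th + - (1) * (cos2_f th * ez z t th)))).
  - apply has_prim_plus; [apply Jf_prim, Ccont_cos|]. apply has_prim_scal, has_prim_plus.
    + apply Jf_prim; intro; apply Ccont_const.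
    + apply has_prim_scal, Jf_prim, Ccont_cos2.
  - apply: has_prim_ext H. intros th _. unfold one_f, cos2_f, sin_f.
    transitivity (cos_f th * ez z t th + Ci * z * RtoC t * (RtoC (sin th) * RtoC (sin th)) * ez z t th); [ring|].
    rewrite sin2_eq. ring.
Qed.

Lemma Jf_1_der (z : C) (t : R) : t <> 0%R ->
  Cder (Jf z cos_f) t (- Ci * z * Jf z one_f t - Jf z cos_f t / RtoC t).
Proof.
  intro Ht. assert (Ht' := RtoC_nz t Ht).
  eapply Cder_eq; [apply Jf_der, Ccont_cos|].
  transitivity (- Ci * z * Jf z cos2_f t).
  - apply (has_prim_unique (fun th => - Ci * z * RtoC (cos th) * cos_f th * ez z t th)).
    + apply (Jf_prim z (fun th => - Ci * z * RtoC (cos th) * cos_f th)). intro th.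
      apply Ccont_mult; [apply Ccont_mult; [apply Ccont_const|apply Ccont_cos]|apply Ccont_cos].
    + apply (has_prim_ext (fun th => - Ci * z * (cos2_f th * ez z t th))).
      * intros; unfold cos2_f, cos_f; ring.
      * apply has_prim_scal, Jf_prim, Ccont_cos2.
  - assert (E := Jf_relation z t).
    replace (Jf z cos_f t) with (- (Ci * z * RtoC t * (Jf z one_f t - Jf z cos2_f t))).
    + field. exact Ht'.
    + set (u := Ci * z * RtoC t * (Jf z one_f t - Jf z cos2_f t)) in *.
      replace (Jf z cos_f t) with (Jf z cos_f t + u - u) by ring. rewrite E. ring.
Qed.

Lemma ez_0 (z : C) (th : R) : ez z 0 th = 1.
Proof. unfold ez. replace (- Ci * z * RtoC 0 * RtoC (cos th)) with (RtoC 0) by ring. apply Cexp_0. Qed.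

Lemma has_prim_const (c : C) : has_prim (fun _ => c) (c * RtoC PI).
Proof.
  replace (c * RtoC PI) with (c * RtoC PI - c * RtoC 0) by ring.
  apply (has_prim_FTC (fun th => c * RtoC th)).
  - intros; apply Ccont_const.
  - intros th _. eapply Cder_eq; [apply Cder_scal, Cder_id|ring].
  - apply (Ctends_at_left (fun th => c * RtoC th)). eapply Cder_Ccont, Cder_scal, Cder_id.
Qed.

Lemma has_prim_cos (m : nat) : (1 <= m)%nat -> has_prim (fun th => RtoC (cos (INR m * th))) 0.
Proof.
  intro Hm. assert (hm : (INR m <> 0)%R) by (apply not_0_INR; lia).
  assert (D : forall th, Cder (fun th => RtoC (sin (INR m * th) / INR m)) th (RtoC (cos (INR m * th)))).
  { intro th. apply (Cder_RtoC (fun th => sin (INR m * th) / INR m)%R). auto_derive; [exact I|]. field; exact hm. }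
  assert (Z : sin (INR m * PI) = 0%R).
  { apply sin_eq_0_1. exists (Z.of_nat m). rewrite INR_IZR_INZ. reflexivity. }
  replace (RtoC 0) with (RtoC (sin (INR m * PI) / INR m) - RtoC (sin (INR m * 0) / INR m)).
  2: { rewrite Z Rmult_0_r sin_0. ring. }
  apply (has_prim_FTC (fun th => RtoC (sin (INR m * th) / INR m))).
  - intros. apply Ccont_RtoC, @ex_derive_continuous. auto_derive. exact I.
  - intros; apply D.
  - apply (Ctends_at_left (fun th => RtoC (sin (INR m * th) / INR m))). eapply Cder_Ccont, D.
Qed.

Lemma has_prim_cos1 : has_prim cos_f 0.
Proof.
  apply (has_prim_ext (fun th => RtoC (cos (INR 1 * th)))); [|apply has_prim_cos; lia].
  intros th _. unfold cos_f; simpl INR. now rewrite Rmult_1_l.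
Qed.

Definition bq (z : C) : C := - (z ^ 2 / 4).

(* T = 1 gives Bessel's integrals for J_0(z) and J_1(z). *)
Lemma Jf_series (z : C) (T : R) : (0 < T)%R ->
  Jf z one_f T = RtoC PI * CPS (bser 0 (bq z)) (T * T)
  /\ Jf z cos_f T = RtoC PI * (- Ci * z / 2 * RtoC T * CPS (bser 1 (bq z)) (T * T)).
Proof.
  intro HT.
  (* Differences between integrals and series: both pairs solve the same system with the same values
     at t = 0, so the differences satisfy the hypotheses of [bessel_system_unique]. *)
  set (A := fun t => Jf z one_f t - RtoC PI * CPS (bser 0 (bq z)) (t * t)).
  set (B := fun t => Jf z cos_f t - RtoC PI * (- Ci * z / 2 * RtoC t * CPS (bser 1 (bq z)) (t * t))).
  assert (D0 : forall t, Cder (fun s => RtoC PI * CPS (bser 0 (bq z)) (s * s)) t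
     (RtoC PI * (RtoC (2 * t) * (bq z * CPS (bser 1 (bq z)) (t * t))))).
  { intro t. apply Cder_scal, CPS_sq_der, bser0_der. }
  assert (D1 : forall t, Cder (fun s => RtoC PI * (- Ci * z / 2 * RtoC s * CPS (bser 1 (bq z)) (s * s))) t
     (RtoC PI * (- Ci * z / 2 * 1 * CPS (bser 1 (bq z)) (t * t)
       + - Ci * z / 2 * RtoC t * (RtoC (2 * t) * CPS (Cderiv (bser 1 (bq z))) (t * t))))).
  { intro t. apply Cder_scal. eapply Cder_eq.
    - apply Cder_mult; [apply Cder_scal, Cder_id|].
      apply CPS_sq_der, Cder_CPS, bser_fast.
    - cbv beta; ring. }
  destruct (bessel_system_unique z A B T HT) as [E0 E1].
  - intros t Ht. eapply Cder_eq; [apply Cder_minus; [apply Jf_0_der|apply D0]|].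
    unfold B, bq. rewrite RtoC_mult. 
    replace (- (z ^ 2 / 4)) with (Ci * Ci * (z ^ 2 / 4)).
    2: { replace (Ci * Ci) with (- (1)) by (apply C_ext; simpl; ring). ring. }
    field.
  - intros t Ht. assert (Ht' : RtoC t <> 0) by (apply RtoC_nz; lra).
    eapply Cder_eq; [apply Cder_minus; [apply Jf_1_der; lra|apply D1]|].
    unfold A, B. assert (X := bser1_xder (bq z) (t * t)). rewrite -X !RtoC_mult. field. exact Ht'.
  - apply Ccont_minus; [eapply Cder_Ccont, Jf_0_der|eapply Cder_Ccont, D0].
  - apply Ccont_minus; [eapply Cder_Ccont, Jf_der, Ccont_cos|eapply Cder_Ccont, D1].
  - unfold A. rewrite Rmult_0_l CPS_0.
    rewrite (has_prim_unique (fun th => one_f th * ez z 0 th) (Jf z one_f 0) (1 * RtoC PI)).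
    + unfold bser. simpl. rewrite Rinv_1. unfold Rdiv; rewrite Rinv_1 Rmult_1_l. ring.
    + apply Jf_prim; intro; apply Ccont_const.
    + apply (has_prim_ext (fun _ => 1)); [|apply has_prim_const]. intros; rewrite ez_0; unfold one_f; ring.
  - unfold B. rewrite Rmult_0_l.
    rewrite (has_prim_unique (fun th => cos_f th * ez z 0 th) (Jf z cos_f 0) 0).
    + ring.
    + apply Jf_prim, Ccont_cos.
    + apply: has_prim_ext has_prim_cos1. intros; rewrite ez_0; ring.
  - unfold A, B in E0, E1. split.
    + match type of E0 with ?a - ?b = _ => replace (Jf z one_f T) with (a - b + b) by ring; rewrite E0 end. ring.
    + match type of E1 with ?a - ?b = _ => replace (Jf z cos_f T) with (a - b + b) by ring; rewrite E1 end. ring.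
Qed.

(** * The logarithmic integrals for m = 0 and m = 1 *)

Definition W0 (z : C) : R -> C := Wf z one_f zero_f.
Definition W1 (z : C) : R -> C := Wf z cos_f nsin_f.
Definition W2 (z : C) : R -> C := Wf z cos2_f cos2_f'.

Lemma Ccont_zero (th : R) : Ccont zero_f th. Proof. apply Ccont_const. Qed.

Lemma W0_prim (z : C) (t : R) : has_prim (fun th => one_f th * Qf z t th) (W0 z t).
Proof. exact (Wf_prim z one_f zero_f t one_f_der Ccont_zero). Qed.

Lemma W1_prim (z : C) (t : R) : has_prim (fun th => cos_f th * Qf z t th) (W1 z t).
Proof. exact (Wf_prim z cos_f nsin_f t Cder_cos Ccont_nsin). Qed.

Lemma W2_prim (z : C) (t : R) : has_prim (fun th => cos2_f th * Qf z t th) (W2 z t).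
Proof. exact (Wf_prim z cos2_f cos2_f' t cos2_der Ccont_cos2'). Qed.

(** The analogue of [Jf_relation]; the source term arises from sin th tan(th/2) = 1 - cos th, whose
    integral is PI. *)
Lemma W_relation (z : C) (t : R) :
  W1 z t + Ci * z * RtoC t * (W0 z t - W2 z t) = RtoC PI * Cexp (Ci * z * RtoC t).
Proof.
  assert (H := Qf_by_parts sin_f cos_f z t Cder_sin Ccont_cos ltac:(unfold sin_f; rewrite sin_PI; reflexivity)).
  unfold sin_f at 2 in H. rewrite sin_0 in H.
  replace (- (RtoC 0 * Qf z t 0)) with (RtoC 0) in H by ring.
  assert (K : has_prim (fun th => cos_f th * Qf z t th
     + (Ci * z * RtoC t * (one_f th * Qf z t th + - (1) * (cos2_f th * Qf z t th))
     + (- Cexp (Ci * z * RtoC t) * 1 + Cexp (Ci * z * RtoC t) * cos_f th)))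
     (W1 z t + (Ci * z * RtoC t * (W0 z t + - (1) * W2 z t)
     + (- Cexp (Ci * z * RtoC t) * (1 * RtoC PI) + Cexp (Ci * z * RtoC t) * 0)))).
  { apply has_prim_plus; [apply W1_prim|]. apply has_prim_plus; [|apply has_prim_plus].
    - apply has_prim_scal, has_prim_plus; [apply W0_prim|apply has_prim_scal, W2_prim].
    - apply has_prim_scal, has_prim_const.
    - apply has_prim_scal, has_prim_cos1. }
  assert (E : W1 z t + (Ci * z * RtoC t * (W0 z t + - (1) * W2 z t)
     + (- Cexp (Ci * z * RtoC t) * (1 * RtoC PI) + Cexp (Ci * z * RtoC t) * 0)) = 0).
  { apply (has_prim_unique _ _ _ K). apply: has_prim_ext H. intros th Hth.
    assert (P := one_plus_cos_pos th Hth).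
    assert (T : sin_f th * RtoC (tan_half th) = 1 - cos_f th).
    { unfold sin_f, cos_f, tan_half. rewrite -RtoC_mult -RtoC_minus. f_equal.
      assert (h := sin2_cos2 th). unfold Rsqr in h.
      apply Rmult_eq_reg_r with (1 + cos th)%R; [|lra]. field_simplify; [|lra]. nra. }
    unfold one_f, cos2_f, sin_f in *.
    transitivity (cos_f th * Qf z t th + (Ci * z * RtoC t * (RtoC (sin th) * RtoC (sin th)) * Qf z t th
      - Cexp (Ci * z * RtoC t) * (RtoC (sin th) * RtoC (tan_half th)))); [ring|].
    rewrite T sin2_eq. ring. }
  match type of E with ?a = _ => transitivity (a + RtoC PI * Cexp (Ci * z * RtoC t)); [ring|rewrite E; ring] end.
Qed.

(** Pointwise, t (1 + cos th) [einc1] is e^{i z t (1 + cos th)} - 1, and multiplication by e^{-i z t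
    cos th} gives e^{i z t} - e^{-i z t cos th}. *)
Lemma einc1_integral (z : C) (p : R -> C) (P : C) (t : R) :
  (forall th, Ccont p th) -> has_prim p P ->
  RtoC t * CInt (fun th => p th * ez z t th * RtoC (1 + cos th) * einc1 z (t * (1 + cos th))) 0 PI
  = Cexp (Ci * z * RtoC t) * P - Jf z p t.
Proof.
  intros Cp HP.
  set (g := fun th => p th * ez z t th * RtoC (1 + cos th) * einc1 z (t * (1 + cos th))).
  assert (Cg : forall th, Ccont g th).
  { intro th. apply Ccont_mult; [apply Ccont_mult; [apply Ccont_mult; [apply Cp|apply ez_cont]|]|apply einc1_th_cont].
    apply Ccont_RtoC, @ex_derive_continuous. auto_derive. exact I. }
  apply (has_prim_unique (fun th => RtoC t * g th)).
  - apply has_prim_scal, has_prim_proper; intros; apply Cg.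
  - apply (has_prim_ext (fun th => Cexp (Ci * z * RtoC t) * p th + - (1) * (p th * ez z t th))).
    + intros th _. unfold g.
      assert (E := einc1_eq z (t * (1 + cos th))).
      assert (X : Cexp (Ci * z * RtoC t) = ez z t th * Cexp (Ci * z * RtoC (t * (1 + cos th)))).
      { unfold ez. rewrite -Cexp_plus; f_equal. rewrite RtoC_mult RtoC_plus. ring. }
      rewrite X. replace (Cexp (Ci * z * RtoC (t * (1 + cos th))))
        with (RtoC (t * (1 + cos th)) * einc1 z (t * (1 + cos th)) + 1) by (rewrite E; ring).
      rewrite RtoC_mult. ring.
    + replace (Cexp (Ci * z * RtoC t) * P - Jf z p t)
        with (Cexp (Ci * z * RtoC t) * P + - (1) * Jf z p t) by ring.
      apply has_prim_plus; apply has_prim_scal; [exact HP|apply Jf_prim, Cp].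
Qed.

Lemma W0_der (z : C) (t : R) : t <> 0%R ->
  Cder (W0 z) t (- Ci * z * W1 z t + (RtoC PI * Cexp (Ci * z * RtoC t) - Jf z one_f t) / RtoC t).
Proof.
  intro Ht. assert (Ht' := RtoC_nz t Ht).
  eapply Cder_eq; [exact (Wf_der z one_f zero_f t one_f_der Ccont_zero)|]. apply f_equal2.
  - apply (has_prim_unique (fun th => - Ci * z * RtoC (cos th) * one_f th * Qf z t th)).
    + apply (Wf_prim z (fun th => - Ci * z * RtoC (cos th) * one_f th)).
      * intro th. eapply Cder_eq; [apply Cder_mult; [apply Cder_scal, Cder_cos|apply one_f_der]|].
        cbv beta; ring.
      * intro th. exact (Ccont_plus _ _ _
          (Ccont_mult (fun th => Ci * z * RtoC (sin th)) one_f _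
             (Ccont_mult _ _ _ (Ccont_const (Ci * z) th) (Ccont_sin th)) (Ccont_const 1 th))
          (Ccont_mult (fun th => - Ci * z * RtoC (cos th)) zero_f _
             (Ccont_mult _ _ _ (Ccont_const (- Ci * z) th) (Ccont_cos th)) (Ccont_zero th))).
    + apply (has_prim_ext (fun th => - Ci * z * (cos_f th * Qf z t th))).
      * intros; unfold one_f, cos_f; ring.
      * apply has_prim_scal, W1_prim.
  - assert (E := einc1_integral z one_f (1 * RtoC PI) t (fun th => Ccont_const 1 th) (has_prim_const 1)).
    match type of E with _ * ?g = _ => replace g with (RtoC t * g / RtoC t) by (field; exact Ht'); rewrite E end.
    f_equal. ring.
Qed.

(** Differentiation produces the weight cos^2, which [W_relation] eliminates; this introduces the
    term - W1 / t of the system. *)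
Lemma W1_der (z : C) (t : R) : t <> 0%R ->
  Cder (W1 z) t (- Ci * z * W0 z t + (RtoC PI * Cexp (Ci * z * RtoC t) - W1 z t - Jf z cos_f t) / RtoC t).
Proof.
  intro Ht. assert (Ht' := RtoC_nz t Ht).
  eapply Cder_eq; [exact (Wf_der z cos_f nsin_f t Cder_cos Ccont_nsin)|].
  transitivity (- Ci * z * W2 z t + (0 - Jf z cos_f t) / RtoC t).
  - apply f_equal2.
    + apply (has_prim_unique (fun th => - Ci * z * RtoC (cos th) * cos_f th * Qf z t th)).
      * apply (Wf_prim z (fun th => - Ci * z * RtoC (cos th) * cos_f th)).
        -- intro th. eapply Cder_eq; [apply Cder_mult; [apply Cder_scal, Cder_cos|apply Cder_cos]|].
           unfold nsin_f, cos_f; cbv beta; ring.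
        -- intro th. exact (Ccont_plus _ _ _
             (Ccont_mult (fun th => Ci * z * RtoC (sin th)) cos_f _
                (Ccont_mult _ _ _ (Ccont_const (Ci * z) th) (Ccont_sin th)) (Ccont_cos th))
             (Ccont_mult (fun th => - Ci * z * RtoC (cos th)) nsin_f _
                (Ccont_mult _ _ _ (Ccont_const (- Ci * z) th) (Ccont_cos th)) (Ccont_nsin th))).
      * apply (has_prim_ext (fun th => - Ci * z * (cos2_f th * Qf z t th))).
        -- intros; unfold cos2_f, cos_f; ring.
        -- apply has_prim_scal, W2_prim.
    + assert (E := einc1_integral z cos_f 0 t Ccont_cos has_prim_cos1).
      match type of E with _ * ?g = _ => replace g with (RtoC t * g / RtoC t) by (field; exact Ht'); rewrite E end.
      f_equal. ring.
  - rewrite -(W_relation z t). field. exact Ht'.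
Qed.

Lemma W0_cont (z : C) (t : R) : Ccont (W0 z) t.
Proof. exact (Cder_Ccont _ _ _ (Wf_der z one_f zero_f t one_f_der Ccont_zero)). Qed.

Lemma W1_cont (z : C) (t : R) : Ccont (W1 z) t.
Proof. exact (Cder_Ccont _ _ _ (Wf_der z cos_f nsin_f t Cder_cos Ccont_nsin)). Qed.

Lemma W0_at_0 (z : C) : W0 z 0 = - RtoC (PI * ln 2).
Proof.
  assert (PIp := PI_RGT_0).
  apply (has_prim_unique (fun th => RtoC (ln1pcos th))).
  - apply (has_prim_ext (fun th => one_f th * Qf z 0 th)); [|apply W0_prim].
    intros; unfold one_f, Qf. rewrite ez_0 Rmult_0_l einc_0. ring.
  - replace (- RtoC (PI * ln 2)) with (RtoC (ln1pcos_prim PI) - RtoC (ln1pcos_prim 0)) by (rewrite ln1pcos_prim_PI ln1pcos_prim_0 RtoC_opp; ring).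
    apply (has_prim_FTC (fun th => RtoC (ln1pcos_prim th))).
    + intros th Hth. apply Ccont_RtoC, @ex_derive_continuous. eexists; apply ln1pcos_der; lra.
    + intros th Hth. apply Cder_RtoC, ln1pcos_prim_der; lra.
    + apply (Ctends_at_left (fun th => RtoC (ln1pcos_prim th))), Ccont_RtoC, ln1pcos_prim_cont; lra.
Qed.

(** Read off from [W_relation] at t = 0, which spares evaluating the integral of cos th ln(1 + cos
    th). *)
Lemma W1_at_0 (z : C) : W1 z 0 = RtoC PI.
Proof.
  assert (E := W_relation z 0). 
  replace (Ci * z * RtoC 0) with (RtoC 0) in E by ring. rewrite Cexp_0 in E.
  transitivity (W1 z 0 + RtoC 0 * (W0 z 0 - W2 z 0)); [ring|rewrite E; ring].
Qed.

(** The right-hand sides are dictated by the expansions of Y_0 and Y_1: ln 2 is what turns Cln z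
    into Cln (z/2), and the [hser] series are the harmonic parts of the order derivatives. *)
Lemma W_series (z : C) : z <> 0 ->
  W0 z 1 = - RtoC PI * (RtoC (ln 2) * CPS (bser 0 (bq z)) 1 + CPS (hser 0 (bq z)) 1)
  /\ W1 z 1 = RtoC PI * Ci * (z / 2 * (RtoC (ln 2) * CPS (bser 1 (bq z)) 1 + CPS (hser 1 (bq z)) 1)
       + (CPS (bser 0 (bq z)) 1 - Cexp (Ci * z)) / z).
Proof.
  intro Hz.
  set (q := bq z). set (l := RtoC (ln 2)).
  set (a0 := fun t => CPS (bser 0 q) (t * t)). set (a1 := fun t => CPS (bser 1 q) (t * t)).
  set (h0 := fun t => CPS (hser 0 q) (t * t)). set (h1 := fun t => CPS (hser 1 q) (t * t)).
  (* t k t = J_0(z t) - e^{i z t}, with k smooth at 0 *)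
  set (k := fun t => RtoC t * CPS (fun n => bser 0 q (S n)) (t * t) - einc1 z t).
  assert (Dsh : forall t, exists d, Cder k t d).
  { intro t. eexists. apply Cder_minus.
    - apply Cder_mult; [apply Cder_id|]. apply CPS_sq_der, Cder_CPS, Cfast_shift, bser_fast.
    - apply Cder_CPS. apply (Cfast_shift (fun k => (Ci * z) ^ k * RtoC (1 / INR (fact k))%R)).
      apply (Cexp_CPS (Ci * z) 0). }
  assert (a0_0 : bser 0 q 0 = 1).
  { unfold bser; simpl. rewrite Rinv_1. unfold Rdiv; rewrite Rinv_1 Rmult_1_l. ring. }
  assert (Ek : forall t, RtoC t * k t = a0 t - Cexp (Ci * z * RtoC t)).
  { intro t. unfold k, a0. rewrite (CPS_decr (bser 0 q) (t * t) (bser_fast 0 q)) a0_0.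
    assert (E := einc1_eq z t). replace (Cexp (Ci * z * RtoC t)) with (RtoC t * einc1 z t + 1) by (rewrite E; ring).
    rewrite RtoC_mult. ring. }
  assert (Da0 : forall t, Cder a0 t (RtoC (2 * t) * (q * a1 t))).
  { intro t. apply CPS_sq_der, bser0_der. }
  assert (Dh0 : forall t, Cder h0 t (RtoC (2 * t) * (q * h1 t))).
  { intro t. apply CPS_sq_der, hser0_der. }
  assert (Da1 : forall t, Cder a1 t (RtoC (2 * t) * CPS (Cderiv (bser 1 q)) (t * t))).
  { intro t. apply CPS_sq_der, Cder_CPS, bser_fast. }
  assert (Dh1 : forall t, Cder h1 t (RtoC (2 * t) * CPS (Cderiv (hser 1 q)) (t * t))).
  { intro t. apply CPS_sq_der, Cder_CPS, hser_fast. }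
  set (A := fun t => W0 z t + RtoC PI * (l * a0 t + h0 t)).
  (* At t = 0 only the summand in [k] remains, and k(0) = - i z makes it cancel W1(0) = PI. *)
  set (B := fun t => W1 z t - RtoC PI * Ci * (z / 2 * RtoC t * (l * a1 t + h1 t) + / z * k t)).
  assert (J01 := Jf_series z). fold q in J01.
  destruct (bessel_system_unique z A B 1 Rlt_0_1) as [E0 E1].
  - intros t Ht. assert (Ht' : RtoC t <> 0) by (apply RtoC_nz; lra).
    eapply Cder_eq; [apply Cder_plus; [apply W0_der; lra|apply Cder_scal, Cder_plus; [apply Cder_scal, Da0|apply Dh0]]|].
    destruct (J01 t ltac:(lra)) as [-> _]. fold (a0 t).
    assert (X := Ek t). replace (Cexp (Ci * z * RtoC t)) with (a0 t - RtoC t * k t) by (rewrite X; ring).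
    assert (Hi : Ci * Ci = - (1)) by (apply C_ext; simpl; ring).
    unfold B, q, bq. rewrite (RtoC_mult 2 t). field [Hi]. split; assumption.
  - intros t Ht. assert (Ht' : RtoC t <> 0) by (apply RtoC_nz; lra).
    destruct (Dsh t) as [k' Dk].
    (* Differentiating t k(t) = J_0(z t) - e^{i z t} gives k' in closed form, without going through
       the series that define [k]. *)
    assert (R : k t + RtoC t * k' = RtoC (2 * t) * (q * a1 t) - Ci * z * Cexp (Ci * z * RtoC t)).
    { apply (Cder_unique (fun s => RtoC s * k s) t).
      - eapply Cder_eq; [apply Cder_mult; [apply Cder_id|exact Dk]|]. cbv beta; ring.
      - apply (Cder_ext (fun s => a0 s - Cexp (Ci * z * RtoC s))); [intro; symmetry; apply Ek|].
        eapply Cder_eq; [apply Cder_minus; [apply Da0|apply Cder_Cexp, Cder_scal, Cder_id]|]. cbv beta; ring. }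
    eapply Cder_eq.
    { apply Cder_minus; [apply W1_der; lra|]. apply Cder_scal, Cder_plus; [|apply Cder_scal, Dk].
      apply Cder_mult; [apply Cder_scal, Cder_id|]. apply Cder_plus; [apply Cder_scal, Da1|apply Dh1]. }
    cbv beta. destruct (J01 t ltac:(lra)) as [_ ->]. fold (a1 t).
    replace k' with ((RtoC (2 * t) * (q * a1 t) - Ci * z * Cexp (Ci * z * RtoC t) - k t) / RtoC t).
    2: { rewrite -R. field. exact Ht'. }
    assert (X1 := bser1_xder q (t * t)). assert (X2 := hser1_xder q (t * t)).
    fold (a1 t) in X1, X2. fold (h1 t) in X2. fold (a0 t) in X1. fold (h0 t) in X2.
    set (e := Cexp (Ci * z * RtoC t)).
    set (u := CPS (Cderiv (bser 1 q)) (t * t)) in *. set (v := CPS (Cderiv (hser 1 q)) (t * t)) in *.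
    replace u with ((a0 t - a1 t) / (RtoC t * RtoC t)).
    2: { rewrite -X1 RtoC_mult. field. exact Ht'. }
    replace v with ((h0 t + a1 t - h1 t) / (RtoC t * RtoC t)).
    2: { rewrite -X2 RtoC_mult. field. exact Ht'. }
    assert (Hi : Ci * Ci = - (1)) by (apply C_ext; simpl; ring).
    unfold A, B, q, bq. rewrite (RtoC_mult 2 t). field [Hi]. split; assumption.
  - apply Ccont_plus; [apply W0_cont|].
    eapply Cder_Ccont, Cder_scal, Cder_plus; [apply Cder_scal, Da0|apply Dh0].
  - apply Ccont_minus; [apply W1_cont|]. destruct (Dsh 0%R) as [k' Dk].
    eapply Cder_Ccont, Cder_scal, Cder_plus; [|apply Cder_scal, Dk].
    apply Cder_mult; [apply Cder_scal, Cder_id|]. apply Cder_plus; [apply Cder_scal, Da1|apply Dh1].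
  - unfold A, a0, h0. rewrite Rmult_0_l !CPS_0 a0_0 W0_at_0.
    unfold hser; simpl. unfold Rdiv; rewrite !Rmult_0_l RtoC_mult. unfold l. ring.
  - unfold B, k. rewrite W1_at_0.
    replace (einc1 z 0) with (Ci * z).
    2: { unfold einc1. rewrite CPS_0. simpl. unfold Rdiv; rewrite Rinv_1 Rmult_1_l. ring. }
    assert (Hi : Ci * Ci = - (1)) by (apply C_ext; simpl; ring).
    field [Hi]. exact Hz.
  - assert (K1 : k 1%R = CPS (bser 0 q) 1 - Cexp (Ci * z)).
    { assert (X := Ek 1%R). unfold a0 in X. rewrite Rmult_1_l in X.
      replace (Ci * z * RtoC 1) with (Ci * z) in X by ring. rewrite -X. ring. }
    unfold A, a0, h0 in E0. unfold B, a1, h1 in E1. rewrite !Rmult_1_l in E0, E1. rewrite K1 in E1.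
    split.
    + match type of E0 with _ + ?b = _ => transitivity (0 - b); [rewrite -E0; ring|ring] end.
    + match type of E1 with _ - ?b = _ => transitivity (0 + b); [rewrite -E1; ring|field; exact Hz] end.
Qed.

(** * The Wallis integrals and Gamma(1/2) *)

Open Scope R_scope.

Definition wallis (n : nat) : R := RInt (fun x => sin x ^ n) 0 PI.

Lemma sin_pow_cont (n : nat) (x : R) : continuous (fun x => sin x ^ n) x.
Proof. apply @ex_derive_continuous. auto_derive. exact I. Qed.

Lemma sin_pow_ex (n : nat) : ex_RInt (fun x => sin x ^ n) 0 PI.
Proof. apply (ex_RInt_continuous (V := R_CompleteNormedModule)); intros; apply sin_pow_cont. Qed.

Lemma wallis_rec (n : nat) : (INR n + 2) * wallis (S (S n)) = (INR n + 1) * wallis n.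
Proof.
  assert (H : is_RInt (fun x => (INR n + 2) * sin x ^ S (S n) - (INR n + 1) * sin x ^ n) 0 PI 0).
  { evar_last.
    - apply (is_RInt_derive (V := R_CompleteNormedModule) (fun x => - cos x * sin x ^ S n)
        (fun x => (INR n + 2) * sin x ^ S (S n) - (INR n + 1) * sin x ^ n)).
      + intros x _. auto_derive; [exact I|].
        assert (E := sin2_cos2 x). unfold Rsqr in E.
        change (match n with 0%nat => 1 | S _ => INR n + 1 end) with (INR (S n)). rewrite S_INR.
        simpl pow.
        transitivity (sin x * sin x * sin x ^ n - (INR n + 1) * (cos x * cos x) * sin x ^ n); [ring|].
        replace (cos x * cos x) with (1 - sin x * sin x) by lra. ring.
      + intros x _. apply (continuous_minus (V := R_NormedModule) (fun x => (INR n + 2) * sin x ^ S (S n)) (fun x => (INR n + 1) * sin x ^ n));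
        apply (continuous_scal_r (V := R_NormedModule)), sin_pow_cont.
    - unfold minus, plus, opp; simpl. rewrite sin_0 sin_PI. ring. }
  assert (K : is_RInt (fun x => (INR n + 2) * sin x ^ S (S n) - (INR n + 1) * sin x ^ n) 0 PI
     ((INR n + 2) * wallis (S (S n)) - (INR n + 1) * wallis n)).
  { apply (is_RInt_minus (V := R_NormedModule));
    apply (is_RInt_scal (V := R_NormedModule)); apply (RInt_correct (V := R_CompleteNormedModule)), sin_pow_ex. }
  assert (E := is_RInt_unique (V := R_CompleteNormedModule) _ _ _ _ H).
  rewrite (is_RInt_unique (V := R_CompleteNormedModule) _ _ _ _ K) in E. lra.
Qed.

Lemma wallis_0 : wallis 0 = PI.
Proof. unfold wallis; simpl. rewrite RInt_const. unfold scal; simpl; unfold mult; simpl; ring. Qed.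

Lemma wallis_1 : wallis 1 = 2.
Proof.
  apply (is_RInt_unique (V := R_CompleteNormedModule)). evar_last.
  - apply (is_RInt_derive (V := R_CompleteNormedModule) (fun x => - cos x) (fun x => sin x ^ 1)).
    + intros x _. auto_derive; [exact I|]. ring.
    + intros; apply sin_pow_cont.
  - unfold minus, plus, opp; simpl. rewrite cos_PI cos_0. ring.
Qed.

Lemma wallis_decr (n : nat) : wallis (S n) <= wallis n.
Proof.
  apply RInt_le; [apply Rlt_le, PI_RGT_0|apply sin_pow_ex|apply sin_pow_ex|].
  intros x Hx. assert (S := sin_ge_0 x ltac:(lra) ltac:(lra)). assert (B := SIN_bound x).
  simpl pow. assert (P := pow_le (sin x) n S). nra.
Qed.

Lemma wallis_pos (n : nat) : 0 < wallis n /\ 0 < wallis (S n).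
Proof.
  induction n as [|n [IH1 IH2]].
  - rewrite wallis_0 wallis_1. assert (h := PI_RGT_0). lra.
  - split; [exact IH2|]. assert (R := wallis_rec n). assert (h := pos_INR n). nra.
Qed.

(** By [wallis_rec] the quantity does not change with n; its value at n = 0 is 2 PI. *)
Lemma wallis_prod (n : nat) : (INR n + 1) * (wallis n * wallis (S n)) = 2 * PI.
Proof.
  induction n as [|n IH].
  - rewrite wallis_0 wallis_1. simpl; ring.
  - rewrite S_INR. assert (R := wallis_rec n).
    transitivity (wallis (S n) * ((INR n + 2) * wallis (S (S n)))); [ring|]. rewrite R -IH. ring.
Qed.

(** [wallis (2 * n) / PI] is the product of (k - 1/2)/k over 1 <= k <= n. *)
Lemma gamma_prod_half (n : nat) :
  prod_f_R0 (fun k => 1 / 2 + INR k) n / INR (fact n) = wallis (2 * n) / PI * (INR n + 1 / 2).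
Proof.
  assert (PIp := PI_RGT_0).
  induction n as [|n IH]; [simpl prod_f_R0; change (2 * 0)%nat with 0%nat; rewrite wallis_0; simpl; field; lra|].
  rewrite prod_f_R0_S fact_simpl mult_INR S_INR. assert (h := pos_INR n). assert (F := INR_fact_neq_0 n).
  replace (prod_f_R0 (fun k => 1 / 2 + INR k) n * (1 / 2 + (INR n + 1)) / ((INR n + 1) * INR (fact n)))
    with (prod_f_R0 (fun k => 1 / 2 + INR k) n / INR (fact n) * ((1 / 2 + (INR n + 1)) / (INR n + 1)))
    by (field; lra).
  rewrite IH. replace (2 * S n)%nat with (S (S (2 * n))) by lia.
  assert (R := wallis_rec (2 * n)). rewrite mult_INR in R. simpl (INR 2) in R.
  replace (wallis (S (S (2 * n)))) with ((2 * INR n + 1) * wallis (2 * n) / (2 * INR n + 2)).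
  - field. lra.
  - replace ((2 * INR n + 1) * wallis (2 * n)) with ((2 * INR n + 2) * wallis (S (S (2 * n)))) by lra. field. lra.
Qed.

(** With N = n + 1, monotonicity of the Wallis integrals and the constancy of their products squeeze
    PI u_n^2 between (N + 1/2)/N and its square; the sign of the limit is that of u_n. *)
Lemma rGamma_half : rGamma (1 / 2) = / sqrt PI.
Proof.
  assert (PIp := PI_RGT_0).
  assert (L := rGamma_lim (1 / 2)). apply is_lim_seq_incr_1 in L.
  set (u := fun n => gamma_prod (1 / 2) (S n)) in *.
  assert (E : forall n, u n = wallis (2 * S n) / PI * (INR n + 1 + 1 / 2) / sqrt (INR n + 1)).
  { intro n. unfold u, gamma_prod. assert (h := pos_INR n).
    assert (RP : Rpower (INR (S n)) (1 / 2) = sqrt (INR n + 1)).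
    { rewrite S_INR. replace (1 / 2) with (/ 2) by field. apply Rpower_sqrt; lra. }
    rewrite RP.
    assert (G := gamma_prod_half (S n)). rewrite S_INR in G. rewrite -G.
    assert (0 < sqrt (INR n + 1)) by (apply sqrt_lt_R0; lra).
    field. split; [apply INR_fact_neq_0|lra]. }
  assert (Pu : forall n, 0 <= u n).
  { intro n. rewrite E. assert (h := pos_INR n). assert (0 < sqrt (INR n + 1)) by (apply sqrt_lt_R0; lra).
    assert (W := proj1 (wallis_pos (2 * S n))).
    apply Rlt_le, Rdiv_lt_0_compat; [|assumption]. apply Rmult_lt_0_compat; [|lra]. apply Rdiv_lt_0_compat; lra. }
  assert (B : forall n, (INR n + 1 + 1 / 2) / (INR n + 1) <= PI * (u n * u n)
      <= (INR n + 1 + 1 / 2) / (INR n + 1) * ((INR n + 1 + 1 / 2) / (INR n + 1))).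
  { intro n. assert (h := pos_INR n).
    assert (Ws := wallis_prod (2 * S n)). assert (Ws' := wallis_prod (S (2 * n))).
    replace (S (S (2 * n))) with (2 * S n)%nat in Ws' by lia.
    replace (INR (2 * S n)) with (2 * (INR n + 1)) in Ws by (rewrite mult_INR (S_INR n); simpl; ring).
    replace (INR (S (2 * n))) with (2 * INR n + 1) in Ws' by (rewrite S_INR mult_INR; simpl; ring).
    assert (M1 := wallis_decr (2 * S n)). assert (M2 := wallis_decr (S (2 * n))).
    replace (S (S (2 * n))) with (2 * S n)%nat in M2 by lia.
    assert (W := proj1 (wallis_pos (2 * S n))).
    set (w := wallis (2 * S n)) in *.
    assert (Sq : sqrt (INR n + 1) * sqrt (INR n + 1) = INR n + 1) by (apply sqrt_sqrt; lra).
    assert (Sp : 0 < sqrt (INR n + 1)) by (apply sqrt_lt_R0; lra).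
    assert (EE : PI * (u n * u n) = w * w * ((INR n + 1 + 1 / 2) * (INR n + 1 + 1 / 2) / (PI * (INR n + 1)))).
    { rewrite E. fold w.
      replace (PI * (INR n + 1)) with (PI * (sqrt (INR n + 1) * sqrt (INR n + 1))) by (rewrite Sq; reflexivity).
      field. lra. }
    assert (L1 : 2 * PI <= (2 * (INR n + 1) + 1) * (w * w)) by (rewrite -Ws; apply Rmult_le_compat_l; [lra|nra]).
    assert (L2 : (2 * INR n + 2) * (w * w) <= 2 * PI).
    { rewrite -Ws'. replace (2 * INR n + 1 + 1) with (2 * INR n + 2) by ring. apply Rmult_le_compat_l; [lra|nra]. }
    rewrite EE. set (N := INR n + 1) in *. assert (HN : 1 <= N) by (unfold N; lra).
    split.
    - apply Rmult_le_reg_r with (PI * N / (N + 1 / 2)); [apply Rdiv_lt_0_compat; nra|].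
      replace ((N + 1 / 2) / N * (PI * N / (N + 1 / 2))) with PI by (field; lra).
      replace (w * w * ((N + 1 / 2) * (N + 1 / 2) / (PI * N)) * (PI * N / (N + 1 / 2))) with (w * w * (N + 1 / 2)) by (field; lra).
      nra.
    - apply Rmult_le_reg_r with (PI * N * N / ((N + 1 / 2) * (N + 1 / 2))); [apply Rdiv_lt_0_compat; [apply Rmult_lt_0_compat; [apply Rmult_lt_0_compat|]; lra|apply Rmult_lt_0_compat; lra]|].
      replace ((N + 1 / 2) / N * ((N + 1 / 2) / N) * (PI * N * N / ((N + 1 / 2) * (N + 1 / 2)))) with PI by (field; lra).
      replace (w * w * ((N + 1 / 2) * (N + 1 / 2) / (PI * N)) * (PI * N * N / ((N + 1 / 2) * (N + 1 / 2)))) with (w * w * N) by (field; lra).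
      unfold N in *. nra. }
  assert (R := is_lim_seq_ratio (1 / 2)).
  assert (Lq : is_lim_seq (fun n => PI * (u n * u n)) (PI * (rGamma (1 / 2) * rGamma (1 / 2)))).
  { apply is_lim_seq_mult'; [apply is_lim_seq_const|apply is_lim_seq_mult'; exact L]. }
  assert (L1 : is_lim_seq (fun n => PI * (u n * u n)) 1).
  { apply (is_lim_seq_le_le _ _ _ _ B); [exact R|].
    replace (Finite 1) with (Finite (1 * 1)) by (f_equal; ring). apply is_lim_seq_mult'; exact R. }
  assert (Q : PI * (rGamma (1 / 2) * rGamma (1 / 2)) = 1).
  { apply is_lim_seq_unique in Lq. apply is_lim_seq_unique in L1. rewrite L1 in Lq. injection Lq. lra. }
  assert (Pg : 0 <= rGamma (1 / 2)).
  { apply (is_lim_seq_le (fun _ => 0) u 0 (rGamma (1 / 2)) Pu (is_lim_seq_const 0) L). }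
  assert (Sp : 0 < sqrt PI) by (apply sqrt_lt_R0; lra).
  assert (Sq : sqrt PI * sqrt PI = PI) by (apply sqrt_sqrt; lra).
  apply Rmult_eq_reg_l with (sqrt PI); [|lra]. rewrite Rinv_r; [|lra].
  assert (X : (sqrt PI * rGamma (1 / 2)) * (sqrt PI * rGamma (1 / 2)) = 1) by (transitivity (sqrt PI * sqrt PI * (rGamma (1 / 2) * rGamma (1 / 2))); [ring|rewrite Sq; exact Q]).
  assert (Y : 0 <= sqrt PI * rGamma (1 / 2)) by (apply Rmult_le_pos; lra).
  set (v := sqrt PI * rGamma (1 / 2)) in *.
  assert (V : (v - 1) * (v + 1) = 0) by lra.
  apply Rmult_integral in V. lra.
Qed.

Lemma Gamma_half : Gamma (1 / 2) = sqrt PI.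
Proof. unfold Gamma. rewrite rGamma_half Rinv_inv. reflexivity. Qed.

Lemma Gamma_step (x : R) : Gamma x = / x * Gamma (x + 1).
Proof. unfold Gamma. rewrite rGamma_step Rinv_mult. reflexivity. Qed.

Lemma Gamma_fact (n : nat) : Gamma (INR n + 1) = INR (fact n).
Proof. unfold Gamma. rewrite rGamma_fact Rinv_inv. reflexivity. Qed.

Lemma rGamma_neg_nat (n : nat) : rGamma (- INR n) = 0.
Proof.
  induction n as [|n IH]; [rewrite rGamma_step; simpl; ring|].
  rewrite rGamma_step S_INR. replace (- (INR n + 1) + 1) with (- INR n) by ring. rewrite IH; ring.
Qed.

Open Scope C_scope.

(** * The finite sums *)

(* coefficient of (2 i z)^{-j} in sigma_n; it vanishes for j > n, where 1 / Gamma (n - j + 1) = 0 *)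
Definition sig_coef (n j : nat) : R :=
  (Gamma (1 / 2 - INR j) * Gamma (INR j + INR n) / Gamma (INR n - INR j + 1))%R.

Lemma sig_coef_eq (n j : nat) :
  sig_coef n j = (Gamma (1 / 2 - INR j) * Gamma (INR j + INR n) * rGamma (INR n - INR j + 1))%R.
Proof. unfold sig_coef, Rdiv. unfold Gamma at 3. rewrite Rinv_inv. reflexivity. Qed.

Lemma sig_coef_vanish (n j : nat) : (n < j)%nat -> sig_coef n j = 0%R.
Proof.
  intro H. rewrite sig_coef_eq.
  replace (INR n - INR j + 1)%R with (- INR (j - n - 1))%R.
  - rewrite rGamma_neg_nat; ring.
  - rewrite !minus_INR; try lia. simpl; ring.
Qed.

(** All Gamma factors reduce to those of [sig_coef n j]; with x = j and y = n - 1 what remains is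
    (x+y+2)(x+y+1) - (y-x)(y-x+1) = (2x+1)(2y+2), divided by - (x + 1/2). Using 1/Gamma for the
    denominator keeps j > n within the same computation. *)
Lemma sig_coef_rec (n j : nat) : (1 <= n)%nat ->
  (sig_coef (S n) (S j) - sig_coef (n - 1) (S j) = - (4 * INR n) * sig_coef n j)%R.
Proof.
  intro Hn. destruct n as [|n]; [lia|]. rewrite !sig_coef_eq.
  replace (S n - 1)%nat with n by lia. rewrite !S_INR.
  assert (hn := pos_INR n). assert (hj := pos_INR j).
  set (y := INR n) in *. set (x := INR j) in *.
  assert (hg : (1 / 2 - (x + 1) <> 0)%R).
  { unfold x. intro E. assert (E' : (IZR (- 1) = IZR (2 * Z.of_nat j))%R).
    { rewrite mult_IZR -INR_IZR_INZ. lra. }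
    apply eq_IZR in E'. lia. }
  rewrite (Gamma_step (1 / 2 - (x + 1))). replace (1 / 2 - (x + 1) + 1)%R with (1 / 2 - x)%R by ring.
  assert (G1 : Gamma (x + 1 + (y + 1 + 1)) = ((x + y + 2) * (x + y + 1) * Gamma (x + (y + 1)))%R).
  { rewrite (Gamma_step (x + (y + 1))) (Gamma_step (x + (y + 1) + 1)).
    replace (x + (y + 1) + 1 + 1)%R with (x + 1 + (y + 1 + 1))%R by ring. field. lra. }
  assert (G2 : Gamma (x + 1 + y) = Gamma (x + (y + 1))) by (f_equal; ring).
  assert (G3 : rGamma (y - (x + 1) + 1) = ((y - x) * (y - x + 1) * rGamma (y + 1 - x + 1))%R).
  { replace (y - (x + 1) + 1)%R with (y - x)%R by ring.
    rewrite rGamma_step (rGamma_step (y - x + 1)).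
    replace (y - x + 1 + 1)%R with (y + 1 - x + 1)%R by ring. ring. }
  replace (y + 1 + 1 - (x + 1) + 1)%R with (y + 1 - x + 1)%R by ring.
  rewrite G1 G2 G3. field. lra.
Qed.

(** The sum in [sigma_m] starts at j = 1, but the index shift in its recurrence uncovers j = 0; this
    value becomes the inhomogeneous term and cancels the prefactor 1/sqrt(PI). *)
Lemma sig_coef_0 (n : nat) : (1 <= n)%nat -> (INR n * sig_coef n 0 = sqrt PI)%R.
Proof.
  intro Hn. destruct n as [|n]; [lia|]. rewrite sig_coef_eq. simpl (INR 0).
  rewrite !Rminus_0_r Rplus_0_l Gamma_half rGamma_fact S_INR Gamma_fact fact_simpl mult_INR S_INR.
  assert (h := pos_INR n). field. split; [apply INR_fact_neq_0|lra].
Qed.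

(** The upper bound is separate from n so that the orders n - 1, n and n + 1 can be compared over
    matching ranges; terms beyond n vanish. *)
Definition sig_sum (n M : nat) (w : C) : C :=
  sum_n_m (G := C_AbelianMonoid) (fun j : nat => RtoC (sig_coef n j) * / w ^ j) 1 M.

Lemma sig_sum_S (n M : nat) (w : C) :
  sig_sum n (S M) w = sig_sum n M w + RtoC (sig_coef n (S M)) * / w ^ S M.
Proof. unfold sig_sum. rewrite sum_n_Sm; [reflexivity|lia]. Qed.

Lemma sig_sum_0 (n : nat) (w : C) : sig_sum n 0 w = 0.
Proof. unfold sig_sum. rewrite sum_n_m_zero; [reflexivity|lia]. Qed.

Lemma sig_sum_stable (n k : nat) (w : C) : sig_sum n (n + k) w = sig_sum n n w.
Proof.
  induction k as [|k IH]; [now rewrite Nat.add_0_r|].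
  rewrite Nat.add_succ_r sig_sum_S IH sig_coef_vanish; [|lia]. ring.
Qed.

Lemma sig_sum_partial (n M : nat) (w : C) : (1 <= n)%nat -> w <> 0 ->
  sig_sum (S n) (S M) w - sig_sum (n - 1) (S M) w
  = - (4 * RtoC (INR n)) / w * (RtoC (sig_coef n 0) + sig_sum n M w).
Proof.
  intros Hn Hw. 
  assert (R : forall j, RtoC (sig_coef (S n) (S j)) - RtoC (sig_coef (n - 1) (S j))
      = - (4 * RtoC (INR n)) * RtoC (sig_coef n j)).
  { intro j. rewrite -RtoC_minus sig_coef_rec // (RtoC_mult (- (4 * INR n))) RtoC_opp (RtoC_mult 4). reflexivity. }
  induction M as [|M IH].
  - rewrite !sig_sum_S !sig_sum_0.
    transitivity ((RtoC (sig_coef (S n) 1) - RtoC (sig_coef (n - 1) 1)) * / w ^ 1); [ring|].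
    rewrite R. simpl. field. exact Hw.
  - rewrite (sig_sum_S (S n)) (sig_sum_S (n - 1)) (sig_sum_S n M).
    transitivity (sig_sum (S n) (S M) w - sig_sum (n - 1) (S M) w
      + (RtoC (sig_coef (S n) (S (S M))) - RtoC (sig_coef (n - 1) (S (S M)))) * / w ^ S (S M)); [ring|].
    rewrite IH R (Cpow_S w (S M)). field. split; [apply Cpow_nz, Hw|exact Hw].
Qed.

Lemma sig_sum_rec (n : nat) (w : C) : (1 <= n)%nat -> w <> 0 ->
  sig_sum (S n) (S n) w - sig_sum (n - 1) (n - 1) w
  = - 4 / w * (RtoC (sqrt PI) + RtoC (INR n) * sig_sum n n w).
Proof.
  intros Hn Hw. assert (E := sig_sum_partial n n w Hn Hw).
  replace (sig_sum (n - 1) (S n) w) with (sig_sum (n - 1) (n - 1) w) in E.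
  - rewrite E -(sig_coef_0 n Hn) (RtoC_mult (INR n)). field. exact Hw.
  - rewrite -(sig_sum_stable (n - 1) 2). f_equal. lia.
Qed.

Lemma CpowZ_nat (a : C) (n : nat) : CpowZ a (Z.of_nat n) = a ^ n.
Proof. destruct n as [|n]; [reflexivity|]. change (a ^ Pos.to_nat (Pos.of_succ_nat n) = a ^ S n). rewrite SuccNat2Pos.id_succ. reflexivity. Qed.

Lemma CpowZ_opp_nat (a : C) (n : nat) : CpowZ a (- Z.of_nat n) = / a ^ n.
Proof.
  destruct n as [|n]; [simpl; field; apply C1_nz|].
  change (/ a ^ Pos.to_nat (Pos.of_succ_nat n) = / a ^ S n). rewrite SuccNat2Pos.id_succ. reflexivity.
Qed.

Lemma CpowZ_succ (a : C) (k : Z) : a <> 0 -> CpowZ a (k + 1) = a * CpowZ a k.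
Proof.
  intro Ha. destruct (Z.le_gt_cases 0 k) as [H|H].
  - replace k with (Z.of_nat (Z.to_nat k)) by lia. set (n := Z.to_nat k).
    replace (Z.of_nat n + 1)%Z with (Z.of_nat (S n)) by lia. rewrite !CpowZ_nat. reflexivity.
  - set (n := Z.to_nat (- k - 1)). replace k with (- Z.of_nat (S n))%Z by lia.
    replace (- Z.of_nat (S n) + 1)%Z with (- Z.of_nat n)%Z by lia.
    rewrite !CpowZ_opp_nat Cpow_S. field. split; [apply Cpow_nz, Ha|exact Ha].
Qed.

Lemma sigma_m_opp (m : Z) (z : C) : sigma_m (- m) z = sigma_m m z.
Proof.
  unfold sigma_m. replace (Z.abs_nat (- m)) with (Z.abs_nat m) by lia.
  replace (CpowZ (- (1)) (- m)) with (CpowZ (- (1)) m); [reflexivity|].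
  assert (G : forall n, / (- (1)) ^ n = (- (1)) ^ n).
  { induction n as [|n IH]; [simpl; field; apply C1_nz|].
    assert (N : - (1) <> 0).
    { intro E. apply (f_equal Re) in E. simpl in E. lra. }
    rewrite !Cpow_S. rewrite -{2}IH. field. apply Cpow_nz, N. }
  destruct (Z.le_gt_cases 0 m) as [H|H].
  - replace m with (Z.of_nat (Z.to_nat m)) by lia. rewrite CpowZ_nat CpowZ_opp_nat G. reflexivity.
  - replace m with (- Z.of_nat (Z.to_nat (- m)))%Z by lia. rewrite Z.opp_involutive CpowZ_nat CpowZ_opp_nat G. reflexivity.
Qed.

Lemma sigma_nat (n : nat) (z : C) :
  sigma_m (Z.of_nat n) z = (- (1)) ^ n / RtoC (sqrt PI) * Cexp (Ci * z) * sig_sum n n (2 * Ci * z).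
Proof. unfold sigma_m. rewrite Zabs2Nat.id CpowZ_nat. reflexivity. Qed.

Lemma Ci_nz : Ci <> 0.
Proof. intro E. apply (f_equal Im) in E. simpl in E. lra. Qed.

Lemma sqrt_PI_nz : RtoC (sqrt PI) <> 0.
Proof. apply RtoC_nz, Rgt_not_eq, sqrt_lt_R0, PI_RGT_0. Qed.

(** The prefactor (-1)^m has the same sign at n + 1 and n - 1, opposite to that at n. The last term
    is the exact counterpart of the source in [Vm_rec]. *)
Lemma sigma_rec (n : nat) (z : C) : (1 <= n)%nat -> z <> 0 ->
  sigma_m (Z.of_nat n + 1) z - sigma_m (Z.of_nat n - 1) z
  = 2 * RtoC (INR n) / (Ci * z) * sigma_m (Z.of_nat n) z + 2 / (Ci * z) * (- (1)) ^ n * Cexp (Ci * z).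
Proof.
  intros Hn Hz.
  assert (Hw : 2 * Ci * z <> 0).
  { apply Cmult_neq_0; [apply Cmult_neq_0; [exact C2_nz|exact Ci_nz]|exact Hz]. }
  replace (Z.of_nat n + 1)%Z with (Z.of_nat (S n)) by lia.
  replace (Z.of_nat n - 1)%Z with (Z.of_nat (n - 1)) by lia. rewrite !sigma_nat.
  assert (E := sig_sum_rec n _ Hn Hw).
  assert (P : (- (1)) ^ S n = - (- (1)) ^ n) by (rewrite Cpow_S; ring).
  assert (P' : (- (1)) ^ (n - 1) = - (- (1)) ^ n).
  { destruct n as [|n]; [lia|]. replace (S n - 1)%nat with n by lia. rewrite Cpow_S. ring. }
  rewrite P P'. set (w := 2 * Ci * z) in *.
  transitivity (- ((- (1)) ^ n / RtoC (sqrt PI) * Cexp (Ci * z) * (sig_sum (S n) (S n) w - sig_sum (n - 1) (n - 1) w))).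
  { field. exact sqrt_PI_nz. }
  rewrite E. unfold w. field. split; [exact Hz|split; [exact Ci_nz|exact sqrt_PI_nz]].
Qed.

Lemma sigma_0 (z : C) : sigma_m 0 z = 0.
Proof.
  change 0%Z with (Z.of_nat 0). rewrite sigma_nat sig_sum_0. ring.
Qed.

Lemma sigma_1 (z : C) : z <> 0 -> sigma_m 1 z = Cexp (Ci * z) / (Ci * z).
Proof.
  intro Hz. change 1%Z with (Z.of_nat 1). rewrite sigma_nat sig_sum_S sig_sum_0.
  assert (E : sig_coef 1 1 = (- (2 * sqrt PI))%R).
  { rewrite sig_coef_eq. change (INR 1) with 1%R. rewrite Gamma_step.
    replace (1 / 2 - 1 + 1)%R with (1 / 2)%R by field. rewrite Gamma_half.
    replace (1 - 1 + 1)%R with 1%R by ring. rewrite rGamma_1.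
    assert (G := Gamma_fact 1). change (INR 1) with 1%R in G. rewrite G. simpl. field. }
  rewrite E RtoC_opp (RtoC_mult 2). simpl Cpow.
  field. split; [exact Hz|split; [exact Ci_nz|exact sqrt_PI_nz]].
Qed.

(** * The recurrence in the order *)

Definition cosm (m : Z) (th : R) : C := RtoC (cos (IZR m * th)).
Definition cosm' (m : Z) (th : R) : C := RtoC (- (IZR m * sin (IZR m * th))).
Definition sinm (m : Z) (th : R) : C := RtoC (sin (IZR m * th)).
Definition sinm' (m : Z) (th : R) : C := RtoC (IZR m * cos (IZR m * th)).

Lemma cosm_der (m : Z) (th : R) : Cder (cosm m) th (cosm' m th).
Proof. apply (Cder_RtoC (fun th => cos (IZR m * th))). auto_derive; [exact I|ring]. Qed.

Lemma sinm_der (m : Z) (th : R) : Cder (sinm m) th (sinm' m th).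
Proof. apply (Cder_RtoC (fun th => sin (IZR m * th))). auto_derive; [exact I|ring]. Qed.

Lemma cosm_cont (m : Z) (th : R) : Ccont (cosm m) th.
Proof. eapply Cder_Ccont, cosm_der. Qed.

Lemma cosm'_cont (m : Z) (th : R) : Ccont (cosm' m) th.
Proof. apply Ccont_RtoC, @ex_derive_continuous. auto_derive. exact I. Qed.

Lemma sinm'_cont (m : Z) (th : R) : Ccont (sinm' m) th.
Proof. apply Ccont_RtoC, @ex_derive_continuous. auto_derive. exact I. Qed.

Lemma sinm_PI (m : Z) : sinm m PI = 0.
Proof. unfold sinm. f_equal. apply sin_eq_0_1. exists m. reflexivity. Qed.

Lemma sinm_0 (m : Z) : sinm m 0 = 0.
Proof. unfold sinm. rewrite Rmult_0_r sin_0. reflexivity. Qed.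

Definition Vm (z : C) (m : Z) : C := Wf z (cosm m) (cosm' m) 1.
Definition Jm (z : C) (m : Z) : C := Jf z (cosm m) 1.

Lemma Vm_prim (z : C) (m : Z) : has_prim (fun th => cosm m th * Qf z 1 th) (Vm z m).
Proof. exact (Wf_prim z (cosm m) (cosm' m) 1 (cosm_der m) (cosm'_cont m)). Qed.

Lemma Jm_prim (z : C) (m : Z) : has_prim (fun th => cosm m th * ez z 1 th) (Jm z m).
Proof. exact (Jf_prim z (cosm m) 1 (cosm_cont m)). Qed.

Lemma cosm_prod (m : Z) (th : R) :
  sinm m th * RtoC (sin th) = (cosm (m - 1) th - cosm (m + 1) th) / 2.
Proof.
  unfold sinm, cosm. rewrite -RtoC_mult -RtoC_minus -RtoC_div; [|lra]. f_equal.
  rewrite minus_IZR plus_IZR.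
  replace ((IZR m - 1) * th)%R with (IZR m * th - th)%R by ring.
  replace ((IZR m + 1) * th)%R with (IZR m * th + th)%R by ring.
  rewrite cos_minus cos_plus. field.
Qed.

(* By induction, sin (m th) tan (th / 2) is a trigonometric polynomial. *)
Lemma tan_half_sin_rec (m : Z) (th : R) : (- PI < th < PI)%R ->
  sinm (m + 1) th * RtoC (tan_half th)
  = - (sinm m th * RtoC (tan_half th)) + (cosm m th - cosm (m + 1) th).
Proof.
  intro H. assert (P := one_plus_cos_pos th H). unfold sinm, cosm, tan_half.
  rewrite -!RtoC_mult -RtoC_minus -RtoC_opp -RtoC_plus. f_equal.
  rewrite plus_IZR. replace ((IZR m + 1) * th)%R with (IZR m * th + th)%R by ring.
  rewrite sin_plus cos_plus. set (a := (IZR m * th)%R).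
  assert (E := sin2_cos2 th). unfold Rsqr in E.
  apply Rmult_eq_reg_r with (1 + cos th)%R; [|lra].
  field_simplify; [|lra|lra].
  replace (sin th ^ 2)%R with (1 - cos th * cos th)%R by lra. ring.
Qed.

Lemma has_prim_cosm (n : nat) : (1 <= n)%nat -> has_prim (cosm (Z.of_nat n)) 0.
Proof.
  intro Hn. apply: has_prim_ext (has_prim_cos n Hn). intros th _. unfold cosm. rewrite INR_IZR_INZ. reflexivity.
Qed.

(** Each step reverses the sign of the previous integrand and adds cosines of zero integral; the
    start is sin th tan(th/2) = 1 - cos th. *)
Lemma has_prim_tan_half_sin (n : nat) :
  has_prim (fun th => sinm (Z.of_nat (S n)) th * RtoC (tan_half th)) (RtoC PI * (- (1)) ^ n).
Proof.
  induction n as [|n IH].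
  - apply (has_prim_ext (fun th => 1 + - (1) * cosm (Z.of_nat 1) th)).
    + intros th Hth. change (Z.of_nat 1) with (0 + 1)%Z. rewrite tan_half_sin_rec //.
      unfold sinm, cosm. rewrite !Rmult_0_l sin_0 cos_0. ring.
    + simpl Cpow. replace (RtoC PI * 1) with (1 * RtoC PI + - (1) * 0) by ring.
      apply has_prim_plus; [apply has_prim_const|apply has_prim_scal, has_prim_cosm; lia].
  - apply (has_prim_ext (fun th => - (1) * (sinm (Z.of_nat (S n)) th * RtoC (tan_half th))
       + (cosm (Z.of_nat (S n)) th + - (1) * cosm (Z.of_nat (S (S n))) th))).
    + intros th Hth. replace (Z.of_nat (S (S n))) with (Z.of_nat (S n) + 1)%Z by lia.
      rewrite tan_half_sin_rec //. ring.
    + rewrite Cpow_S. replace (RtoC PI * (- (1) * (- (1)) ^ n)) with (- (1) * (RtoC PI * (- (1)) ^ n) + (0 + - (1) * 0)) by ring.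
      apply has_prim_plus; [apply has_prim_scal, IH|].
      apply has_prim_plus; [|apply has_prim_scal]; apply has_prim_cosm; lia.
Qed.

Lemma sinm'_nat (n : nat) (th : R) : sinm' (Z.of_nat n) th = RtoC (INR n) * cosm (Z.of_nat n) th.
Proof. unfold sinm', cosm. rewrite INR_IZR_INZ. apply RtoC_mult. Qed.

(** By parts against sin(n th): the boundary terms vanish, sin(n th) sin th splits into the two
    neighbouring orders, and the source is e^{i z} times the integral of sin(n th) tan(th/2). *)
Lemma Vm_rec (z : C) (n : nat) : (1 <= n)%nat ->
  RtoC (INR n) * Vm z (Z.of_nat n) + Ci * z / 2 * (Vm z (Z.of_nat n - 1) - Vm z (Z.of_nat n + 1))
  = Cexp (Ci * z) * (RtoC PI * (- (1)) ^ (n - 1)).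
Proof.
  intro Hn. set (m := Z.of_nat n).
  assert (H := Qf_by_parts (sinm m) (sinm' m) z 1 (sinm_der m) (sinm'_cont m) (sinm_PI m)).
  rewrite sinm_0 in H. replace (- (0 * Qf z 1 0)) with (RtoC 0) in H by ring.
  assert (T : has_prim (fun th => sinm m th * RtoC (tan_half th)) (RtoC PI * (- (1)) ^ (n - 1))).
  { assert (T := has_prim_tan_half_sin (n - 1)). replace (S (n - 1)) with n in T by lia. exact T. }
  assert (K := has_prim_plus _ _ _ _ (has_prim_scal (RtoC (INR n)) _ _ (Vm_prim z m))
     (has_prim_plus _ _ _ _ (has_prim_scal (Ci * z / 2) _ _ (has_prim_plus _ _ _ _ (Vm_prim z (m - 1))
         (has_prim_scal (- (1)) _ _ (Vm_prim z (m + 1)))))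
       (has_prim_scal (- Cexp (Ci * z)) _ _ T))).
  assert (E : RtoC (INR n) * Vm z m + (Ci * z / 2 * (Vm z (m - 1) + - (1) * Vm z (m + 1))
      + - Cexp (Ci * z) * (RtoC PI * (- (1)) ^ (n - 1))) = 0).
  { apply (has_prim_unique _ _ _ K). apply: has_prim_ext H. intros th _.
    replace (Ci * z * RtoC 1) with (Ci * z) by ring.
    transitivity (sinm' m th * Qf z 1 th + Ci * z * (sinm m th * RtoC (sin th)) * Qf z 1 th
      - Cexp (Ci * z) * (sinm m th * RtoC (tan_half th))); [ring|].
    rewrite cosm_prod. rewrite sinm'_nat -/m. field. }
  match type of E with _ + (_ + - ?e * ?p) = _ =>
    match type of E with ?a = _ => transitivity (a + e * p); [field|rewrite E; ring] end end.
Qed.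

Lemma Jm_rec (z : C) (n : nat) :
  RtoC (INR n) * Jm z (Z.of_nat n) + Ci * z / 2 * (Jm z (Z.of_nat n - 1) - Jm z (Z.of_nat n + 1)) = 0.
Proof.
  set (m := Z.of_nat n).
  assert (H := ez_by_parts (sinm m) (sinm' m) z 1 (sinm_der m) (sinm'_cont m)).
  rewrite sinm_0 sinm_PI in H. replace (0 * ez z 1 PI - 0 * ez z 1 0) with (RtoC 0) in H by ring.
  replace (Jm z (m - 1) - Jm z (m + 1)) with (Jm z (m - 1) + - (1) * Jm z (m + 1)) by ring.
  assert (K := has_prim_plus _ _ _ _ (has_prim_scal (RtoC (INR n)) _ _ (Jm_prim z m))
     (has_prim_scal (Ci * z / 2) _ _ (has_prim_plus _ _ _ _ (Jm_prim z (m - 1))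
         (has_prim_scal (- (1)) _ _ (Jm_prim z (m + 1)))))).
  apply (has_prim_unique _ _ _ K). apply: has_prim_ext H. intros th _.
  transitivity (sinm' m th * ez z 1 th + Ci * z * (sinm m th * RtoC (sin th)) * ez z 1 th); [ring|].
  rewrite cosm_prod. rewrite sinm'_nat -/m. field.
Qed.

Lemma cosm_opp (m : Z) (th : R) : cosm (- m) th = cosm m th.
Proof. unfold cosm. rewrite opp_IZR Ropp_mult_distr_l_reverse cos_neg. reflexivity. Qed.

Lemma Vm_opp (z : C) (m : Z) : Vm z (- m) = Vm z m.
Proof.
  apply (has_prim_unique (fun th => cosm m th * Qf z 1 th)); [|apply Vm_prim].
  apply (has_prim_ext (fun th => cosm (- m) th * Qf z 1 th)); [|apply Vm_prim].
  intros; now rewrite cosm_opp.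
Qed.

Lemma Jm_opp (z : C) (m : Z) : Jm z (- m) = Jm z m.
Proof.
  apply (has_prim_unique (fun th => cosm m th * ez z 1 th)); [|apply Jm_prim].
  apply (has_prim_ext (fun th => cosm (- m) th * ez z 1 th)); [|apply Jm_prim].
  intros; now rewrite cosm_opp.
Qed.

Lemma Vm_0 (z : C) : Vm z 0 = W0 z 1.
Proof.
  apply (has_prim_unique (fun th => one_f th * Qf z 1 th)); [|apply W0_prim].
  apply (has_prim_ext (fun th => cosm 0 th * Qf z 1 th)); [|apply Vm_prim].
  intros; unfold cosm, one_f. now rewrite Rmult_0_l cos_0.
Qed.

Lemma Vm_1 (z : C) : Vm z 1 = W1 z 1.
Proof.
  apply (has_prim_unique (fun th => cos_f th * Qf z 1 th)); [|apply W1_prim].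
  apply (has_prim_ext (fun th => cosm 1 th * Qf z 1 th)); [|apply Vm_prim].
  intros; unfold cosm, cos_f. now rewrite Rmult_1_l.
Qed.

Lemma Jm_0 (z : C) : Jm z 0 = RtoC PI * CPS (bser 0 (bq z)) 1.
Proof.
  destruct (Jf_series z 1 Rlt_0_1) as [E _]. rewrite Rmult_1_l in E. rewrite -E.
  apply (has_prim_unique (fun th => one_f th * ez z 1 th)); [|apply Jf_prim; intro; apply Ccont_const].
  apply (has_prim_ext (fun th => cosm 0 th * ez z 1 th)); [|apply Jm_prim].
  intros; unfold cosm, one_f. now rewrite Rmult_0_l cos_0.
Qed.

Lemma Jm_1 (z : C) : Jm z 1 = RtoC PI * (- Ci * z / 2 * CPS (bser 1 (bq z)) 1).
Proof.
  destruct (Jf_series z 1 Rlt_0_1) as [_ E]. rewrite Rmult_1_l in E.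
  transitivity (Jf z cos_f 1); [|rewrite E; ring].
  apply (has_prim_unique (fun th => cos_f th * ez z 1 th)); [|apply Jf_prim; apply Ccont_cos].
  apply (has_prim_ext (fun th => cosm 1 th * ez z 1 th)); [|apply Jm_prim].
  intros; unfold cosm, cos_f. now rewrite Rmult_1_l.
Qed.

(** * Assembling the integral representations *)

Lemma Ci_sq : Ci * Ci = - (1).
Proof. apply C_ext; simpl; ring. Qed.

Lemma CpowZ_Ci_opp (n : nat) (k : Z) : CpowZ Ci (- Z.of_nat n + k) = (- (1)) ^ n * CpowZ Ci (Z.of_nat n + k).
Proof.
  induction n as [|n IH]; [simpl; ring|].
  assert (A : CpowZ Ci (- Z.of_nat n + k) = Ci * CpowZ Ci (- Z.of_nat (S n) + k)).
  { rewrite -CpowZ_succ; [|exact Ci_nz]. f_equal. lia. }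
  assert (B : CpowZ Ci (Z.of_nat (S n) + k) = Ci * CpowZ Ci (Z.of_nat n + k)).
  { rewrite -CpowZ_succ; [|exact Ci_nz]. f_equal. lia. }
  rewrite B Cpow_S.
  transitivity (- Ci * (Ci * CpowZ Ci (- Z.of_nat (S n) + k))); [ring [Ci_sq]|].
  rewrite -A IH. ring.
Qed.

(** The value of the first integral of the theorem: the part of Gamma(0, w) constant in th
    multiplies Bessel's integral, and the varying part is - [Vm]. *)
Definition Fm (z : C) (m : Z) : C :=
  (- RtoC EulerMascheroni - Cln z + Ci * RtoC PI / 2) * Jm z m - Vm z m.

Lemma RtoC_PI_nz : RtoC PI <> 0.
Proof. apply RtoC_nz, PI_neq0. Qed.

(** Bessel's integral in all integer orders, by the recurrence from m = 0 and 1; the second Hankel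
    function is reached through it. *)
Lemma BesselJ_integral (m : Z) (z : C) : z <> 0 ->
  BesselJ (IZR m) z = CpowZ Ci m / RtoC PI * Jm z m.
Proof.
  intro Hz. assert (HP := RtoC_PI_nz).
  apply (rec_agree (2 / z) (fun m => BesselJ (IZR m) z) (fun m => CpowZ Ci m / RtoC PI * Jm z m)).
  - intro k. rewrite BesselJ_IZR_rec //. field. exact Hz.
  - intros n Hn. assert (E := Jm_rec z n).
    set (k := Z.of_nat n) in *.
    assert (A : CpowZ Ci k = Ci * CpowZ Ci (k - 1)).
    { rewrite -CpowZ_succ; [|exact Ci_nz]. f_equal. lia. }
    rewrite (CpowZ_succ Ci k Ci_nz) A.
    assert (X : Jm z (k + 1) = Jm z (k - 1) + 2 * RtoC (INR n) / (Ci * z) * Jm z k).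
    { transitivity (Jm z (k - 1) + 2 / (Ci * z) * (RtoC (INR n) * Jm z k - 0)).
      - rewrite -E. field. split; [exact Hz|exact Ci_nz].
      - field. split; [exact Hz|exact Ci_nz]. }
    rewrite X. field [Ci_sq]. repeat split; try assumption; exact Ci_nz.
  - intro n. rewrite Jm_opp. assert (A := CpowZ_Ci_opp n 0). rewrite !Z.add_0_r in A. rewrite A. field. exact HP.
  - rewrite (BesselJ_01 0 z ltac:(lia) Hz : BesselJ 0 z = _) Jm_0 -/(bq z).
    change (CpowZ Ci 0) with (RtoC 1). change ((z / 2) ^ 0) with (RtoC 1). field. exact HP.
  - rewrite (BesselJ_01 1 z ltac:(lia) Hz : BesselJ 1 z = _) Jm_1 -/(bq z).
    change (CpowZ Ci 1) with (Ci * 1). rewrite Cpow_1_r. field [Ci_sq]. exact HP.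
Qed.

Lemma Hankel1_integral (m : Z) (z : C) : z <> 0 ->
  Hankel1 m z = 2 * CpowZ Ci (m - 1) / RtoC PI * (1 / RtoC PI * Fm z m + sigma_m m z).
Proof.
  intro Hz. assert (HP := RtoC_PI_nz). assert (Hi := Ci_nz). assert (L := Cln_half z Hz).
  apply (rec_agree (2 / z) (fun m => Hankel1 m z)
    (fun m => 2 * CpowZ Ci (m - 1) / RtoC PI * (1 / RtoC PI * Fm z m + sigma_m m z))).
  - intro k. rewrite Hankel1_rec //. field. exact Hz.
  - intros n Hn. assert (E := Jm_rec z n). assert (E' := Vm_rec z n Hn). assert (S := sigma_rec n z Hn Hz).
    assert (P : (- (1)) ^ n = - (- (1)) ^ (n - 1)).
    { destruct n as [|n]; [lia|]. replace (Datatypes.S n - 1)%nat with n by lia. rewrite Cpow_S. ring. }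
    set (k := Z.of_nat n) in *.
    assert (A : CpowZ Ci k = Ci * CpowZ Ci (k - 1)).
    { rewrite -CpowZ_succ; [|exact Ci_nz]. f_equal. lia. }
    assert (B : CpowZ Ci (k - 1) = Ci * CpowZ Ci (k - 1 - 1)).
    { rewrite -CpowZ_succ; [|exact Ci_nz]. f_equal. lia. }
    replace (k + 1 - 1)%Z with k by lia. rewrite A B.
    (* [Jm_rec] is homogeneous, so the constant factor c does not matter and the only source comes
       from [Vm_rec]. *)
    assert (X : Fm z (k + 1) = Fm z (k - 1) + 2 * RtoC (INR n) / (Ci * z) * Fm z k
        + 2 / (Ci * z) * (Cexp (Ci * z) * (RtoC PI * (- (1)) ^ (n - 1)))).
    { rewrite -E'. unfold Fm.
      set (c := - RtoC EulerMascheroni - Cln z + Ci * RtoC PI / 2).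
      transitivity (c * Jm z (k + 1) - Vm z (k + 1) + c * (2 / (Ci * z)) * 0); [ring|].
      rewrite -E. field. split; assumption. }
    assert (Y : sigma_m (k + 1) z = sigma_m (k - 1) z + (2 * RtoC (INR n) / (Ci * z) * sigma_m k z
       + 2 / (Ci * z) * (- (1)) ^ n * Cexp (Ci * z))) by (rewrite -S; ring).
    (* After the factor 1/PI, the source in [X] is (2/(i z)) e^{i z} (-1)^{n-1} and the one in [Y]
       is its opposite, so the homogeneous Bessel recurrence remains. *)
    rewrite X Y P. field [Ci_sq]. repeat split; assumption.
  - intro n. rewrite sigma_m_opp. unfold Fm. rewrite Jm_opp Vm_opp.
    assert (A := CpowZ_Ci_opp n (-1)). 
    replace (- Z.of_nat n - 1)%Z with (- Z.of_nat n + -1)%Z by lia.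
    replace (Z.of_nat n - 1)%Z with (Z.of_nat n + -1)%Z by lia. rewrite A. field. exact HP.
  - rewrite Hankel1_0 // L sigma_0. unfold Fm. rewrite Jm_0 Vm_0 (proj1 (W_series z Hz)).
    fold (bq z). change (CpowZ Ci (0 - 1)) with (/ Ci ^ 1).
    simpl Cpow. field [Ci_sq]. repeat split; assumption.
  - rewrite Hankel1_1 // L sigma_1 //. unfold Fm. rewrite Jm_1 Vm_1 (proj2 (W_series z Hz)).
    fold (bq z). change (CpowZ Ci (1 - 1)) with (RtoC 1).
    field [Ci_sq]. repeat split; assumption.
Qed.

Lemma Fm_prim (m : Z) (z : C) :
  has_prim (fun theta : R =>
       Cexp (- Ci * z * RtoC (cos theta))
       * Gamma0_mi (1 + cos theta)%R z
       * RtoC (cos (IZR m * theta)%R)) (Fm z m).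
Proof.
  set (c := - RtoC EulerMascheroni - Cln z + Ci * RtoC PI / 2).
  apply (has_prim_ext (fun th => c * (cosm m th * ez z 1 th) + - (1) * (cosm m th * Qf z 1 th))).
  - intros th _. rewrite Gamma0_mi_einc. unfold Qf, ln1pcos. fold (cosm m th).
    replace (Cexp (- Ci * z * RtoC (cos th))) with (ez z 1 th) by (unfold ez; f_equal; ring).
    rewrite Rmult_1_l. unfold c. unfold Cdiv; ring.
  - replace (Fm z m) with (c * Jm z m + - (1) * Vm z m) by (unfold Fm; fold c; ring).
    apply has_prim_plus; apply has_prim_scal; [apply Jm_prim|apply Vm_prim].
Qed.

Theorem mainTheorem7 (m : Z) (z : C) (hz : ~ (Im z = 0%R /\ (Re z <= 0)%R)) :
  (exists I1 : C,
     is_CInt_0_PI (fun theta : R =>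
       Cexp (- Ci * z * RtoC (cos theta))
       * Gamma0_mi (1 + cos theta)%R z
       * RtoC (cos (IZR m * theta)%R)) I1
     /\ Hankel1 m z
        = 2 * CpowZ Ci (m - 1) / RtoC PI * (1 / RtoC PI * I1 + sigma_m m z))
  /\
  (exists I2 : C,
     is_CInt_0_PI (fun theta : R =>
       Cexp (- Ci * z * RtoC (cos theta))
       * (Gamma0_mi (1 + cos theta)%R z - Ci * RtoC PI)
       * RtoC (cos (IZR m * theta)%R)) I2
     /\ Hankel2 m z
        = - (2 * CpowZ Ci (m - 1) / RtoC PI) * (1 / RtoC PI * I2 + sigma_m m z)).
Proof.
  assert (Hz : z <> 0).
  { intros ->. apply hz. simpl; split; lra. }
  assert (H1 := Hankel1_integral m z Hz).
  split.
  - exists (Fm z m). split; [apply has_prim_is_CInt, Fm_prim|exact H1].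
  - exists (Fm z m + - (Ci * RtoC PI) * Jm z m). split.
    + apply has_prim_is_CInt.
      apply (has_prim_ext (fun th => Cexp (- Ci * z * RtoC (cos th)) * Gamma0_mi (1 + cos th)%R z
         * RtoC (cos (IZR m * th)%R) + - (Ci * RtoC PI) * (cosm m th * ez z 1 th))).
      * intros th _. unfold cosm, ez.
        replace (- Ci * z * RtoC 1 * RtoC (cos th)) with (- Ci * z * RtoC (cos th)) by ring. ring.
      * apply has_prim_plus; [apply Fm_prim|apply has_prim_scal, Jm_prim].
    + assert (HJ := BesselJ_integral m z Hz).
      (* The summand - i PI contributes - i PI [Jm] to the integral, which the prefactor - 2
         i^{m-1}/PI^2 turns into 2 J_m. *)
      assert (E : Hankel2 m z = 2 * BesselJ (IZR m) z - Hankel1 m z) by (unfold Hankel1, Hankel2; ring).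
      rewrite E H1 HJ.
      assert (A : CpowZ Ci m = Ci * CpowZ Ci (m - 1)).
      { rewrite -CpowZ_succ; [|exact Ci_nz]. f_equal. lia. }
      rewrite A. field. exact RtoC_PI_nz.
Qed.
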